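(* Let $N\ge3$, $2^*=2N/(N-2)$, and let $V_\infty>0$ be a constant. Assume that $f\in\mathcal{C}(\mathbb{R},\mathbb{R})$, that there is a constant $\mathcal{C}_0>0$ with $|f(t)|\le\mathcal{C}_0(1+|t|^{2^*-1})$ for all $t\in\mathbb{R}$, that $f(t)=o(t)$ as $t\to0$ and $|f(t)|=o(|t|^{(N+2)/(N-2)})$ as $|t|\to+\infty$, and that there exists $s_0>0$ such that $F(s_0)>\frac12V_\infty s_0^2$, where $F(t)=\int_0^tf(s)\,ds$. Then the problem $-\Delta u+V_\infty u=f(u)$ in $\mathbb{R}^N$, $u\in H^1(\mathbb{R}^N)$, has a solution $\bar u\in H^1(\mathbb{R}^N)$ such that $$I^\infty(\bar u)=\inf_{\mathcal{M}^\infty}I^\infty=\inf_{u\in\Lambda}\max_{t>0}I^\infty(u_t)>0.$$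
   Context: Solutions are understood in the weak sense, i.e. as critical points of the energy functional on $H^1(\mathbb{R}^N)$ $$I^\infty(u)=\frac12\int_{\mathbb{R}^N}\left(|\nabla u|^2+V_\infty u^2\right)dx-\int_{\mathbb{R}^N}F(u)\,dx.$$ The Pohožaev functional is $$\mathcal{P}^\infty(u)=\frac{N-2}{2}\|\nabla u\|_2^2+\frac{NV_\infty}{2}\|u\|_2^2-N\int_{\mathbb{R}^N}F(u)\,dx,$$ and $\mathcal{M}^\infty=\{u\in H^1(\mathbb{R}^N)\setminus\{0\}:\mathcal{P}^\infty(u)=0\}$. For $t>0$, $u_t(x):=u(x/t)$. Also $$\Lambda=\left\{u\in H^1(\mathbb{R}^N):\int_{\mathbb{R}^N}\left[\tfrac12V_\infty u^2-F(u)\right]dx<0\right\}.$$ *)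

(* Defs.v *)
From HB Require Import structures.
From mathcomp Require Import all_boot all_order all_algebra.
From mathcomp Require Import all_classical all_reals all_analysis.

Set Implicit Arguments.
Unset Strict Implicit.
Unset Printing Implicit Defensive.

Import Order.TTheory GRing.Theory Num.Def Num.Theory.
Import numFieldNormedType.Exports.

Local Open Scope classical_set_scope.
Local Open Scope ring_scope.

Section measurable_rV.
Context {R : realType}.
Variable n : nat.

Definition rV_coor (i : 'I_n) (x : 'rV[R]_n) : R := x ord0 i.

Let rV_set0 : g_sigma_preimage rV_coor set0.
Proof. exact: sigma_algebra0. Qed.

Let rV_setC A : g_sigma_preimage rV_coor A -> g_sigma_preimage rV_coor (~` A).
Proof. exact: sigma_algebraC. Qed.

Let rV_bigcup (F : _^nat) : (forall i, g_sigma_preimage rV_coor (F i)) ->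
  g_sigma_preimage rV_coor (\bigcup_i (F i)).
Proof. exact: sigma_algebra_bigcup. Qed.

(* As for tuples in the library, the sigma-algebra on R^n is generated by the
   coordinates: it is the Borel sigma-algebra. *)
HB.instance Definition _ := @isMeasurable.Build default_measure_display
  'rV[R]_n (g_sigma_preimage rV_coor) rV_set0 rV_setC rV_bigcup.

Lemma measurable_rV_coor (i : 'I_n) : measurable_fun [set: 'rV[R]_n] (rV_coor i).
Proof.
move=> _ Y mY; rewrite setTI; apply: sub_sigma_algebra => /=.
rewrite -bigcup_seq/=; exists i => /=; first by rewrite mem_index_enum.
by exists Y => //; rewrite setTI.
Qed.

Lemma measurable_fun_rVP d (T : measurableType d) (f : T -> 'rV[R]_n) :
  (forall i, measurable_fun [set: T] (rV_coor i \o f)) ->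
  measurable_fun [set: T] f.
Proof.
move=> mf.
suff prefS : g_sigma_preimage (fun i => rV_coor i \o f) `<=` measurable.
  move=> _ A mA; apply: prefS.
  by rewrite g_sigma_preimage_comp; exists A.
apply: smallest_sub; first exact: sigma_algebra_measurable.
rewrite -bigcup_seq; apply: bigcup_sub => i Ii.
by move=> A [B mB <-]; exact: mf.
Qed.

End measurable_rV.

Section lebesgue_rV_succ.
Context {R : realType} (n : nat).
Variable mu : {sigma_finite_measure set 'rV[R]_n -> \bar R}.

Definition rV_cons (p : measurableTypeR R * 'rV[R]_n) : 'rV[R]_n.+1 :=
  row_mx (p.1 : R)%:M p.2 : 'rV[R]_(1 + n).

Definition rV_uncons (x : 'rV[R]_n.+1) : measurableTypeR R * 'rV[R]_n :=
  (x ord0 ord0, rsubmx (x : 'rV[R]_(1 + n))).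

Lemma rV_cons0 p : rV_cons p ord0 ord0 = p.1.
Proof.
transitivity (row_mx (p.1 : R)%:M p.2 ord0 (lshift n (ord0 : 'I_1))).
  by congr (row_mx _ _ _ _); exact/val_inj.
by rewrite row_mxEl mxE eqxx mulr1n.
Qed.

Lemma rV_consS p (j : 'I_n) : rV_cons p ord0 (lift ord0 j) = p.2 ord0 j.
Proof.
transitivity (row_mx (p.1 : R)%:M p.2 ord0 (rshift 1 j)).
  by congr (row_mx _ _ _ _); exact/val_inj.
by rewrite row_mxEr.
Qed.

Lemma rV_consK : cancel rV_cons rV_uncons.
Proof.
move=> [a v]; rewrite /rV_uncons rV_cons0 /=; congr pair.
by rewrite /rV_cons row_mxKr.
Qed.

Lemma measurable_rV_cons : measurable_fun setT rV_cons.
Proof.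
apply: measurable_fun_rVP => i; have [j ->|->] := unliftP ord0 i; last first.
  rewrite (_ : _ \o _ = @fst (measurableTypeR R) 'rV[R]_n); last first.
    by apply/funext => p; rewrite /= /rV_coor rV_cons0.
  exact: (@measurable_fst _ _ (measurableTypeR R) 'rV[R]_n).
rewrite (_ : _ \o _ = rV_coor j \o @snd (measurableTypeR R) 'rV[R]_n); last first.
  by apply/funext => p; rewrite /= /rV_coor rV_consS.
by apply: measurableT_comp => //; exact: measurable_rV_coor.
Qed.

Lemma measurable_rV_uncons : measurable_fun setT rV_uncons.
Proof.
apply/measurable_fun_pairP; split.
  exact: (@measurable_rV_coor R n.+1 ord0).
apply: measurable_fun_rVP => i.
rewrite (_ : _ \o _ = rV_coor (lift ord0 i)).
  exact: measurable_rV_coor.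
apply/funext => x; rewrite /rV_coor /= mxE; congr (x _ _); exact/val_inj.
Qed.

Definition lebesgue_rV_succ : set 'rV[R]_n.+1 -> \bar R :=
  pushforward (lebesgue_measure \x mu)%E rV_cons.

Let mcons := measurable_rV_cons.

Let lebesgue_rV_succ0 : lebesgue_rV_succ set0 = 0%E.
Proof. exact: measure0. Qed.

Let lebesgue_rV_succ_ge0 A : (0 <= lebesgue_rV_succ A)%E.
Proof. exact: measure_ge0. Qed.

Let lebesgue_rV_succ_sigma_additive : semi_sigma_additive lebesgue_rV_succ.
Proof. exact: measure_semi_sigma_additive. Qed.

HB.instance Definition _ := isMeasure.Build _ _ _ lebesgue_rV_succ
  lebesgue_rV_succ0 lebesgue_rV_succ_ge0 lebesgue_rV_succ_sigma_additive.

Let lebesgue_rV_succ_sigma_finite : sigma_finite setT lebesgue_rV_succ.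
Proof.
have /sigma_finiteP[F [TF ndF Foo]] := sigma_finiteT (@lebesgue_measure R).
have /sigma_finiteP[G [TG ndG Goo]] := sigma_finiteT mu.
exists (fun k => rV_uncons @^-1` (F k `*` G k)).
  rewrite -preimage_bigcup (_ : \bigcup_k _ = setT) ?preimage_setT//.
  rewrite -setXTT TF TG predeqE => -[x y]; split.
    by move=> [k _ []/= ? ?]; split; exists k.
  move=> [/= [k _ Fkx] [l _ Gly]]; exists (maxn k l) => //; split.
  - by move: x Fkx; exact/subsetPset/ndF/leq_maxl.
  - by move: y Gly; exact/subsetPset/ndG/leq_maxr.
move=> k; have [mF Fk] := Foo k; have [mG Gk] := Goo k; split.
  rewrite -[X in measurable X]setTI; apply: measurable_rV_uncons => //.
  exact: measurableX.
rewrite /lebesgue_rV_succ /pushforward -comp_preimage.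
rewrite (_ : rV_uncons \o rV_cons = id); last first.
  by apply/funext => p /=; rewrite rV_consK.
by rewrite preimage_id product_measure1E// lte_mul_pinfty// ge0_fin_numE//.
Qed.

HB.instance Definition _ := Measure_isSigmaFinite.Build _ _ _ lebesgue_rV_succ
  lebesgue_rV_succ_sigma_finite.

End lebesgue_rV_succ.

Fixpoint lebesgue_rV {R : realType} (n : nat) :
    {sigma_finite_measure set 'rV[R]_n -> \bar R} :=
  match n return {sigma_finite_measure set 'rV[R]_n -> \bar R} with
  | 0%N => \d_ (0 : 'rV[R]_0)
  | n'.+1 => lebesgue_rV_succ (lebesgue_rV n')
  end.

Lemma lebesgue_rV_box (R : realType) (n : nat) (a b : 'rV[R]_n) :
  (forall i, a ord0 i <= b ord0 i) ->
  lebesgue_rV n [set x | forall i, a ord0 i <= x ord0 i <= b ord0 i] =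
  (\prod_i (b ord0 i - a ord0 i))%:E.
Proof.
elim: n a b => [|n IH] a b ab.
  by rewrite big_ord0 /= diracE mem_set//= => -[].
pose a' := \row_j a ord0 (lift ord0 j); pose b' := \row_j b ord0 (lift ord0 j).
rewrite /= /lebesgue_rV_succ /pushforward.
rewrite (_ : _ @^-1` _ = `[a ord0 ord0, b ord0 ord0] `*`
  [set x : 'rV[R]_n | forall i, a' ord0 i <= x ord0 i <= b' ord0 i]).
  rewrite product_measure1E//; last first.
    rewrite (_ : mkset _ = \bigcap_(i in [set: 'I_n])
      (setT `&` rV_coor i @^-1` `[a' ord0 i, b' ord0 i])); last first.
      apply/seteqP; split => [x /= h i _|x /= h i].
        by split => //=; rewrite in_itv/=; exact: h.
      by have [_] := h i I; rewrite /= in_itv.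
    apply: fin_bigcap_measurable => // i _.
    exact: (measurable_rV_coor i).
  rewrite IH; last by move=> i; rewrite !mxE.
  have vol1 : lebesgue_measure `[a ord0 ord0, b ord0 ord0]%classic =
      (b ord0 ord0 - a ord0 ord0)%:E :> \bar R.
    rewrite lebesgue_measure_itv/= lte_fin.
    by have := ab ord0; rewrite le_eqVlt => /predU1P[->|->];
      rewrite ?ltxx ?subrr ?EFinB.
  rewrite big_ord_recl EFinM; congr (_ * _)%E; first exact: vol1.
  by congr EFin; apply: eq_bigr => i _; rewrite !mxE.
apply/seteqP; split => [p /= h|p /= [h1 h2] i].
  split; first by have := h ord0; rewrite rV_cons0 in_itv.
  by move=> i; have := h (lift ord0 i); rewrite rV_consS !mxE.
have [j ->|->] := unliftP ord0 i; last by rewrite rV_cons0; rewrite in_itv in h1.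
by rewrite rV_consS; have := h2 j; rewrite !mxE.
Qed.

Section sobolev.
Context {R : realType} {N : nat}.
Implicit Types (u g h phi : 'rV[R]_N -> R) (i : 'I_N).

Definition basis_vec i : 'rV[R]_N := delta_mx ord0 i.

Definition partial i phi : 'rV[R]_N -> R := fun x => 'D_(basis_vec i) phi x.

Fixpoint Ck (k : nat) phi : Prop :=
  continuous phi /\
  if k is k'.+1 then
    forall i, (forall x, derivable phi x (basis_vec i)) /\ Ck k' (partial i phi)
  else True.

Definition test_function phi : Prop :=
  (forall k, Ck k phi) /\ compact (closure [set x | phi x != 0]).

Definition L2 u : Prop := u \in Lfun (lebesgue_rV N) 2%:E.

Definition is_weak_partial i u g : Prop :=
  forall phi, test_function phi ->
    \int[lebesgue_rV N]_x (u x * partial i phi x) =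
    - \int[lebesgue_rV N]_x (g x * phi x).

(* Elements of H^1 are represented by functions, not by classes modulo
   equality almost everywhere. *)
Definition H1 : set ('rV[R]_N -> R) :=
  [set u | L2 u /\ forall i, exists g, L2 g /\ is_weak_partial i u g].

(* The i-th component of the weak gradient: a choice of representative, unique
   up to equality almost everywhere; it is 0 if there is none in L^2. *)
Definition weak_partial i u : 'rV[R]_N -> R :=
  xget (cst 0) [set g | L2 g /\ is_weak_partial i u g].

Definition grad_sqr u : 'rV[R]_N -> R :=
  fun x => \sum_i weak_partial i u x ^+ 2.

Definition H1norm u : R :=
  Num.sqrt (\int[lebesgue_rV N]_x (grad_sqr u x + u x ^+ 2)).

(* The functional J is Frechet differentiable at u with J'(u) = 0. *)
Definition critical_point (J : ('rV[R]_N -> R) -> R) u : Prop :=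
  H1 u /\
  forall e : R, 0 < e -> exists2 d : R, 0 < d &
    forall h, H1 h -> H1norm h <= d ->
      `|J (u \+ h) - J u| <= e * H1norm h.

Definition dilate (t : R) u : 'rV[R]_N -> R := fun x => u (t^-1 *: x).

End sobolev.

Section autonomous_problem.
Context {R : realType} (N : nat).
Variables (Vinf : R) (f : R -> R).
Implicit Types u : 'rV[R]_N -> R.

Definition critical_exponent : R := 2 * N%:R / (N%:R - 2).

(* F(t), the oriented integral of f from 0 to t. *)
Definition primitive (t : R) : R :=
  if 0 <= t then \int[lebesgue_measure]_(s in `[0, t]) f s
  else - \int[lebesgue_measure]_(s in `[t, 0]) f s.

Definition energy u : R :=
  2^-1 * \int[lebesgue_rV N]_x (grad_sqr u x + Vinf * u x ^+ 2)
  - \int[lebesgue_rV N]_x primitive (u x).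

Definition pohozaev u : R :=
  (N%:R - 2) / 2 * \int[lebesgue_rV N]_x grad_sqr u x
  + N%:R * Vinf / 2 * \int[lebesgue_rV N]_x (u x ^+ 2)
  - N%:R * \int[lebesgue_rV N]_x primitive (u x).

Definition pohozaev_manifold : set ('rV[R]_N -> R) :=
  [set u | [/\ H1 u, ~ ae_eq (lebesgue_rV N) setT u (cst 0)
             & pohozaev u = 0]].

Definition Lambda : set ('rV[R]_N -> R) :=
  [set u | H1 u /\
    \int[lebesgue_rV N]_x (2^-1 * Vinf * u x ^+ 2 - primitive (u x)) < 0].

(* u solves - Delta u + Vinf u = f(u) in R^N, in the weak sense. *)
Definition is_solution u : Prop := critical_point energy u.

End autonomous_problem.
Arguments pohozaev_manifold {R} N Vinf f _.
Arguments Lambda {R} N Vinf f _.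

(* Main.v *)
(** Constrained minimisation without symmetrisation, after Brezis and Lieb.  Put
    [W u] for the integral of [F u - Vinf u^2 / 2], [D u] for the Dirichlet integral
    and [th = (N - 2) / N].  Under [u_t] the first is multiplied by [t^N] and the
    second by [t^(N - 2)], so [D u / (W u)^th] is scale invariant on [W > 0]; by the
    Sobolev inequality its infimum [m] is positive.  Since [f] is subcritical at
    infinity, a minimising sequence with [W = 1] is bounded in [H^1] and stays large
    on sets of measure bounded below, hence so do its mollifications, and after
    translation it has a weak limit [u <> 0].  By local compactness the sequence
    converges to [u] almost everywhere, so both [D] and [W] split (Brezis-Lieb lemma)
    and [m >= D u + m (1 - W u)_+^th]; strict concavity of [s^th] forces [W u = 1]
    and [D u = m].  A dilation of [u] has Lagrange multiplier one and is therefore a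
    critical point.  On the Pohozaev manifold [D = (2 / th) W], so the energy is a
    multiple of [W] and [D >= m W^th] bounds it below by the energy of the critical
    point; each fibre [u_t] with [W u > 0] meets the manifold at its maximum. *)

Require Import Defs.
From HB Require Import structures.
From mathcomp Require Import all_boot all_order all_algebra.
From mathcomp Require Import all_classical all_reals all_analysis.
From mathcomp Require Import measurable_realfun.
From mathcomp Require Import ring lra.

Set Implicit Arguments.
Unset Strict Implicit.
Unset Printing Implicit Defensive.

Import Order.TTheory GRing.Theory Num.Def Num.Theory.
Import numFieldNormedType.Exports.

Local Open Scope classical_set_scope.
Local Open Scope ring_scope.

(** * Integration of real-valued functions *)

(** The mass term is absorbed into the nonlinearity: with [G t = F t - V t^2 / 2] the energy is half
    of the Dirichlet form minus the integral of [G u], and only growth bounds on [G] enter the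
    variational part. One estimate recurs: a translation by [z] moves [u] in L^2 by at most a
    constant times [|z|] times the norm of the gradient. It gives the rate at which mollifications
    approach [u], uniformly on bounded sets of H^1. This rate transfers large values of [u] to its
    mollifications, yields local compactness because mollifications are equicontinuous, and carries
    the Sobolev inequality from mollifications, which decay along lines, to [u]. Weak limits are
    taken along an ultrafilter on the integers; a sequence is extracted only when the needed
    smallness is known, with geometric rates, so that almost everywhere convergence and dominating
    functions come from convergent series. Differentiability of the nonlinear term is proved by
    contradiction along a sequence of the same kind, so that dominated convergence applies. *)

Definition Rintegrable d (T : measurableType d) (R : realType)
    (mu : {measure set T -> \bar R}) (f : T -> R) : Prop :=
  mu.-integrable [set: T] (EFin \o f).

Section real_integration.
Context d (T : measurableType d) (R : realType).
Variable mu : {measure set T -> \bar R}.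
Implicit Types f g h : T -> R.
Local Notation Int := (Rintegrable mu).

Lemma Rintegrable_meas f : Int f -> measurable_fun setT f.
Proof. by move=> /integrableP[/measurable_EFinP]. Qed.

Lemma Rintegrable_le f g : measurable_fun setT f -> Int g ->
  (forall x, `|f x| <= g x) -> Int f.
Proof.
move=> mf ig fg; apply: le_integrable ig => //; first exact/measurable_EFinP.
by move=> x _ /=; rewrite lee_fin (le_trans (fg x))// ler_norm.
Qed.

Lemma eq_Rintegrable f g : f =1 g -> Int f -> Int g.
Proof. by move=> /funext ->. Qed.

Lemma Rintegrable0 : Int (fun=> 0).
Proof. exact: integrable0. Qed.

Lemma RintegrableD f g : Int f -> Int g -> Int (fun x => f x + g x).
Proof. by move=> fi gi; have := integrableD measurableT fi gi. Qed.

Lemma RintegrableB f g : Int f -> Int g -> Int (fun x => f x - g x).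
Proof. by move=> fi gi; have := integrableB measurableT fi gi. Qed.

Lemma RintegrableZ k f : Int f -> Int (fun x => k * f x).
Proof. by move=> fi; have := integrableZl measurableT k fi. Qed.

Lemma Rintegrable_abs f : Int f -> Int (fun x => `|f x|).
Proof. exact: integrable_norm. Qed.

Lemma Rintegrable_sum (J : Type) (s : seq J) (F : J -> T -> R) :
  (forall i, Int (F i)) -> Int (fun x => \sum_(i <- s) F i x).
Proof.
move=> iF; elim: s => [|i s IH].
  by apply: eq_Rintegrable Rintegrable0 => x; rewrite big_nil.
by apply: eq_Rintegrable (RintegrableD (iF i) IH) => x; rewrite big_cons.
Qed.

Lemma EFin_Rintegral f : Int f ->
  (\int[mu]_x (f x)%:E)%E = (\int[mu]_x f x)%:E.
Proof. by move=> fi; rewrite /Rintegral fineK//; exact: integrable_fin_num. Qed.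

Lemma RintD f g : Int f -> Int g ->
  \int[mu]_x (f x + g x) = \int[mu]_x f x + \int[mu]_x g x.
Proof. exact: RintegralD. Qed.

Lemma RintB f g : Int f -> Int g ->
  \int[mu]_x (f x - g x) = \int[mu]_x f x - \int[mu]_x g x.
Proof. exact: RintegralB. Qed.

Lemma RintZ k f : Int f -> \int[mu]_x (k * f x) = k * \int[mu]_x f x.
Proof. by move=> fi; rewrite RintegralZl. Qed.

Lemma Rint_cst0 : \int[mu]_x (0 : R) = 0.
Proof. by rewrite /Rintegral integral0. Qed.

Lemma Rint_sum (J : Type) (s : seq J) (F : J -> T -> R) :
  (forall i, Int (F i)) ->
  \int[mu]_x (\sum_(i <- s) F i x) = \sum_(i <- s) \int[mu]_x F i x.
Proof.
move=> iF; elim: s => [|i s IH].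
  by rewrite big_nil -[RHS]Rint_cst0; apply: eq_Rintegral => x _; rewrite big_nil.
rewrite big_cons -IH -RintD//; last exact: Rintegrable_sum.
by apply: eq_Rintegral => x _; rewrite big_cons.
Qed.

Lemma Rint_le f g : Int f -> Int g -> (forall x, f x <= g x) ->
  \int[mu]_x f x <= \int[mu]_x g x.
Proof. by move=> fi gi fg; apply: le_Rintegral. Qed.

Lemma Rint_ge0 f : (forall x, 0 <= f x) -> 0 <= \int[mu]_x f x.
Proof. by move=> f0; apply: Rintegral_ge0. Qed.

Lemma Rint_norm f : Int f -> `|\int[mu]_x f x| <= \int[mu]_x `|f x|.
Proof. exact: le_normr_Rintegral. Qed.

Lemma Rint_ae_eq f g : measurable_fun setT f -> measurable_fun setT g ->
  {ae mu, forall x, f x = g x} -> \int[mu]_x f x = \int[mu]_x g x.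
Proof.
move=> mf mg fg; rewrite /Rintegral; congr fine.
apply: ae_eq_integral => //; [exact/measurable_EFinP..|].
by apply: filterS fg => x /= -> .
Qed.

Lemma Rintegrable_ae_le f g : measurable_fun setT f -> Int g ->
  {ae mu, forall x, `|f x| <= g x} -> Int f.
Proof.
move=> mf ig fg; apply/integrableP; split; first exact/measurable_EFinP.
have ig' := Rintegrable_abs ig.
have := integrable_lty measurableT ig'; apply: le_lt_trans.
apply: ae_ge0_le_integral => //.
- by apply: measurableT_comp => //; exact/measurable_EFinP.
- by move=> x _; rewrite lee_fin.
- by case/integrableP : ig'.
- by apply: filterS fg => x /= fx _; rewrite lee_fin (le_trans fx)// ler_norm.
Qed.

Lemma Rint_ae_le f g : Int f -> Int g -> {ae mu, forall x, f x <= g x} ->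
  \int[mu]_x f x <= \int[mu]_x g x.
Proof.
move=> fi gi fg; rewrite -subr_ge0 -RintB//; have di := RintegrableB gi fi.
rewrite (_ : \int[mu]_x _ = \int[mu]_x `|g x - f x|); first exact: Rint_ge0.
apply: Rint_ae_eq; [exact: Rintegrable_meas|
  exact: Rintegrable_meas (Rintegrable_abs di)|].
by apply: filterS fg => x h; rewrite ger0_norm// subr_ge0.
Qed.

Lemma Rintegrable_lty f (C : R) : measurable_fun setT f -> (forall x, 0 <= f x) ->
  (\int[mu]_x (f x)%:E <= C%:E)%E -> Int f /\ \int[mu]_x f x <= C.
Proof.
move=> mf f0 fC; have fi : Int f.
  apply/integrableP; split; first exact/measurable_EFinP.
  rewrite (le_lt_trans _ (ltry C))// (le_trans _ fC)//.
  by under eq_integral do rewrite /= ger0_norm//.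
by split=> //; rewrite -lee_fin -EFin_Rintegral.
Qed.

Lemma Rint_dominated (f_ : (T -> R)^nat) f g :
  (forall n, measurable_fun setT (f_ n)) -> measurable_fun setT f ->
  {ae mu, forall x, f_ ^~ x @ \oo --> f x} -> Int g ->
  {ae mu, forall x, forall n, `|f_ n x| <= g x} ->
  Int f /\ (\int[mu]_x f_ n x @[n --> \oo] --> \int[mu]_x f x).
Proof.
move=> mf_ mf ff ig fg.
have [||||fi _ cv] := @dominated_convergence _ _ _ mu setT measurableT
  (fun n => EFin \o f_ n) (EFin \o f) (EFin \o g) _ _ _ ig _.
- by move=> n; exact/measurable_EFinP.
- exact/measurable_EFinP.
- by apply: filterS ff => x fx _; apply: cvg_EFin => //; exact: nearW.
- by apply: filterS fg => x fx n _ /=; rewrite lee_fin.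
split => //; apply: fine_cvg.
by move: cv; rewrite -[X in _ --> X -> _]fineK// integrable_fin_num.
Qed.

(** Fatou's lemma. The convergence is only almost everywhere, so [f] may be negative on a null set;
    the bound is proved for [|f|] and then transferred. *)
Lemma Rint_fatou (f_ : (T -> R)^nat) f (C : R) :
  (forall n, Int (f_ n)) -> (forall n x, 0 <= f_ n x) ->
  measurable_fun setT f -> {ae mu, forall x, f_ ^~ x @ \oo --> f x} ->
  (forall n, \int[mu]_x f_ n x <= C) ->
  [/\ Int f, \int[mu]_x f x <= C & {ae mu, forall x, 0 <= f x}].
Proof.
move=> if_ f0 mf ff fC.
have aef0 : {ae mu, forall x, 0 <= f x}.
  apply: filterS ff => x fx; rewrite -(cvg_lim (@Rhausdorff R) fx).
  by apply: limr_ge; [apply/cvg_ex; exists (f x)|exact: nearW].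
have mf_ n := Rintegrable_meas (if_ n).
have mnf : measurable_fun setT (fun x => `|f x|) by exact: measurableT_comp.
have le : (\int[mu]_x (`|f x|)%:E <= C%:E)%E.
  apply: (@le_trans _ _ (\int[mu]_x limn_einf (fun n => (f_ n x)%:E)))%E.
    rewrite le_eqVlt; apply/orP; left; apply/eqP; apply: ae_eq_integral => //.
    - exact/measurable_EFinP.
    - have -> : (fun x => limn_einf (fun n => (f_ n x)%:E)) =
        (fun x => - limn_esup (fun n => - (f_ n x)%:E))%E.
        apply/funext => x; rewrite -limn_einfN; congr limn_einf.
        by apply/funext => n; rewrite /comp oppeK.
      apply: measurableT_comp => //; apply: measurable_fun_limn_esup => n.
      apply: measurableT_comp => //; exact/measurable_EFinP.
    - apply: filterS2 ff aef0 => x fx fx0 _ /=.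
      have cv : (f_ n x)%:E @[n --> \oo] --> (f x)%:E.
        by apply: cvg_EFin => //; exact: nearW.
      rewrite is_cvg_limn_einfE; last by apply/cvg_ex; eexists; exact: cv.
      by rewrite (cvg_lim _ cv)// ger0_norm.
  apply: le_trans.
    apply: (@fatou _ _ _ mu _ measurableT (fun n x => (f_ n x)%:E)).
    - by move=> n; exact/measurable_EFinP.
    - by move=> n x _; rewrite lee_fin.
  rewrite limn_einf_lim; apply: lime_le; first exact: is_cvg_einfs.
  apply: nearW => n; apply: (@le_trans _ _ (\int[mu]_x (f_ n x)%:E)%E).
    by apply: ereal_inf_lbound; exists n => //=.
  by rewrite EFin_Rintegral// lee_fin.
have [nfi nfC] := Rintegrable_lty mnf (fun x => normr_ge0 _) le.
have fi : Int f by apply: (Rintegrable_le mf nfi).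
split => //; rewrite -(_ : \int[mu]_x `|f x| = \int[mu]_x f x) //.
apply: Rint_ae_eq => //; by apply: filterS aef0 => x /ger0_norm.
Qed.

(** Monotone convergence for the partial sums. [H] serves as an integrable majorant of all [f_ n] at
    once. Where the series diverges [fine] returns 0, hence the bound only almost everywhere. *)
Lemma Rint_series (f_ : (T -> R)^nat) (C : R) :
  (forall n, Int (f_ n)) -> (forall n x, 0 <= f_ n x) ->
  (forall n, \sum_(k < n) \int[mu]_x f_ k x <= C) ->
  exists H : T -> R, [/\ Int H, forall x, 0 <= H x, \int[mu]_x H x <= C &
    {ae mu, forall x, forall n, \sum_(k < n) f_ k x <= H x}].
Proof.
move=> if_ f0 fC.
pose G x := (\sum_(n <oo) (f_ n x)%:E)%E.
have mf_ n := Rintegrable_meas (if_ n).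
have G0 x : (0 <= G x)%E by apply: nneseries_ge0 => n _ _; rewrite lee_fin.
have mG : measurable_fun setT G.
  by apply: ge0_emeasurable_sum => [n x _ _|n _];
    [rewrite lee_fin|exact/measurable_EFinP].
have iG : (\int[mu]_x G x <= C%:E)%E.
  rewrite integral_nneseries//; [|by move=> n; exact/measurable_EFinP|
    by move=> n x _; rewrite lee_fin].
  apply: lime_le.
    by apply: is_cvg_nneseries => n _ _; apply: integral_ge0 => x _; rewrite lee_fin.
  apply: nearW => n; rewrite big_mkord.
  under eq_bigr do rewrite EFin_Rintegral//.
  by rewrite sumEFin lee_fin.
have intG : mu.-integrable setT G.
  apply/integrableP; split => //; rewrite (le_lt_trans _ (ltry C))//.
  by under eq_integral do rewrite gee0_abs//.
have finG := integrable_ae measurableT intG.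
have mH : measurable_fun setT (fine \o G) by exact: measurableT_comp.
have H0 x : 0 <= fine (G x) by exact: fine_ge0.
have [||Hi HC] := @Rintegrable_lty (fine \o G) C mH => //.
  rewrite (le_trans _ iG)//; apply: ge0_le_integral => //.
  - by move=> x _; rewrite lee_fin H0.
  - exact/measurable_EFinP.
  - move=> x _ /=; have := G0 x; case: (G x) => //= _; exact: leey.
exists (fine \o G); split => //.
apply: filterS finG => x /(_ I) finx n /=.
rewrite -lee_fin fineK// -sumEFin.
have := @nneseries_lim_ge _ (fun n => (f_ n x)%:E) xpredT 0%N n.
rewrite big_mkord; apply => m _ _; by rewrite lee_fin.
Qed.

Lemma Rint_eq0 f : Int f -> (forall x, 0 <= f x) -> \int[mu]_x f x = 0 ->
  {ae mu, forall x, f x = 0}.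
Proof.
move=> fi f0 If0.
have := @ae_eq_integral_abs _ _ _ mu setT measurableT (EFin \o f).
case=> [|h _]; first exact/measurable_EFinP/Rintegrable_meas.
have : ae_eq mu setT (EFin \o f) (cst 0)%E.
  apply: h; under eq_integral do rewrite /= ger0_norm//.
  by rewrite EFin_Rintegral// If0.
by apply: filterS => x /(_ I)/= [].
Qed.

Lemma Rintegrable_indic (A : set T) : measurable A -> (mu A < +oo)%E ->
  Int (\1_A : T -> R) /\ \int[mu]_x (\1_A x : R) = fine (mu A).
Proof.
move=> mA Aoo; rewrite /Rintegral integral_indic// setIT; split => //.
apply/integrableP; split; first exact/measurable_EFinP/measurable_indicP.
rewrite (eq_integral (fun x => (\1_A x)%:E)); last first.
  by move=> t _; rewrite gee0_abs// lee_fin.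
by rewrite integral_indic// setIT.
Qed.

End real_integration.

(** * Square-integrable functions, Riesz representation, weak compactness *)

Section square_integrable.
Context d (T : measurableType d) (R : realType).
Variable mu : {measure set T -> \bar R}.
Implicit Types f g h : T -> R.
Local Notation Int := (Rintegrable mu).

Definition sqint f : Prop :=
  measurable_fun setT f /\ Int (fun x => f x ^+ 2).

Lemma sqintP f : f \in Lfun mu 2%:E <-> sqint f.
Proof.
split=> [Lf|[mf if2]].
  split; last exact: Lfun2_integrable_sqr.
  by move: Lf; rewrite inE => /andP[]; rewrite inE.
rewrite inE; apply/andP; split; rewrite inE//=.
rewrite /finite_norm unlock; apply: poweR_lty.
have := integrable_lty measurableT if2; apply: le_lt_trans.
rewrite le_eqVlt; apply/orP; left; apply/eqP; apply: eq_integral => x _ /=.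
by rewrite powR_mulrn// real_normK ?num_real.
Qed.

Lemma sqint_meas f : sqint f -> measurable_fun setT f.
Proof. by case. Qed.

Lemma sqint_int f : sqint f -> Int (fun x => f x ^+ 2).
Proof. by case. Qed.

Lemma sqint_mul f g : sqint f -> sqint g -> Int (fun x => f x * g x).
Proof.
move=> [mf f2] [mg g2]; apply: (Rintegrable_le _ (RintegrableD f2 g2)).
  exact: measurable_funM.
move=> x; rewrite normrM.
have := sqr_ge0 (`|f x| - `|g x|); rewrite -(real_normK (num_real (f x))).
rewrite -(real_normK (num_real (g x))) => h.
have := normr_ge0 (f x); have := normr_ge0 (g x); nra.
Qed.

Lemma sqintD f g : sqint f -> sqint g -> sqint (fun x => f x + g x).
Proof.
move=> sf sg; have [mf f2] := sf; have [mg g2] := sg; split.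
  exact: measurable_funD.
apply: eq_Rintegrable (RintegrableD (RintegrableD f2 g2)
  (RintegrableZ 2 (sqint_mul sf sg))) => x /=; ring.
Qed.

Lemma sqintZ k f : sqint f -> sqint (fun x => k * f x).
Proof.
move=> [mf f2]; split; first exact: measurable_funM.
by apply: eq_Rintegrable (RintegrableZ (k ^+ 2) f2) => x; rewrite exprMn.
Qed.

Lemma sqintN f : sqint f -> sqint (fun x => - f x).
Proof.
move=> /(sqintZ (-1)) h; rewrite (_ : (fun _ => _) = (fun x => -1 * f x))//.
by apply/funext => x; rewrite mulN1r.
Qed.

Lemma sqintB f g : sqint f -> sqint g -> sqint (fun x => f x - g x).
Proof. by move=> sf sg; apply: sqintD => //; exact: sqintN. Qed.

Lemma sqint0 : sqint (fun=> 0).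
Proof.
split=> //; apply: eq_Rintegrable (Rintegrable0 mu) => x.
by rewrite expr0n.
Qed.

Lemma sqint_le f g : measurable_fun setT f -> sqint g ->
  (forall x, `|f x| <= `|g x|) -> sqint f.
Proof.
move=> mf [mg g2] fg; split => //; apply: Rintegrable_le g2 _.
  exact: measurable_funX.
move=> x; rewrite normrX -(real_normK (num_real (g x))).
by rewrite ler_pXn2r// nnegrE.
Qed.

Lemma Rint_sqrD f g : sqint f -> sqint g ->
  \int[mu]_x (f x + g x) ^+ 2 = \int[mu]_x f x ^+ 2 +
    2 * \int[mu]_x (f x * g x) + \int[mu]_x g x ^+ 2.
Proof.
move=> sf sg; have [mf f2] := sf; have [mg g2] := sg.
have fg := sqint_mul sf sg.
transitivity (\int[mu]_x ((f x ^+ 2 + 2 * (f x * g x)) + g x ^+ 2)).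
  by apply: eq_Rintegral => x _; ring.
by rewrite !RintD ?RintZ//; [exact: RintegrableZ|apply: RintegrableD => //;
  exact: RintegrableZ].
Qed.

(** Evaluation at the vertex [- b / c]. It yields Cauchy-Schwarz and, in the Riesz argument, the
    approximate Euler equation. *)
Lemma discriminant_le (a b c : R) : 0 <= c ->
  (forall t, 0 <= a + 2 * t * b + t ^+ 2 * c) -> b ^+ 2 <= a * c.
Proof.
move=> c0 h; have [c1|cn0] := eqVneq c 0.
  rewrite c1 mulr0; have [->|b0] := eqVneq b 0; first by rewrite expr0n.
  (* For [c = 0] and [b <> 0] this is the point where the affine function equals [-1]. *)
  have := h (- (a + 1) / (2 * b)); rewrite c1 mulr0 addr0.
  have -> : 2 * (- (a + 1) / (2 * b)) * b = - (a + 1) by field.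
  by rewrite opprD addrA subrr add0r oppr_ge0 ler10.
have cp : 0 < c by rewrite lt_neqAle eq_sym cn0.
have := h (- b / c).
have -> : a + 2 * (- b / c) * b + (- b / c) ^+ 2 * c = (a * c - b ^+ 2) / c by field.
by rewrite pmulr_lge0 ?invr_gt0// subr_ge0.
Qed.

Lemma cauchy_schwarz f g : sqint f -> sqint g ->
  (\int[mu]_x (f x * g x)) ^+ 2 <= \int[mu]_x f x ^+ 2 * \int[mu]_x g x ^+ 2.
Proof.
move=> sf sg; apply: discriminant_le.
  by apply: Rint_ge0 => x; exact: sqr_ge0.
move=> t; have stg := sqintZ t sg.
have -> : \int[mu]_x f x ^+ 2 + 2 * t * \int[mu]_x (f x * g x) +
  t ^+ 2 * \int[mu]_x g x ^+ 2 = \int[mu]_x (f x + t * g x) ^+ 2.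
  rewrite Rint_sqrD//; congr (_ + _ + _).
    rewrite -mulrA -RintZ; last exact: sqint_mul.
    by congr (_ * _); apply: eq_Rintegral => x _; ring.
  rewrite -RintZ; last exact: sg.2.
  by apply: eq_Rintegral => x _; ring.
by apply: Rint_ge0 => x; exact: sqr_ge0.
Qed.

(** The sequence is put to 0 on the exceptional null set, so that it converges everywhere and its
    pointwise limit is measurable. *)
Lemma ae_cvg_measurable (f_ : (T -> R)^nat) :
  (forall n, measurable_fun setT (f_ n)) -> {ae mu, forall x, cvgn (f_ ^~ x)} ->
  exists2 f : T -> R, measurable_fun setT f & {ae mu, forall x, f_ ^~ x @ \oo --> f x}.
Proof.
move=> mf_ [N [mN N0 sub]].
pose g_ n := (f_ n) \_ (~` N).
have cg x : cvgn (g_ ^~ x).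
  have [Nx|Nx] := pselect (N x).
    rewrite (_ : g_ ^~ x = fun=> 0); first exact: is_cvg_cst.
    by apply/funext => n; rewrite /g_ patchE memNset//=; exact.
  rewrite (_ : g_ ^~ x = f_ ^~ x).
    by apply: contrapT => h; apply: Nx; apply: sub.
  by apply/funext => n; rewrite /g_ patchE mem_set.
exists (fun x => limn (g_ ^~ x)).
  apply: (@measurable_fun_cvg _ _ _ _ g_) => [n|x _]; last exact: cg.
  apply/(measurable_restrictT _ (measurableC mN)).
  exact: measurable_funS (mf_ n).
exists N; split => // x /=; apply: contra_notP => Nx.
have := cg x; rewrite (_ : g_ ^~ x = f_ ^~ x)//.
by apply/funext => n; rewrite /g_ patchE mem_set.
Qed.

Lemma sum_half_le n : \sum_(k < n) (2^-1 : R) ^+ k <= 2.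
Proof.
suff -> : \sum_(k < n) (2^-1 : R) ^+ k = 2 - 2 * 2^-1 ^+ n.
  by rewrite lerBlDr lerDl mulr_ge0// exprn_ge0.
elim: n => [|n IH]; first by rewrite big_ord0 expr0; ring.
by rewrite big_ord_recr/= IH exprS; field.
Qed.

(** The weights [2 ^ n] against the rate [8 ^ - n] leave a summable series of integrals, so
    [2 ^ n |f_(n+1) - f_n|^2] is summable almost everywhere; the increments are then absolutely
    summable because [|y| <= 2 ^ - n + 2 ^ n y^2]. *)
Lemma ae_cvg_of_fast_cauchy (f_ : (T -> R)^nat) (C : R) :
  (forall n, measurable_fun setT (f_ n)) ->
  (forall n, Int (fun x => (f_ n.+1 x - f_ n x) ^+ 2)) ->
  (forall n, \int[mu]_x (f_ n.+1 x - f_ n x) ^+ 2 <= C * (8^-1) ^+ n) ->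
  {ae mu, forall x, cvgn (f_ ^~ x)}.
Proof.
move=> mf_ id_ dC.
have C0 : 0 <= C.
  have := dC 0%N; rewrite expr0 mulr1; apply: le_trans.
  by apply: Rint_ge0 => x; exact: sqr_ge0.
have [||H [_ _ _ hH]] := @Rint_series _ _ _ mu
  (fun n x => 2 ^+ n * (f_ n.+1 x - f_ n x) ^+ 2) (2 * C)
  (fun n => RintegrableZ _ (id_ n)).
- by move=> n x; rewrite mulr_ge0 ?sqr_ge0 ?exprn_ge0.
- move=> n; apply: (@le_trans _ _ (\sum_(k < n) C * 2^-1 ^+ k)); last first.
    by rewrite -mulr_sumr mulrC ler_wpM2r// sum_half_le.
  apply: ler_sum => k _; rewrite RintZ//.
  apply: (@le_trans _ _ (2 ^+ k * (C * 8^-1 ^+ k))).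
    by rewrite ler_wpM2l// exprn_ge0.
  rewrite mulrCA -exprMn ler_wpM2l// lerXn2r// ?nnegrE; lra.
apply: filterS hH => x hH.
have cs : cvgn (series (fun n => `|f_ n.+1 x - f_ n x|)).
  apply: nondecreasing_is_cvgn.
    by apply/nondecreasing_seqP => n; rewrite !seriesEnat/= big_nat_recr//= lerDl.
  exists (2 + H x) => _ [n _ <-]; rewrite seriesEord/=.
  apply: (@le_trans _ _ (\sum_(k < n) (2^-1 ^+ k +
    2 ^+ k * (f_ k.+1 x - f_ k x) ^+ 2))); last first.
    rewrite big_split/=; apply: lerD; first exact: sum_half_le.
    exact: hH.
  apply: ler_sum => k _; set y := f_ k.+1 x - f_ k x.
  have a0 : 0 < (2 : R) ^+ k by rewrite exprn_gt0.
  rewrite exprVn; set a := (2 : R) ^+ k in a0 *.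
  rewrite -(real_normK (num_real y)).
  have -> : a^-1 + a * `|y| ^+ 2 =
    `|y| + ((a * `|y| - 1) ^+ 2 + a * `|y|) / a by field; rewrite gt_eqF.
  by rewrite lerDl divr_ge0 ?addr_ge0 ?sqr_ge0 ?mulr_ge0// ltW.
have := normed_cvg cs.
have -> : f_ ^~ x = (fun n => f_ 0%N x + series (fun n => f_ n.+1 x - f_ n x) n).
  by apply/funext => n; exact: (eq_sum_telescope (f_ ^~ x)).
by move=> ?; apply: is_cvgD => //; exact: is_cvg_cst.
Qed.

(** Completeness of L^2 with a rate: [f] is the almost everywhere limit, and Fatou's lemma in the
    second index keeps the bound [8 ^ - n]. *)
Lemma sqint_complete (f_ : (T -> R)^nat) :
  (forall n, sqint (f_ n)) ->
  (forall n m, (n <= m)%N -> \int[mu]_x (f_ n x - f_ m x) ^+ 2 <= 8^-1 ^+ n) ->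
  exists2 f, sqint f & forall n, \int[mu]_x (f_ n x - f x) ^+ 2 <= 8^-1 ^+ n.
Proof.
move=> sf fC; have mf n := sqint_meas (sf n).
have [|f mf' ff] := @ae_cvg_measurable f_ mf.
  apply: (@ae_cvg_of_fast_cauchy _ 1) => // n.
    by case: (sqintB (sf n.+1) (sf n)).
  rewrite mul1r (le_trans _ (fC n n.+1 _))//.
  by rewrite le_eqVlt; apply/orP; left; apply/eqP; apply: eq_Rintegral => x _; ring.
have key n : Int (fun x => (f_ n x - f x) ^+ 2) /\
    \int[mu]_x (f_ n x - f x) ^+ 2 <= 8^-1 ^+ n.
  have [|||||h1 h2 _] := @Rint_fatou _ _ _ mu
    (fun m x => (f_ n x - f_ (m + n)%N x) ^+ 2)
    (fun x => (f_ n x - f x) ^+ 2) (8^-1 ^+ n) => //.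
  - by move=> m; exact: (sqint_int (sqintB (sf n) (sf _))).
  - by move=> m x; exact: sqr_ge0.
  - exact/measurable_funX/measurable_funB.
  - apply: filterS ff => x fx.
    suff h : f_ n x - f_ (m + n)%N x @[m --> \oo] --> f_ n x - f x.
      by apply: cvgM.
    by apply: cvgB; [exact: cvg_cst|rewrite (cvg_shiftn n (f_ ^~ x))].
  - by move=> m; apply: fC; rewrite leq_addl.
exists f => [|n]; last by case: (key n).
have sd : sqint (fun x => f_ 0%N x - f x).
  by split; [exact: measurable_funB|case: (key 0%N)].
rewrite (_ : f = fun x => f_ 0%N x - (f_ 0%N x - f x)); first exact: sqintB.
by apply/funext => x; ring.
Qed.

(* A representative is obtained as the minimiser of |g|^2 - 2 l(g); the
   parallelogram identity makes minimising sequences Cauchy. *)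
Lemma riesz_representation (l : (T -> R) -> R) (M : R) : 0 <= M ->
  (forall f g t, sqint f -> sqint g -> l (fun x => f x + t * g x) = l f + t * l g) ->
  (forall f, sqint f -> l f ^+ 2 <= M * \int[mu]_x f x ^+ 2) ->
  exists2 g, sqint g & forall f, sqint f -> l f = \int[mu]_x (g x * f x).
Proof.
move=> M0 llin lb.
pose J f := \int[mu]_x f x ^+ 2 - 2 * l f.
have JM f : sqint f -> - M <= J f.
  move=> sf; have h := lb f sf; rewrite /J; set A := \int[mu]_x f x ^+ 2 in h *.
  have A0 : 0 <= A by apply: Rint_ge0 => x; exact: sqr_ge0.
  have := sqr_ge0 (M - A) => h2; rewrite lerBrDl.
  have h3 : (2 * l f) ^+ 2 <= (M + A) ^+ 2 by rewrite exprMn; nra.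
  have h4 : `|2 * l f| <= `|M + A|.
    by rewrite -ler_sqr ?nnegrE// !real_normK ?num_real.
  have := ler_norm (2 * l f); rewrite [`|M + A|]ger0_norm ?addr_ge0// in h4; lra.
pose E := [set J f | f in sqint].
have E0 : E !=set0 by exists (J (fun=> 0)); exists (fun=> 0) => //; exact: sqint0.
have Elb : has_lbound E by exists (- M) => _ [f sf <-]; exact: JM.
pose i := inf E.
have iJ f : sqint f -> i <= J f by move=> sf; apply: ge_inf => //; exists f.
(* The factor [4^-1] makes the parallelogram bound below at most [8 ^ - n], the rate required by
   [sqint_complete]. *)
have ex n : exists f, sqint f /\ J f <= i + 4^-1 * 8^-1 ^+ n.
  have [|_ [f sf <-] h] := @inf_adherent _ E (4^-1 * 8^-1 ^+ n) _ (conj E0 Elb).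
    by rewrite mulr_gt0// exprn_gt0.
  by exists f; split => //; exact: ltW.
have [g_ hg] := choice ex.
have sg n : sqint (g_ n) by case: (hg n).
have Jexp f g t : sqint f -> sqint g -> J (fun x => f x + t * g x) =
    J f + 2 * t * (\int[mu]_x (f x * g x) - l g) + t ^+ 2 * \int[mu]_x g x ^+ 2.
  move=> sf sg'; rewrite /J llin// Rint_sqrD//; last exact: sqintZ.
  have -> : \int[mu]_x (f x * (t * g x)) = t * \int[mu]_x (f x * g x).
    by rewrite -RintZ; [apply: eq_Rintegral => x _; ring|exact: sqint_mul].
  have -> : \int[mu]_x (t * g x) ^+ 2 = t ^+ 2 * \int[mu]_x g x ^+ 2.
    by rewrite -RintZ; [apply: eq_Rintegral => x _; ring|exact: sqint_int].
  ring.
have par f g : sqint f -> sqint g ->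
    \int[mu]_x (f x - g x) ^+ 2 <= 2 * (J f - i) + 2 * (J g - i).
  move=> sf sg'; have sd := sqintB sg' sf.
  (* The midpoint of [f] and [g], where [J] is at least [i]. *)
  have h1 := iJ _ (sqintD sf (sqintZ 2^-1 sd)).
  rewrite Jexp// in h1.
  have h2 : J g = J f + 2 * 1 * (\int[mu]_x (f x * (g x - f x)) -
      l (fun x => g x - f x)) + 1 ^+ 2 * \int[mu]_x (g x - f x) ^+ 2.
    rewrite -Jexp//; congr J; apply/funext => x; ring.
  have -> : \int[mu]_x (f x - g x) ^+ 2 = \int[mu]_x (g x - f x) ^+ 2.
    by apply: eq_Rintegral => x _; ring.
  by move: h1 h2; set I1 := \int[mu]_x _; set I2 := \int[mu]_x _ ^+ 2; nra.
have [|g sg' hg'] := sqint_complete sg.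
  move=> n m nm; rewrite (le_trans (par _ _ (sg n) (sg m)))//.
  have [_ h1] := hg n; have [_ h2] := hg m.
  have : (8^-1 : R) ^+ m <= 8^-1 ^+ n by apply: ler_wiXn2l => //; lra.
  lra.
exists g => // f sf; set A := \int[mu]_x f x ^+ 2.
have A0 : 0 <= A by apply: Rint_ge0 => x; exact: sqr_ge0.
(* [J (g_n + t f) >= i] for every [t], while [J g_n] exceeds [i] by at most [8 ^ - n]: the
   discriminant of this quadratic in [t] bounds the defect in the Euler equation. *)
have b1 n : (\int[mu]_x (g_ n x * f x) - l f) ^+ 2 <= 8^-1 ^+ n * A.
  apply: discriminant_le => // t; have [_ h1] := hg n.
  have := iJ _ (sqintD (sg n) (sqintZ t sf)); rewrite Jexp// -/A.
  have : 0 <= (8^-1 : R) ^+ n by rewrite exprn_ge0.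
  by move: h1; set X := 2 * t * _; set Y := t ^+ 2 * _; set Z := _ ^+ n; lra.
have b2 n : (\int[mu]_x (g_ n x * f x) - \int[mu]_x (g x * f x)) ^+ 2 <=
    8^-1 ^+ n * A.
  rewrite -RintB; [|exact: sqint_mul..].
  have -> : \int[mu]_x (g_ n x * f x - g x * f x) =
      \int[mu]_x ((g_ n x - g x) * f x).
    by apply: eq_Rintegral => x _; ring.
  apply: (le_trans (cauchy_schwarz (sqintB (sg n) sg') sf)).
  by rewrite ler_wpM2r.
have lim0 : (fun n => 4 * A * 8^-1 ^+ n) @ \oo --> (0 : R).
  by apply: cvg_geometric; rewrite ger0_norm; lra.
have : (l f - \int[mu]_x (g x * f x)) ^+ 2 <= 0.
  rewrite -(cvg_lim (@Rhausdorff R) lim0).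
  apply: limr_ge; first by apply/cvg_ex; exists 0.
  apply: nearW => n; have := b1 n; have := b2 n.
  set a := \int[mu]_x (g_ n x * f x); set b := \int[mu]_x (g x * f x).
  have := sqr_ge0 ((a - l f) + (a - b)); nra.
rewrite le_eqVlt ltNge sqr_ge0 orbF sqrf_eq0 subr_eq0 => /eqP //.
Qed.

(** Limits along an ultrafilter take the place of subsequences: the image ultrafilter lives on a
    compact segment. *)
Lemma ultra_bounded_cvg (U : set_system nat) (a : R^nat) (K : R) :
  UltraFilter U -> (forall n, `|a n| <= K) -> cvg (a @ U).
Proof.
move=> UU aK.
have [c [_ hc]] : `[- K, K]%classic `&` (fun c => a @ U --> c) !=set0.
  have := @segment_compact R (- K) K; rewrite compact_ultra; apply.
    split=> [|G GF sUG]; first exact: fmap_proper_filter.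
    rewrite predeqE => A; split=> [GA|]; last exact: sUG.
    have [//|nA] := in_ultra_setVsetC (a @^-1` A) UU.
    have GnA : G (~` A) by apply: sUG.
    by have /filter_ex [? []] : G (A `&` ~` A) by exact: filterI.
  by apply: nearW => n; rewrite /= in_itv/= -ler_norml.
by apply/cvg_ex; exists c.
Qed.

(** For each [f] the pairings are bounded, hence converge along [U]; the limit is linear and bounded
    in [f], and Riesz representation provides [g]. The same ultrafilter serves all [f], and later
    all partial derivatives, simultaneously. *)
Lemma sqint_weak_compact (U : set_system nat) (w : (T -> R)^nat) (M : R) :
  UltraFilter U -> (forall n, sqint (w n)) ->
  (forall n, \int[mu]_x w n x ^+ 2 <= M) ->
  exists2 g, sqint g & forall f, sqint f ->
    \int[mu]_x (w n x * f x) @[n --> U] --> \int[mu]_x (g x * f x).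
Proof.
move=> UU sw wM.
have M0 : 0 <= M.
  by apply: le_trans (wM 0%N); apply: Rint_ge0 => x; exact: sqr_ge0.
have bd f n : sqint f ->
    (\int[mu]_x (w n x * f x)) ^+ 2 <= M * \int[mu]_x f x ^+ 2.
  move=> sf; apply: (le_trans (cauchy_schwarz (sw n) sf)).
  by rewrite ler_wpM2r//; apply: Rint_ge0 => x; exact: sqr_ge0.
pose l f := lim (\int[mu]_x (w n x * f x) @[n --> U]).
have cl f : sqint f -> \int[mu]_x (w n x * f x) @[n --> U] --> l f.
  move=> sf; apply: (@ultra_bounded_cvg U _ (Num.sqrt (M * \int[mu]_x f x ^+ 2))).
  by move=> n; rewrite -sqrtr_sqr ler_wsqrtr// bd.
have [||g sg hg] := @riesz_representation l M M0.
- move=> f g t sf sg; apply: (@cvg_lim _ (@Rhausdorff R)).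
  rewrite (_ : (fun n => _) = (fun n => \int[mu]_x (w n x * f x) +
    t * \int[mu]_x (w n x * g x))); last first.
    apply/funext => n; rewrite -RintZ; last exact: sqint_mul.
    rewrite -RintD; [|exact: sqint_mul|exact/RintegrableZ/sqint_mul].
    by apply: eq_Rintegral => x _; ring.
  by apply: cvgD; [exact: cl|apply: cvgMr; exact: cl].
- move=> f sf; have h : (\int[mu]_x (w n x * f x)) ^+ 2 @[n --> U] --> l f ^+ 2.
    by apply: cvgM; exact: cl.
  rewrite -(cvg_lim (@Rhausdorff R) h); apply: limr_le.
    by apply/cvg_ex; eexists; exact: h.
  by apply: nearW => n; exact: bd.
by exists g => // f sf; rewrite -hg//; exact: cl.
Qed.

End square_integrable.

(** * Lebesgue measure on R^n *)

Section rV_borel.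
Context {R : realType} {n : nat}.
Local Notation E := 'rV[R]_n.

Lemma rV_norm_leP (x : E) (r : R) : 0 <= r ->
  reflect (forall i, `|x ord0 i| <= r) (`|x| <= r).
Proof.
move=> r0; rewrite [`|x|]mx_normrE; apply: (iffP (bigmax_leP _ _ _ _)).
  by move=> [_ h] i; exact: (h (ord0, i)).
by move=> h; split => // -[i j] _; rewrite [i]ord1; exact: h.
Qed.

Lemma rV_norm_coord (x : E) i : `|x ord0 i| <= `|x|.
Proof. by move: i; apply/(rV_norm_leP x). Qed.

(** An open set is the union of the boxes with rational centre and half-width [1 / (k + 1)] that it
    contains, a countable family. Two errors, each below [e / 2], keep such a box around [x] inside
    a ball of radius [e]. *)
Lemma rV_open_measurable (A : set E) : open A -> measurable A.
Proof.
move=> oA.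
pose box (p : 'rV[rat]_n * nat) : set E :=
  [set x | forall i, `|x ord0 i - ratr (p.1 ord0 i)| < p.2.+1%:R^-1].
pose F p := if `[< box p `<=` A >] then box p else set0.
have -> : A = \bigcup_p F p.
  apply/seteqP; split => [x Ax|x [p _]]; rewrite /F;
    last by case: asboolP => [h /h|].
  have := oA; rewrite openE => /(_ x Ax)/nbhs_ballP[e e0 eA].
  have [k hk] : exists k : nat, k.+1%:R^-1 < e / 2.
    exists (Num.trunc (e / 2)^-1).
    have h : 0 < e / 2 by rewrite divr_gt0.
    rewrite invf_plt ?posrE//; exact: truncnS_gt.
  have ex i : exists q : rat, `|x ord0 i - ratr q| < k.+1%:R^-1.
    have [|q] := @rat_in_itvoo R (x ord0 i - k.+1%:R^-1) (x ord0 i + k.+1%:R^-1).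
      by rewrite ltrBlDr -addrA ltrDl addr_gt0 ?invr_gt0.
    by rewrite in_itv/= => h; exists q; rewrite ltr_distlC.
  have [q hq] := choice ex.
  have bxA : box (\row_i q i, k) `<=` A.
    move=> y hy; apply: eA; split => // i j; rewrite ord1 /ball/=.
    have := hy j; have := hq j; rewrite /= mxE => h1 h2.
    have -> : x ord0 j - y ord0 j =
      (x ord0 j - ratr (q j)) - (y ord0 j - ratr (q j)) by ring.
    rewrite (le_lt_trans (ler_normB _ _))// (splitr e).
    by rewrite ltrD// (lt_trans _ hk).
  exists (\row_i q i, k) => //; case: asboolP => // _ i.
  by rewrite /= mxE; exact: hq.
apply: countable_bigcupT_measurable => [|p]; first exact: countableP.
rewrite /F; case: asboolP => // _.
rewrite (_ : box p = \bigcap_(i in [set: 'I_n]) (setT `&` rV_coor i @^-1`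
    ball (ratr (p.1 ord0 i) : R) p.2.+1%:R^-1)); last first.
  apply/seteqP; split => [x h i _|x h i].
    by split => //; rewrite /ball/= distrC; exact: h.
  by have [_] := h i I; rewrite /ball/= distrC.
apply: fin_bigcap_measurable => // i _.
by apply: measurable_rV_coor => //; exact: measurable_ball.
Qed.

Lemma rV_continuous_measurable (f : E -> R) : continuous f ->
  measurable_fun setT f.
Proof.
move=> cf; apply: (measurability _ (RGenOInfty.measurableE R)).
move=> _ [_ [x ->] <-]; rewrite setTI; apply: rV_open_measurable.
by apply: open_comp => //; exact: interval_open.
Qed.

Definition rV_affine (t : R) (z : E) (x : E) : E := t *: x + z.

Lemma measurable_rV_affine t z : measurable_fun setT (rV_affine t z).
Proof.
apply: measurable_fun_rVP => i.
rewrite (_ : _ \o _ = fun x => t * rV_coor i x + z ord0 i); last first.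
  by apply/funext => x; rewrite /rV_coor /= !mxE.
apply: measurable_funD => //; apply: measurable_funM => //.
exact: measurable_rV_coor.
Qed.

Definition rV_affine_pushforward (k : {nonneg R}) t z :
    {measure set E -> \bar R} :=
  mscale k (measure_function_pushforward__canonical__measure_function_Measure
    (lebesgue_rV n) (measurable_rV_affine t z)).

Definition rV_box (a b : E) : set E :=
  [set x | forall i, a ord0 i <= x ord0 i <= b ord0 i].

Lemma measurable_rV_box a b : measurable (rV_box a b).
Proof.
rewrite (_ : rV_box a b = \bigcap_(i in [set: 'I_n])
  (setT `&` rV_coor i @^-1` `[a ord0 i, b ord0 i])); last first.
  apply/seteqP; split => [x h i _|x h i].
    by split => //=; rewrite in_itv/=; exact: h.
  by have [_] := h i I; rewrite /= in_itv.
apply: fin_bigcap_measurable => // i _.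
by apply: (measurable_rV_coor i).
Qed.

Definition rV_boxes : set (set E) := [set A | exists a b, A = rV_box a b].

Lemma rV_boxes_setI : setI_closed rV_boxes.
Proof.
move=> _ _ [a [b ->]] [c [d ->]].
exists (\row_i maxr (a ord0 i) (c ord0 i)), (\row_i minr (b ord0 i) (d ord0 i)).
apply/seteqP; split => [x [h1 h2] i|x h].
  have /andP[? ?] := h1 i; have /andP[? ?] := h2 i.
  by rewrite !mxE ge_max le_min; apply/andP; split; apply/andP; split.
split => i; have := h i; rewrite !mxE ge_max le_min;
  by move=> /andP[/andP[h1 h2] /andP[h3 h4]]; apply/andP.
Qed.

Definition rV_cube (k : nat) : set E := rV_box (const_mx (- k%:R)) (const_mx k%:R).

Lemma rV_cubeP k x : rV_cube k x <-> `|x| <= k%:R.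
Proof.
split => [h|/rV_norm_leP h i].
  by apply/rV_norm_leP => // i; have := h i; rewrite !mxE ler_norml.
by rewrite !mxE -ler_norml; exact: h.
Qed.

Lemma rV_cube_cover : \bigcup_k rV_cube k = setT.
Proof.
apply/seteqP; split => // x _; exists (Num.trunc `|x|).+1 => //.
by apply/rV_cubeP; rewrite ltW// truncnS_gt.
Qed.

(** The half-space [x_i >= y] is the union over [k] of boxes with lower bound [y] in direction [i]
    and [- k] elsewhere. Since boxes are stable under intersection, uniqueness of measures and
    Dynkin arguments become available on them. *)
Lemma rV_measurableE : @measurable _ E = <<s rV_boxes >>.
Proof.
apply/seteqP; split; last first.
  apply: smallest_sub; first exact: sigma_algebra_measurable.
  by move=> _ [a [b ->]]; exact: measurable_rV_box.
apply: smallest_sub; first exact: smallest_sigma_algebra.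
rewrite -bigcup_seq; apply: bigcup_sub => i _ _ [Y mY <-].
have mi : @measurable_fun _ _ (g_sigma_algebraType rV_boxes) R setT (rV_coor i).
  apply: (measurability _ (RGenCInfty.measurableE R)).
  move=> _ [_ [y ->] <-]; rewrite setTI.
  rewrite (_ : _ @^-1` _ = \bigcup_(k : nat)
      rV_box (\row_j (if j == i then y else - k%:R)) (const_mx k%:R)).
    apply: bigcupT_measurable => k; apply: sub_sigma_algebra.
    by eexists; eexists; reflexivity.
  apply/seteqP; split => [x|x [k _ /(_ i)]]; last first.
    by rewrite !mxE eqxx /= in_itv/= andbT => /andP[].
  rewrite /= in_itv/= andbT => yx; exists (Num.trunc `|x|).+1 => // j.
  have h : `|x ord0 j| <= (Num.trunc `|x|).+1%:R.
    by rewrite (le_trans (rV_norm_coord x j))// ltW// truncnS_gt.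
  move: h; rewrite ler_norml !mxE => /andP[h1 ->]; rewrite andbT.
  by case: eqP => // ->.
by have := mi measurableT Y mY.
Qed.

Lemma rV_measure_unique (m1 m2 : {measure set E -> \bar R}) :
  (forall a b, m1 (rV_box a b) = m2 (rV_box a b)) ->
  (forall k, m1 (rV_cube k) < +oo)%E ->
  forall A, measurable A -> m1 A = m2 A.
Proof.
move=> h hoo; apply: (measure_unique rV_boxes rV_cube) => //.
- exact: rV_measurableE.
- exact: rV_boxes_setI.
- by move=> k; eexists; eexists; reflexivity.
- exact: rV_cube_cover.
- by move=> _ [a [b ->]].
Qed.

Lemma rV_box_empty (a b : E) i : b ord0 i < a ord0 i -> rV_box a b = set0.
Proof.
move=> ab; rewrite -subset0 => x /(_ i)/andP[h1 h2].
by move: ab; rewrite ltNge (le_trans h1 h2).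
Qed.

Lemma lebesgue_rV_box_lty a b : (lebesgue_rV n (rV_box a b) < +oo)%E.
Proof.
have [h|/existsNP[i /negP]] := pselect (forall i, a ord0 i <= b ord0 i).
  by rewrite lebesgue_rV_box// ltry.
by rewrite -ltNge => /rV_box_empty ->; rewrite measure0.
Qed.

(** Both sides are measures in [A], so it suffices to compare them on boxes, where the volume is a
    product of lengths. *)
Lemma lebesgue_rV_affine (t : R) (z : E) (A : set E) : 0 < t -> measurable A ->
  lebesgue_rV n A = ((t ^+ n)%:E * lebesgue_rV n (rV_affine t z @^-1` A))%E.
Proof.
move=> t0 mA.
have tn0 : 0 <= t ^+ n by rewrite exprn_ge0// ltW.
rewrite -[RHS]/(rV_affine_pushforward (NngNum tn0) t z A).
apply: rV_measure_unique => //; last by move=> k; exact: lebesgue_rV_box_lty.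
move=> a b; rewrite /rV_affine_pushforward /= /mscale /= /pushforward.
have -> : rV_affine t z @^-1` rV_box a b =
    rV_box (\row_i ((a ord0 i - z ord0 i) / t)) (\row_i ((b ord0 i - z ord0 i) / t)).
  apply/seteqP; split => x h i; have := h i; rewrite /rV_affine !mxE.
    by rewrite ler_pdivrMr// ler_pdivlMr// lerBlDr lerBrDr mulrC.
  by rewrite ler_pdivrMr// ler_pdivlMr// lerBlDr lerBrDr mulrC.
have [h|/existsNP[i /negP]] := pselect (forall i, a ord0 i <= b ord0 i).
  rewrite !lebesgue_rV_box//; last first.
    by move=> i; rewrite !mxE ler_pdivrMr// divfK ?gt_eqF// lerD2r.
  rewrite -EFinM; congr EFin.
  have -> : t ^+ n = \prod_(i < n) t by rewrite prodr_const card_ord.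
  rewrite -big_split/=; apply: eq_bigr => i _.
  by rewrite !mxE; field; rewrite gt_eqF.
rewrite -ltNge => ab; rewrite (rV_box_empty ab) (@rV_box_empty _ _ i).
  by rewrite !measure0 mule0.
by rewrite !mxE ltr_pM2r ?invr_gt0// ltrD2r.
Qed.

Lemma ge0_integral_rV_affine (t : R) (z : E) (f : E -> \bar R) : 0 < t ->
  measurable_fun setT f -> (forall x, 0 <= f x)%E ->
  (\int[lebesgue_rV n]_x f x =
   (t ^+ n)%:E * \int[lebesgue_rV n]_x f (t *: x + z)%R)%E.
Proof.
move=> t0 mf f0.
have tn0 : 0 <= t ^+ n by rewrite exprn_ge0// ltW.
transitivity (\int[rV_affine_pushforward (NngNum tn0) t z]_x f x)%E.
  apply: eq_measure_integral => A mA _; exact: lebesgue_rV_affine.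
rewrite ge0_integral_mscale//=; congr (_ * _)%E.
by rewrite ge0_integral_pushforward//; exact: measurable_rV_affine.
Qed.

Lemma Rintegrable_rV_affine (t : R) (z : E) (f : E -> R) : 0 < t ->
  Rintegrable (lebesgue_rV n) f ->
  Rintegrable (lebesgue_rV n) (fun x => f (t *: x + z)).
Proof.
move=> t0 fi; have mf := Rintegrable_meas fi.
have mf' : measurable_fun setT (fun x : E => f (t *: x + z)).
  by apply: (measurableT_comp mf); exact: measurable_rV_affine.
apply/integrableP; split; first exact/measurable_EFinP.
have /integrableP[_] := fi.
rewrite (@ge0_integral_rV_affine t z)//; last first.
  by apply: measurableT_comp => //; exact/measurable_EFinP.
have t1 : 0 < (t ^+ n)^-1 by rewrite invr_gt0 exprn_gt0.
move=> h; rewrite -[ltLHS]mul1e -(@divff _ (t ^+ n)) ?gt_eqF ?exprn_gt0//.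
rewrite EFinM -muleA muleCA; apply: lte_mul_pinfty => //.
by rewrite lee_fin ltW.
Qed.

Lemma Rint_rV_affine (t : R) (z : E) (f : E -> R) : 0 < t ->
  Rintegrable (lebesgue_rV n) f ->
  \int[lebesgue_rV n]_x f x = t ^+ n * \int[lebesgue_rV n]_x f (t *: x + z).
Proof.
move=> t0 fi.
have mf := Rintegrable_meas fi.
have mp : measurable_fun setT (fun x => maxr (f x) 0) by exact: measurable_maxr.
have mn : measurable_fun setT (fun x => maxr (- f x) 0).
  by apply: measurable_maxr => //; exact: measurableT_comp.
have pi : Rintegrable (lebesgue_rV n) (fun x => maxr (f x) 0).
  apply: (Rintegrable_le mp (Rintegrable_abs fi)) => x.
  by rewrite ger0_norm ?le_max ?lexx ?orbT// ge_max ler_norm normr_ge0.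
have ni : Rintegrable (lebesgue_rV n) (fun x => maxr (- f x) 0).
  apply: (Rintegrable_le mn (Rintegrable_abs fi)) => x.
  by rewrite ger0_norm ?le_max ?lexx ?orbT// ge_max -normrN ler_norm normr_ge0.
have key (g : E -> R) : measurable_fun setT g -> Rintegrable (lebesgue_rV n) g ->
    (forall x, 0 <= g x) ->
    \int[lebesgue_rV n]_x g x = t ^+ n * \int[lebesgue_rV n]_x g (t *: x + z).
  move=> mg gi g0; apply: EFin_inj; rewrite EFinM -!EFin_Rintegral//; last first.
    exact: Rintegrable_rV_affine.
  rewrite (@ge0_integral_rV_affine t z)//; exact/measurable_EFinP.
have fE x : f x = maxr (f x) 0 - maxr (- f x) 0.
  by rewrite /maxr; case: ltP => h1; case: ltP => h2; lra.
transitivity (\int[lebesgue_rV n]_x (maxr (f x) 0 - maxr (- f x) 0)).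
  by apply: eq_Rintegral => x _; rewrite -fE.
rewrite RintB// (key _ mp pi) ?(key _ mn ni); last 2 first.
- by move=> x; rewrite le_max lexx orbT.
- by move=> x; rewrite le_max lexx orbT.
rewrite -mulrBr -RintB; last 2 first.
- exact: (Rintegrable_rV_affine _ _ pi).
- exact: (Rintegrable_rV_affine _ _ ni).
by congr (_ * _); apply: eq_Rintegral => x _; rewrite -fE.
Qed.

Lemma Rintegrable_rV_shift (z : E) (f : E -> R) :
  Rintegrable (lebesgue_rV n) f -> Rintegrable (lebesgue_rV n) (fun x => f (x + z)).
Proof.
move=> fi; have := @Rintegrable_rV_affine 1 z f ltr01 fi.
by apply: eq_Rintegrable => x; rewrite scale1r.
Qed.

Lemma Rint_rV_shift (z : E) (f : E -> R) : Rintegrable (lebesgue_rV n) f ->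
  \int[lebesgue_rV n]_x f (x + z) = \int[lebesgue_rV n]_x f x.
Proof.
move=> fi; rewrite [RHS](@Rint_rV_affine 1 z)// expr1n mul1r.
by apply: eq_Rintegral => x _; rewrite scale1r.
Qed.

Lemma measurable_fun_rV_comp d (T : measurableType d) (f : E -> R) (g : T -> E) :
  measurable_fun setT f -> (forall i, measurable_fun setT (fun x => g x ord0 i)) ->
  measurable_fun setT (fun x => f (g x)).
Proof.
by move=> mf mg; apply: (measurableT_comp mf); exact: measurable_fun_rVP.
Qed.

End rV_borel.

Lemma measurable_rV_coord (R : realType) (n : nat) (i : 'I_n) :
  measurable_fun setT (fun x : 'rV[R]_n => x ord0 i).
Proof. exact: measurable_rV_coor. Qed.

(** * Test functions *)

Section flat_functions.
Context {R : realType}.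

(* All derivatives of [exp (- 1 / t)] are linear combinations of these functions. *)
Definition flat (k : nat) (t : R) : R :=
  if 0 < t then t ^- k * expR (- t^-1) else 0.

Lemma is_deriveP (V W : normedModType R) (f : V -> W) x v l :
  is_derive x v f l <-> h^-1 *: (f (h *: v + x) - f x) @[h --> 0^'] --> l.
Proof.
split=> [[df <-]|h]; first exact: df.
have df : derivable f x v by apply/cvg_ex; exists l.
by apply: (DeriveDef df); exact: cvg_lim h.
Qed.

Lemma is_derive_val (V W : normedModType R) (f : V -> W) x v a b :
  is_derive x v f a -> a = b -> is_derive x v f b.
Proof. by move=> ? <-. Qed.

Lemma cvg_dnbhs0 (T : Type) (F : set_system T) (g : T -> R) : Filter F ->
  g @ F --> (0 : R) -> (\forall x \near F, g x != 0) -> g @ F --> (0 : R)^'.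
Proof.
move=> FF g0 gn0 A hA; have h := g0 _ hA.
by apply: filterS2 gn0 h => x nz; apply.
Qed.

Lemma flat_ge0 k t : 0 <= flat k t.
Proof.
by rewrite /flat; case: ifPn => // t0; rewrite mulr_ge0 ?expR_ge0 ?invr_ge0 ?exprn_ge0 ?ltW.
Qed.

Lemma flat0_le1 t : flat 0 t <= 1.
Proof.
rewrite /flat; case: ifPn => // t0; rewrite expr0 invr1 mul1r.
by rewrite -(expR0 R) ler_expR oppr_le0 invr_ge0 ltW.
Qed.

(** [exp (1 / t)] is the power [k + 2] of [exp (1 / ((k + 2) t))], which is at least
    [1 / ((k + 2) t)]. Vanishing of second order at 0 makes the derivative there 0. *)
Lemma flat_le_sqr k : exists2 K : R, 0 < K & forall t, flat k t <= K * t ^+ 2.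
Proof.
exists (k.+2%:R ^+ k.+2) => [|t]; first by rewrite exprn_gt0.
rewrite /flat; case: ifPn => [t0|_]; last first.
  by rewrite mulr_ge0 ?sqr_ge0// exprn_ge0.
have h : expR (- t^-1) <= (k.+2%:R * t) ^+ k.+2.
  rewrite expRN -[leRHS]invrK lef_pV2 ?posrE ?expR_gt0 ?invr_gt0 ?exprn_gt0 ?mulr_gt0//.
  rewrite -exprVn.
  have -> : t^-1 = k.+2%:R * (k.+2%:R * t)^-1.
    by field; rewrite gt_eqF//= pnatr_eq0.
  rewrite expRM_natl ler_pXn2r ?nnegrE ?expR_ge0 ?invr_ge0 ?mulr_ge0 ?ltW//.
  by apply: lt_le_trans (expR_ge1Dx _); rewrite ltrDr.
apply: (@le_trans _ _ (t ^- k * (k.+2%:R * t) ^+ k.+2)).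
  by rewrite ler_wpM2l// invr_ge0 exprn_ge0// ltW.
rewrite exprMn mulrCA; have -> : t ^- k * t ^+ k.+2 = t ^+ 2; last by [].
by rewrite -addn2 exprD mulKf// expf_neq0// gt_eqF.
Qed.

Lemma is_derive_flat k (t : R) :
  is_derive t 1 (flat k) (flat k.+2 t - k%:R * flat k.+1 t).
Proof.
have [t0|t0|t0] := ltgtP t 0.
- apply: (@near_eq_is_derive _ _ _ (cst 0)) => //.
    near=> s; rewrite /flat ltNge.
    suff -> : s <= 0 by [].
    by apply: ltW; near: s; exact: lt_nbhsl.
  apply: (is_derive_val (is_derive_cst _ _ _)).
  by rewrite /flat !ltNge !(ltW t0)/= mulr0 subr0.
- pose g (s : R) := s^-1 ^+ k * expR (- s^-1).
  apply: (@near_eq_is_derive _ _ _ g) => //.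
    near=> s; rewrite /flat /g.
    suff -> : 0 < s by rewrite exprVn.
    near: s; exact: lt_nbhsr.
  have tn0 : t != 0 by rewrite gt_eqF.
  rewrite /g; have dV : is_derive t 1 (fun s : R => s^-1) (- t^-1 ^+ 2).
    apply: (is_derive_val (@is_deriveV R (@id R) t 1 1 tn0 (is_derive_id _ _))).
    by rewrite /= exprVn [_%:A]mulr1.
  have dE : is_derive t 1 (fun s : R => expR (- s^-1))
      (t^-1 ^+ 2 * expR (- t^-1)).
    apply: (is_derive_val (@is_derive1_comp _ expR (fun s : R => - s^-1) t _ _
      (is_derive_expR _) (is_deriveN dV))).
    by rewrite opprK mulrC.
  have dP : is_derive t 1 (fun s : R => s^-1 ^+ k)
      (k%:R * t^-1 ^+ k.-1 * - t^-1 ^+ 2).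
    rewrite (_ : (fun s => _) = (fun s : R => s^-1) ^+ k); last first.
      by apply/funext => s; rewrite exprfctE.
    apply: (is_derive_val (@is_deriveX _ _ (fun s : R => s^-1) k t 1 _ dV)).
    by rewrite /GRing.scale/=; ring.
  apply: (is_derive_val (@is_deriveM _ _ _ _ _ _ _ _ dP dE)); rewrite /flat t0 /GRing.scale/= -!exprVn.
  by clear; case: k => [|k]; rewrite /= ?mul0r ?mulr0 ?exprS ?expr0; ring.
- rewrite t0; apply/is_deriveP; have [K K0 hK] := flat_le_sqr k.
  have fl0 j : flat j 0 = 0 by rewrite /flat ltxx.
  rewrite !fl0 mulr0 subr0; apply/cvgr0Pnorm_lt => e e0.
  near=> h; rewrite addr0 subr0 /GRing.scale/= mulr1 normrM normfV.
  have h0 : h != 0 by near: h; exact: nbhs_dnbhs_neq.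
  rewrite ltr_pdivrMl ?normr_gt0// ger0_norm ?flat_ge0//.
  rewrite (le_lt_trans (hK _))// -real_normK ?num_real// expr2 mulrCA.
  rewrite ltr_pM2l ?normr_gt0// mulrC -ltr_pdivlMr//.
  near: h; apply: dnbhs0_lt; exact: divr_gt0.
Unshelve. all: by end_near. Qed.

Lemma continuous_flat k : continuous (flat k).
Proof.
move=> t; apply: differentiable_continuous.
by apply/derivable1_diffP; have [] := is_derive_flat k t.
Qed.

End flat_functions.

Section test_functions.
Context {R : realType} {n : nat}.
Local Notation E := 'rV[R]_n.
Local Notation mu := (lebesgue_rV n : {measure set E -> \bar R}).
Implicit Types phi psi : E -> R.

(** A class of expressions closed under partial derivatives, so that smoothness of every order
    follows from one induction on the order. *)
Inductive flat_alg : (E -> R) -> Prop :=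
| flat_alg_cst c : flat_alg (fun=> c)
| flat_alg_coord k c d j : flat_alg (fun x => flat k (c * x ord0 j + d))
| flat_algD phi psi : flat_alg phi -> flat_alg psi ->
    flat_alg (fun x => phi x + psi x)
| flat_algM phi psi : flat_alg phi -> flat_alg psi ->
    flat_alg (fun x => phi x * psi x).

Lemma flat_alg_continuous phi : flat_alg phi -> continuous phi.
Proof.
elim=> [c x|k c d j x|f g _ hf _ hg x|f g _ hf _ hg x].
- exact: cst_continuous.
- apply: (@continuous_comp _ _ _ (fun x : E => c * x ord0 j + d) (flat k)).
    apply: (@continuousD _ _ _ (fun y : E => c * y ord0 j) (fun=> d)).
      apply: (@continuousM _ _ (fun=> c) (fun y : E => y ord0 j)).
        exact: cst_continuous.
      exact: coord_continuous.
    exact: cst_continuous.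
  exact: continuous_flat.
- by apply: (@continuousD _ _ _ f g); [exact: hf|exact: hg].
- by apply: (@continuousM _ _ f g); [exact: hf|exact: hg].
Qed.

Lemma flat_alg_partial phi i : flat_alg phi ->
  exists2 psi, flat_alg psi & forall x, is_derive x (basis_vec i) phi (psi x).
Proof.
elim=> [c|k c d j|f g af [f' af' hf] ag [g' ag' hg]|f g af [f' af' hf] ag [g' ag' hg]].
- by exists (fun=> 0) => [|x]; [exact: flat_alg_cst|exact: is_derive_cst].
- exists (fun x => (c * (i == j)%:R) * (flat k.+2 (c * x ord0 j + d) +
    - k%:R * flat k.+1 (c * x ord0 j + d))).
    apply: flat_algM; first exact: flat_alg_cst.
    apply: flat_algD; first exact: flat_alg_coord.
    by apply: flat_algM; [exact: flat_alg_cst|exact: flat_alg_coord].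
  move=> x; apply/is_deriveP; set y := c * x ord0 j + d.
  have d1 : is_derive (0 : R) 1 (fun h => flat k (h * (c * (i == j)%:R) + y))
      ((flat k.+2 y - k%:R * flat k.+1 y) * (c * (i == j)%:R)).
    have := @is_derive1_comp _ (flat k) (fun h => h * (c * (i == j)%:R) + y) 0
      (flat k.+2 y - k%:R * flat k.+1 y) (c * (i == j)%:R).
    apply; first by rewrite mul0r add0r; exact: is_derive_flat.
    apply/is_deriveP; apply: (@cvg_near_cst _ _ _ _ _ _).
    near=> h; rewrite [h%:A]mulr1 mul0r add0r addr0 addrK; apply: mulKf.
    by near: h; exact: nbhs_dnbhs_neq.
  move/is_deriveP : d1.
  have -> : (flat k.+2 y - k%:R * flat k.+1 y) * (c * (i == j)%:R) =
      c * (i == j)%:R * (flat k.+2 y + - k%:R * flat k.+1 y) by ring.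
  apply: cvg_trans; apply: near_eq_cvg; apply: nearW => h /=.
  rewrite mul0r add0r addr0 [h%:A]mulr1 !mxE eqxx/= eq_sym.
  by congr (_ * (flat _ _ - _)); rewrite /y; ring.
- exists (fun x => f' x + g' x) => [|x]; first exact: flat_algD.
  exact: is_deriveD.
- exists (fun x => f x * g' x + g x * f' x) => [|x].
    by apply: flat_algD; exact: flat_algM.
  exact: is_deriveM.
Unshelve. all: by end_near. Qed.

Lemma flat_alg_Ck phi k : flat_alg phi -> Ck k phi.
Proof.
elim: k phi => [|k IH] phi h; split; [exact: flat_alg_continuous|by []|
  exact: flat_alg_continuous|].
move=> i; have [psi hpsi dpsi] := flat_alg_partial i h; split.
  by move=> x; have [] := dpsi x.
rewrite (_ : partial i phi = psi); first exact: IH.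
by apply/funext => x; rewrite /partial; have [] := dpsi x.
Qed.

Lemma flat_alg_prod (s : seq 'I_n) (F : 'I_n -> E -> R) :
  (forall i, flat_alg (F i)) -> flat_alg (fun x => \prod_(i <- s) F i x).
Proof.
move=> hF; elim: s => [|i s IH].
  rewrite (_ : (fun _ => _) = fun=> 1); first exact: flat_alg_cst.
  by apply/funext => x; rewrite big_nil.
rewrite (_ : (fun _ => _) = fun x => F i x * \prod_(j <- s) F j x).
  exact: flat_algM.
by apply/funext => x; rewrite big_cons.
Qed.

Lemma test_function_compact_box phi a b : (forall k, Ck k phi) ->
  (forall x, phi x != 0 -> rV_box a b x) -> test_function phi.
Proof.
move=> ck sup; split => //.
have cpt : compact (rV_box a b).
  have := @rV_compact R n (fun i => `[a ord0 i, b ord0 i]%classic).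
  have -> : [set v : E | forall i, `[a ord0 i, b ord0 i]%classic (v ord0 i)] =
    rV_box a b by apply/seteqP; split => x h i; have := h i; rewrite /= in_itv.
  by apply=> i; exact: segment_compact.
apply: (subclosed_compact (@closed_closure _ _) cpt).
have cl : closed (rV_box a b) by apply: compact_closed => //; exact: norm_hausdorff.
by rewrite (closure_id (rV_box a b)).1//; apply: closure_subset => x; exact: sup.
Qed.

(* As [k] grows, [flat 0 (k^2 s + k)] tends to 1 if [0 <= s] and to 0 if [s < 0]. *)
Definition rV_bump (a b : E) (k : nat) (x : E) : R :=
  \prod_i (flat 0 (k%:R ^+ 2 * (x ord0 i - a ord0 i) + k%:R) *
           flat 0 (k%:R ^+ 2 * (b ord0 i - x ord0 i) + k%:R)).

Lemma bump_ge0 a b k x : 0 <= rV_bump a b k x.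
Proof. by apply: prodr_ge0 => i _; rewrite mulr_ge0// flat_ge0. Qed.

Lemma bump_le1 a b k x : rV_bump a b k x <= 1.
Proof.
apply: prodr_ile1 => i _; rewrite mulr_ge0 ?flat_ge0//=.
by rewrite mulr_ile1 ?flat_ge0 ?flat0_le1.
Qed.

Lemma flat_neq0 k (t : R) : flat k t != 0 -> 0 < t.
Proof. by rewrite /flat; case: ifP => //; rewrite eqxx. Qed.

Lemma bump_support a b k x : (0 < k)%N -> rV_bump a b k x != 0 ->
  rV_box (a - const_mx 1) (b + const_mx 1) x.
Proof.
move=> k0 + i; rewrite /rV_bump (bigD1 i)//= !mulf_eq0 !negb_or.
move=> /andP[/andP[/flat_neq0 h1 /flat_neq0 h2] _]; rewrite !mxE.
have k1 : 1 <= k%:R :> R by rewrite ler1n.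
by apply/andP; split; rewrite leNgt; apply/negP => h; nra.
Qed.

Lemma bump_flat_alg a b k : flat_alg (rV_bump a b k).
Proof.
apply: flat_alg_prod => i; apply: flat_algM.
  rewrite (_ : (fun _ => _) = (fun x : E => flat 0 (k%:R ^+ 2 * x ord0 i +
    (k%:R - k%:R ^+ 2 * a ord0 i)))); first exact: flat_alg_coord.
  by apply/funext => x; congr (flat _ _); ring.
rewrite (_ : (fun _ => _) = (fun x : E => flat 0 (- k%:R ^+ 2 * x ord0 i +
  (k%:R + k%:R ^+ 2 * b ord0 i)))); first exact: flat_alg_coord.
by apply/funext => x; congr (flat _ _); ring.
Qed.

Lemma bump_test a b k : (0 < k)%N -> test_function (rV_bump a b k).
Proof.
move=> k0; apply: (@test_function_compact_box _ (a - const_mx 1) (b + const_mx 1)).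
  by move=> m; apply: flat_alg_Ck; exact: bump_flat_alg.
by move=> x; exact: bump_support.
Qed.

Lemma cvg_flat0_ge0 (t : R) : 0 <= t ->
  flat 0 (k%:R ^+ 2 * t + k%:R) @[k --> \oo] --> (1 : R).
Proof.
move=> t0; apply: (@squeeze_cvgr _ _ _ _ (fun k : nat => 1 - k%:R^-1) (fun=> 1)).
- near=> k; rewrite flat0_le1 andbT.
  have k0 : 0 < k%:R :> R by rewrite ltr0n; near: k; exists 1%N.
  have c0 : 0 < k%:R ^+ 2 * t + k%:R by rewrite ltr_wpDl// mulr_ge0// sqr_ge0.
  rewrite /flat c0 expr0 invr1 mul1r (le_trans _ (expR_ge1Dx _))//.
  by rewrite lerD2l lerN2 lef_pV2 ?posrE// lerDr mulr_ge0// sqr_ge0.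
- rewrite -[X in _ --> X]subr0; apply: cvgB; first exact: cvg_cst.
  apply/gtr0_cvgV0; last exact: cvgr_idn.
  by near=> k; rewrite ltr0n; near: k; exists 1%N.
- exact: cvg_cst.
Unshelve. all: by end_near. Qed.

Lemma cvg_flat0_lt0 (t : R) : t < 0 ->
  flat 0 (k%:R ^+ 2 * t + k%:R) @[k --> \oo] --> (0 : R).
Proof.
move=> t0; apply: cvg_near_cst; near=> k.
have : (- t)^-1 <= k%:R by near: k; exact: nbhs_infty_ger.
rewrite invf_ple ?posrE ?oppr_gt0//; last first.
  by rewrite ltr0n; near: k; exists 1%N.
have k0 : 0 < k%:R :> R by rewrite ltr0n; near: k; exists 1%N.
rewrite /flat => h; case: ifPn => // c0; exfalso.
have : 1 <= - t * k%:R by rewrite -ler_pdivrMr// mul1r.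
nra.
Unshelve. all: by end_near. Qed.

Lemma cvg_bump a b x : rV_bump a b k x @[k --> \oo] --> (\1_(rV_box a b) x : R).
Proof.
have [bx|/existsNP[i /negP]] := pselect (rV_box a b x).
  rewrite indicE mem_set//=.
  have -> : 1 = \prod_(i < n) (1 : R) by rewrite big1.
  apply: cvg_big => [|i _]; last rewrite -[X in _ --> X](mulr1 1).
    exact: mul_continuous.
  have /andP[h1 h2] := bx i.
  by apply: cvgM; apply: cvg_flat0_ge0; rewrite subr_ge0.
rewrite negb_and -!ltNge => h.
rewrite indicE memNset/=; last first.
  by move=> /(_ i)/andP[h1 h2]; case/orP : h; rewrite ltNge ?h1 ?h2.
suff h0 : flat 0 (k%:R ^+ 2 * (x ord0 i - a ord0 i) + k%:R) *
    flat 0 (k%:R ^+ 2 * (b ord0 i - x ord0 i) + k%:R) @[k --> \oo] --> (0 : R).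
  apply: (@squeeze_cvgr _ _ _ _ (fun=> 0) _ _ _ _ _ h0); last exact: cvg_cst.
  apply: nearW => k; rewrite bump_ge0/= /rV_bump (bigD1 i)//=.
  rewrite ler_piMr ?mulr_ge0 ?flat_ge0//; apply: prodr_ile1 => j _.
  by rewrite mulr_ge0 ?flat_ge0//= mulr_ile1 ?flat_ge0 ?flat0_le1.
case/orP : h => h.
  apply: (@squeeze_cvgr _ _ _ _ (fun=> 0) (fun k =>
    flat 0 (k%:R ^+ 2 * (x ord0 i - a ord0 i) + k%:R))); last 2 first.
  - exact: cvg_cst.
  - by apply: cvg_flat0_lt0; rewrite subr_lt0.
  by apply: nearW => k; rewrite mulr_ge0 ?flat_ge0//= ler_piMr ?flat_ge0 ?flat0_le1.
apply: (@squeeze_cvgr _ _ _ _ (fun=> 0) (fun k =>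
  flat 0 (k%:R ^+ 2 * (b ord0 i - x ord0 i) + k%:R))); last 2 first.
- exact: cvg_cst.
- by apply: cvg_flat0_lt0; rewrite subr_lt0.
by apply: nearW => k; rewrite mulr_ge0 ?flat_ge0//= ler_piMl ?flat_ge0 ?flat0_le1.
Qed.

Lemma test_continuous phi : test_function phi -> continuous phi.
Proof. by move=> [/(_ 0%N)[]]. Qed.

Lemma test_measurable phi : test_function phi -> measurable_fun setT phi.
Proof. by move=> /test_continuous/rV_continuous_measurable. Qed.

Lemma test_support phi : test_function phi ->
  exists2 M : R, 0 <= M & forall x, phi x != 0 -> `|x| <= M.
Proof.
move=> [_ /compact_bounded[M [_ hM]]].
exists (`|M| + 1) => [|x px]; first by rewrite addr_ge0.
apply: (hM (`|M| + 1)); first by rewrite ltr_pwDr// ler_norm.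
exact: subset_closure.
Qed.

Lemma continuous_support_bounded phi (M : R) : continuous phi ->
  (forall x, phi x != 0 -> `|x| <= M) ->
  exists2 C : R, 0 <= C & forall x, `|phi x| <= C.
Proof.
move=> cphi sup.
have cpt : compact (rV_box (const_mx (- M) : E) (const_mx M)).
  have := @rV_compact R n (fun i => `[- M, M]%classic).
  have -> : [set v : E | forall i, `[- M, M]%classic (v ord0 i)] =
    rV_box (const_mx (- M)) (const_mx M).
    by apply/seteqP; split => x h i; have := h i; rewrite /= !mxE in_itv.
  by apply=> i; exact: segment_compact.
have : compact (phi @` rV_box (const_mx (- M) : E) (const_mx M)).
  by apply: continuous_compact => //; exact: continuous_subspaceT.
move=> /compact_bounded[K [_ hK]].
exists (`|K| + 1) => [|x]; first by rewrite addr_ge0.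
have [->|px] := eqVneq (phi x) 0; first by rewrite normr0 addr_ge0.
apply: (hK (`|K| + 1)); first by rewrite ltr_pwDr// ler_norm.
exists x => // i; rewrite !mxE -ler_norml.
exact: (le_trans (rV_norm_coord x i) (sup x px)).
Qed.

Lemma derive_support phi v (M : R) : (forall x, phi x != 0 -> `|x| <= M) ->
  forall x, 'D_v phi x != 0 -> `|x| <= M.
Proof.
move=> sup x; apply: contraNT; rewrite -ltNge => xM; apply/eqP.
have [->|v0] := eqVneq v 0; first by rewrite derive0.
transitivity ('D_v (cst 0 : E -> R) x); last exact: derive_cst.
apply: near_eq_derive => //; near=> y; rewrite /=.
apply/eqP; apply: contraT => /sup; rewrite leNgt => /negP[].
near: y; apply: (@cvgr_gt _ _ _ _ (fun y : E => `|y|) `|x|) => //.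
exact: norm_continuous.
Unshelve. all: by end_near. Qed.

Lemma test_partial_Ck phi i : (forall k, Ck k phi) ->
  (forall k, Ck k (partial i phi)) /\ forall x, derivable phi x (basis_vec i).
Proof.
move=> ck; split=> [k|]; first by have [_ /(_ i)[]] := ck k.+1.
by have [_ /(_ i)[]] := ck 1%N.
Qed.

Lemma test_partial phi i : test_function phi -> test_function (partial i phi).
Proof.
move=> tphi; have [M M0 hM] := test_support tphi; case: tphi => ck _.
have [ck' _] := test_partial_Ck i ck.
apply: (@test_function_compact_box _ (const_mx (- M)) (const_mx M)) => // x px j.
rewrite !mxE -ler_norml (le_trans (rV_norm_coord x j))//.
exact: (derive_support hM px).
Qed.

Lemma test_derivable phi i (x : E) : test_function phi ->
  derivable phi x (basis_vec i).
Proof. by case=> ck _; have [_] := test_partial_Ck i ck. Qed.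

Lemma Rintegrable_box (a b : E) : Rintegrable mu (\1_(rV_box a b) : E -> R).
Proof.
have [] := @Rintegrable_indic _ _ _ mu (rV_box a b) => //.
  exact: measurable_rV_box.
exact: lebesgue_rV_box_lty.
Qed.

Lemma Rintegrable_bounded_support (f : E -> R) (C M : R) :
  measurable_fun setT f -> (forall x, `|f x| <= C) ->
  (forall x, f x != 0 -> `|x| <= M) -> Rintegrable mu f.
Proof.
move=> mf fC fM; pose Q := rV_box (const_mx (- M) : E) (const_mx M).
have iQ : Rintegrable mu (fun x => C * \1_Q x).
  by apply: RintegrableZ; exact: Rintegrable_box.
apply: (Rintegrable_le mf iQ) => x.
have [->|fx] := eqVneq (f x) 0.
  rewrite normr0 mulr_ge0// ?indicE//; exact: le_trans (fC x).
rewrite indicE mem_set ?mulr1// => i; rewrite !mxE -ler_norml.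
exact: (le_trans (rV_norm_coord x i) (fM x fx)).
Qed.

Lemma sqint_bounded_support (f : E -> R) (C M : R) :
  measurable_fun setT f -> (forall x, `|f x| <= C) ->
  (forall x, f x != 0 -> `|x| <= M) -> sqint mu f.
Proof.
move=> mf fC fM; split => //.
apply: (@Rintegrable_bounded_support _ (C ^+ 2) M) => [|x|x].
- exact: measurable_funX.
- by rewrite normrX ler_pXn2r ?nnegrE// (le_trans _ (fC x)).
- by rewrite expf_eq0/=; exact: fM.
Qed.

Lemma test_sqint phi : test_function phi -> sqint mu phi.
Proof.
move=> tphi; have [M M0 hM] := test_support tphi.
have [C C0 hC] := continuous_support_bounded (test_continuous tphi) hM.
by apply: (@sqint_bounded_support _ C M) => //; exact: test_measurable.
Qed.

Lemma test_integrable phi : test_function phi -> Rintegrable mu phi.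
Proof.
move=> tphi; have [M M0 hM] := test_support tphi.
have [C C0 hC] := continuous_support_bounded (test_continuous tphi) hM.
by apply: (@Rintegrable_bounded_support _ C M) => //; exact: test_measurable.
Qed.

Lemma derive_affine phi (t : R) (z v x : E) : t != 0 ->
  (forall y, derivable phi y v) ->
  is_derive x v (fun y => phi (t *: y + z)) (t * 'D_v phi (t *: x + z)).
Proof.
move=> t0 dphi; apply/is_deriveP.
have /derivableP/is_deriveP h := dphi (t *: x + z).
have : (fun h => t * (h^-1 *: (phi (h *: v + (t *: x + z)) - phi (t *: x + z))))
    @ 0^' --> t * 'D_v phi (t *: x + z) by apply: cvgMr.
have h2 : (fun h => t * h) @ 0^' --> (0 : R)^'.
  apply: cvg_dnbhs0; last first.
    by near=> s; rewrite mulf_neq0//; near: s; exact: nbhs_dnbhs_neq.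
  by rewrite -[X in _ --> X](mulr0 t); apply: cvgMr; exact: cvg_within.
move=> h3; apply: cvg_trans (cvg_comp _ _ h2 h3); apply: near_eq_cvg.
near=> s; have s0 : s != 0 by near: s; exact: nbhs_dnbhs_neq.
have E1 : (t * s) *: v + (t *: x + z) = t *: (s *: v + x) + z.
  by rewrite scalerDr scalerA addrA.
rewrite /= E1; set X := (_ - _).
transitivity (t * ((t * s)^-1 * X)); first by [].
by rewrite invfM !mulrA divff// mul1r.
Unshelve. all: by end_near. Qed.

Lemma Ck_affine phi (t : R) (z : E) k : t != 0 -> (forall k, Ck k phi) ->
  Ck k (fun y => phi (t *: y + z)).
Proof.
move=> t0 ckphi.
have ct (f : E -> R) c : continuous f ->
    continuous (fun y : E => c * f (t *: y + z)).
  move=> cf x; apply: (@continuousM _ _ (fun=> c) (fun y : E => f (t *: y + z))).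
    exact: cst_continuous.
  apply: (@continuous_comp _ _ _ (fun y : E => t *: y + z) f); last exact: cf.
  apply: (@continuousD _ _ _ (fun y : E => t *: y) (fun=> z)).
    by apply: (@continuousZl_tmp _ _ _ id); exact: cvg_id.
  exact: cst_continuous.
suff h : forall c, Ck k (fun y => c * phi (t *: y + z)).
  by have := h 1; under eq_fun do rewrite mul1r.
elim: k phi ckphi => [|k IH] phi ckphi c.
  by split => //; apply: ct; case: (ckphi 0%N).
split; first by apply: ct; case: (ckphi 0%N).
move=> i; have [ck' dphi] := test_partial_Ck i ckphi.
have dd x : is_derive x (basis_vec i) (fun y => c * phi (t *: y + z))
    (c * t * partial i phi (t *: x + z)).
  have h := is_deriveZ c (derive_affine z x t0 dphi).
  by apply: (is_derive_val h); exact: mulrA.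
split; first by move=> x; have [] := dd x.
rewrite (_ : partial i _ = fun x => c * t * partial i phi (t *: x + z)).
  exact: IH.
by apply/funext => x; have [_] := dd x.
Qed.

Lemma test_affine phi (t : R) (z : E) : 0 < t -> test_function phi ->
  test_function (fun x => phi (t *: x + z)).
Proof.
move=> t0 tphi; have [M M0 hM] := test_support tphi.
have r0 : 0 <= (M + `|z|) / t by rewrite divr_ge0 ?addr_ge0// ltW.
apply: (@test_function_compact_box _ (const_mx (- ((M + `|z|) / t)))
  (const_mx ((M + `|z|) / t))).
  by move=> k; apply: Ck_affine; [rewrite gt_eqF|case: tphi].
move=> x /hM h i; rewrite !mxE -ler_norml (le_trans (rV_norm_coord x i))//.
rewrite ler_pdivlMr//.
have -> : `|x| * t = `|t *: x| by rewrite normrZ gtr0_norm// mulrC.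
have -> : t *: x = (t *: x + z) - z by rewrite addrK.
by rewrite (le_trans (ler_normB _ _))// lerD2r.
Qed.

Lemma partial_affine phi (t : R) (z : E) i x : 0 < t -> test_function phi ->
  partial i (fun y => phi (t *: y + z)) x = t * partial i phi (t *: x + z).
Proof.
move=> t0 tphi; rewrite /partial.
have [] := @derive_affine phi t z (basis_vec i) x _ _ => //.
  by rewrite gt_eqF.
by move=> y; exact: test_derivable.
Qed.

Lemma test_shift phi (z : E) : test_function phi -> test_function (fun x => phi (x + z)).
Proof.
move=> /(test_affine z ltr01); rewrite (_ : (fun x => phi (1 *: x + z)) =
  (fun x => phi (x + z)))//; by apply/funext => x; rewrite scale1r.
Qed.

Lemma partial_shift phi (z : E) i x : test_function phi ->
  partial i (fun y => phi (y + z)) x = partial i phi (x + z).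
Proof.
move=> tphi; have := partial_affine z i x ltr01 tphi.
rewrite scale1r mul1r (_ : (fun y => phi (1 *: y + z)) = (fun y => phi (y + z)))//.
by apply/funext => y; rewrite scale1r.
Qed.

Lemma is_derive_line phi (x v : E) (s : R) : derivable phi (x + s *: v) v ->
  is_derive s 1 (fun r : R => phi (x + r *: v)) ('D_v phi (x + s *: v)).
Proof.
move=> /derivableP/is_deriveP h; apply/is_deriveP; apply: cvg_trans h.
apply: near_eq_cvg; apply: nearW => r /=; rewrite [r%:A]mulr1.
by congr (_ *: (phi _ - _)); rewrite scalerDl addrCA.
Qed.

Lemma mvt_line phi i (x : E) (h C : R) : (forall y, derivable phi y (basis_vec i)) ->
  (forall y, `|partial i phi y| <= C) ->
  `|phi (x + h *: basis_vec i) - phi x| <= C * `|h|.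
Proof.
move=> dphi hC.
wlog h0 : x h / 0 <= h.
  move=> wl; have [/wl //|h0] := leP 0 h.
  have := wl (x + h *: basis_vec i) (- h); rewrite scaleNr addrK normrN distrC.
  by apply; rewrite oppr_ge0 ltW.
have [h1|hn0] := eqVneq h 0.
  by rewrite h1 scale0r addr0 subrr normr0 mulr0.
have hp : 0 < h by rewrite lt_neqAle eq_sym hn0.
have dl s := @is_derive_line phi x (basis_vec i) s (dphi _).
have [|c _] := @MVT R (fun r => phi (x + r *: basis_vec i))
    (fun r => partial i phi (x + r *: basis_vec i)) 0 h hp (fun s _ => dl s).
  apply: derivable_within_continuous => s _; by have [] := dl s.
by rewrite scale0r addr0 subr0 => ->; rewrite normrM ler_wpM2r.
Qed.

(** Difference quotients have integral 0 by translation invariance, and dominated convergence passes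
    to the derivative. *)
Lemma Rint_partial0 psi i (M : R) : continuous psi ->
  (forall x, derivable psi x (basis_vec i)) -> continuous (partial i psi) ->
  (forall x, psi x != 0 -> `|x| <= M) ->
  \int[mu]_x partial i psi x = 0.
Proof.
move=> cpsi dpsi cd sup.
have mpsi := rV_continuous_measurable cpsi.
have md := rV_continuous_measurable cd.
have [C C0 hC] := continuous_support_bounded cd (derive_support sup).
have [C' C'0 hC'] := continuous_support_bounded cpsi sup.
have ipsi := Rintegrable_bounded_support mpsi hC' sup.
pose q (k : nat) (x : E) := k.+1%:R * (psi (x + k.+1%:R^-1 *: basis_vec i) - psi x).
have q0 k : \int[mu]_x q k x = 0.
  rewrite /q RintZ; last by apply: RintegrableB => //; exact: Rintegrable_rV_shift.
  rewrite RintB//; last exact: Rintegrable_rV_shift.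
  by rewrite Rint_rV_shift// subrr mulr0.
have e1 : `|basis_vec i : E| <= 1.
  by apply/rV_norm_leP => // j; rewrite !mxE eqxx/=; case: eqP; rewrite ?normr1 ?normr0.
(* The shifts have length at most 1, so all quotients vanish outside the cube of half-width [M + 1];
   the mean value theorem bounds them by [C]. *)
have iQ : Rintegrable mu (fun x => C * \1_(rV_box (const_mx (- (M + 1)) : E)
    (const_mx (M + 1))) x).
  by apply: RintegrableZ; exact: Rintegrable_box.
have [|||_ h] := @Rint_dominated _ _ _ mu q (partial i psi) _ _ md _ iQ _.
- move=> k; apply: measurable_funM => //; apply: measurable_funB => //.
  apply: (measurable_fun_rV_comp mpsi) => j /=.
  under eq_fun do rewrite mxE.
  by apply: measurable_funD => //; exact: measurable_rV_coord.
- apply: aeW => x; have /derivableP/is_deriveP h := dpsi x.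
  have hk : k.+1%:R^-1 @[k --> \oo] --> (0 : R)^'.
    apply: cvg_dnbhs0; first exact: cvg_harmonic.
    by apply: nearW => k; rewrite invr_eq0 pnatr_eq0.
  apply: cvg_trans (cvg_comp _ _ hk h); apply: near_eq_cvg.
  by apply: nearW => k; rewrite /q /= invrK [x + _]addrC.
- apply: aeW => x k; rewrite /q normrM normr_nat.
  have hb := @mvt_line psi i x k.+1%:R^-1 C dpsi hC.
  rewrite indicE; case: (asboolP (rV_box (const_mx (- (M + 1)) : E)
    (const_mx (M + 1)) x)) => hx.
    rewrite mem_set// mulr1.
    rewrite -ler_pdivlMl ?ltr0n// (le_trans hb)// ger0_norm ?invr_ge0//.
    by rewrite mulrC.
  rewrite memNset// mulr0.
  suff [-> ->] : psi (x + k.+1%:R^-1 *: basis_vec i) = 0 /\ psi x = 0.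
    by rewrite subrr normr0 mulr0.
  split; apply/eqP; apply: contraT => /sup hs; exfalso; apply: hx => j;
    rewrite !mxE -ler_norml (le_trans (rV_norm_coord x j))//; last first.
    by rewrite (le_trans hs)// lerDl.
  have -> : x = (x + k.+1%:R^-1 *: basis_vec i) - k.+1%:R^-1 *: basis_vec i.
    by rewrite addrK.
  rewrite (le_trans (ler_normB _ _))// lerD// normrZ.
  rewrite mulr_ile1// ger0_norm ?invr_ge0//.
  by rewrite invf_le1 ?ltr0n// ler1n.
rewrite -(cvg_lim (@Rhausdorff R) h) (_ : (fun k => _) = fun=> 0) ?lim_cst//.
by apply/funext => k; exact: q0.
Qed.

(** Integration by parts: [phi psi] has compact support, so the integral of its derivative is 0. *)
Lemma test_weak_partial phi i : test_function phi ->
  is_weak_partial i phi (partial i phi).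
Proof.
move=> tphi psi tpsi.
have [M M0 hM] := test_support tphi.
have tphi' := test_partial i tphi; have tpsi' := test_partial i tpsi.
have dd x : is_derive x (basis_vec i) (fun y => phi y * psi y)
    (phi x * partial i psi x + psi x * partial i phi x).
  have h1 := derivableP (@test_derivable _ i x tphi).
  have h2 := derivableP (@test_derivable _ i x tpsi).
  exact: is_deriveM.
have pE : partial i (fun y => phi y * psi y) =
    fun x => phi x * partial i psi x + psi x * partial i phi x.
  by apply/funext => x; have [_] := dd x.
have cM (f g : E -> R) : continuous f -> continuous g -> continuous (fun x : E => f x * g x : R).
  by move=> cf cg x; apply: (@continuousM _ _ f g); [exact: cf|exact: cg].
have : \int[mu]_x partial i (fun y => phi y * psi y) x = 0.
  apply: (@Rint_partial0 _ _ M).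
  - by apply: cM; exact: test_continuous.
  - by move=> x; have [] := dd x.
  - rewrite pE => x; apply: (@continuousD _ _ _ (fun x => phi x * partial i psi x)
      (fun x => psi x * partial i phi x)); apply: cM; exact: test_continuous.
  - by move=> x; rewrite mulf_eq0 negb_or => /andP[/hM].
rewrite pE RintD; [|exact: sqint_mul (test_sqint _) (test_sqint _)..].
move/eqP; rewrite addr_eq0 => /eqP ->; congr (- _).
by apply: eq_Rintegral => x _; rewrite mulrC.
Qed.

(** Bumps converge to indicators of boxes, so [w] has integral 0 on every box; within a fixed cube
    the sets with this property form a Dynkin class, hence contain all measurable sets. *)
Lemma fundamental_lemma (w : E -> R) : sqint mu w ->
  (forall phi, test_function phi -> \int[mu]_x (w x * phi x) = 0) ->
  {ae mu, forall x, w x = 0}.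
Proof.
move=> sw w0; have mw := sqint_meas sw.
have sbox a b : sqint mu (\1_(rV_box a b : set E) : E -> R).
  split; first by apply/measurable_indicP; exact: measurable_rV_box.
  rewrite (_ : (fun x => _) = (\1_(rV_box a b : set E) : E -> R)).
    exact: Rintegrable_box.
  by apply/funext => x; rewrite indicE; case: (x \in _); rewrite ?expr1n ?expr0n.
have box0 a b : \int[mu]_x (w x * \1_(rV_box a b) x) = 0.
  have iw : Rintegrable mu (fun x => `|w x * \1_(rV_box (a - const_mx 1)
      (b + const_mx 1)) x|).
    exact: Rintegrable_abs (sqint_mul sw (sbox _ _)).
  have [||||_ h] := @Rint_dominated _ _ _ mu (fun k x => w x * rV_bump a b k.+1 x)
    (fun x => w x * \1_(rV_box a b) x) _ _ _ _ iw _.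
  - move=> k; apply: measurable_funM => //.
    exact: test_measurable (bump_test _ _ _).
  - exact: measurable_funM mw (sqint_meas (sbox _ _)).
  - apply: aeW => x; apply: cvgMr.
    by have := @cvg_bump a b x; rewrite -(cvg_shiftS (fun k => rV_bump a b k x)).
  - apply: aeW => x k; rewrite !normrM ler_wpM2l//.
    rewrite ger0_norm ?bump_ge0// ger0_norm ?indicE//.
    have [->|/(bump_support (ltn0Sn _)) hx] := eqVneq (rV_bump a b k.+1 x) 0.
      by rewrite ler0n.
    by rewrite mem_set//= bump_le1.
  rewrite -(cvg_lim (@Rhausdorff R) h) (_ : (fun k => _) = fun=> 0) ?lim_cst//.
  by apply/funext => k; apply: w0; exact: bump_test.
(* [w] is square integrable but perhaps not integrable, so it is cut off to cubes, which exhaust the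
   space. *)
pose Q k := rV_cube k : set E.
have aek k : {ae mu, forall x, Q k x -> w x = 0}.
  pose g x := w x * \1_(Q k) x.
  have gi : Rintegrable mu g by exact: sqint_mul sw (sbox _ _).
  have mg := Rintegrable_meas gi.
  have gA A : measurable A -> (\int[mu]_(x in A) (g x)%:E = 0)%E.
    move=> mA; suff : forall S, <<s rV_boxes >> S ->
        measurable S /\ (\int[mu]_(x in S) (g x)%:E = 0)%E.
      by move=> h; have [] := h A; rewrite -?rV_measurableE.
    apply: (@dynkin_induction _ E rV_boxes
      [set A | measurable A /\ (\int[mu]_(x in A) (g x)%:E = 0)%E]).
    - exact: rV_measurableE.
    - exact: rV_boxes_setI.
    - split; first exact: measurableT.
      by rewrite EFin_Rintegral// box0.
    - move=> _ [a [b ->]]; split; first exact: measurable_rV_box.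
      rewrite integral_mkcond.
      transitivity (\int[mu]_x (w x * \1_(Q k `&` rV_box a b) x)%:E)%E.
        apply: eq_integral => x _; rewrite patchE /g indicI/=.
        rewrite [\1_(rV_box a b) x]indicE; case: ifPn => h; first by rewrite mulr1.
        by rewrite !mulr0.
      have [c [d ->]] := rV_boxes_setI (ex_intro _ _ (ex_intro _ _ (erefl (Q k))))
        (ex_intro _ a (ex_intro _ b (erefl (rV_box a b)))).
      by rewrite EFin_Rintegral ?box0//; exact: sqint_mul sw (sbox _ _).
    - move=> S mS [_ S0]; split; first exact: measurableC.
      have := @integral_setU _ _ _ mu S (~` S) (EFin \o g) mS (measurableC mS).
      rewrite setUv S0 add0e => <-; [by rewrite EFin_Rintegral ?box0|
        exact/measurable_EFinP|exact/disj_setPCl].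
    - move=> F mF tF hF; split; first exact: bigcupT_measurable.
      rewrite integral_bigcup//; last first.
        by apply: (integrableS measurableT) => //; exact: bigcupT_measurable.
      by apply: eseries0 => i _ _; have [] := hF i.
  have : ae_eq mu setT (EFin \o g) (cst 0)%E.
    apply: integral_ae_eq => // A _ mA; rewrite gA// integral0//.
  apply: filterS => x /(_ I)/= []; rewrite /g indicE => h Qx.
  by move: h; rewrite mem_set// mulr1.
have : {ae mu, forall x, forall k, Q k x -> w x = 0}.
  by apply: ae_foralln.
apply: filterS => x h.
have : (\bigcup_k rV_cube k) x by rewrite rV_cube_cover.
by move=> [k _] /h.
Qed.

End test_functions.

(** * The Dirichlet form on H^1 *)

(* Locked, since conversion would otherwise unfold the integrals. *)
HB.lock Definition dirichlet {R : realType} {n : nat} (u v : 'rV[R]_n -> R) : R :=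
  \sum_i \int[lebesgue_rV n]_x (weak_partial i u x * weak_partial i v x).

Section sobolev_H1.
Context {R : realType} {n : nat}.
Local Notation E := 'rV[R]_n.
Local Notation mu := (lebesgue_rV n : {measure set E -> \bar R}).
Implicit Types u v w g h phi : E -> R.

Lemma L2P u : L2 u <-> sqint mu u.
Proof. exact: sqintP. Qed.

Lemma weak_partial_unique i u g1 g2 : sqint mu g1 -> sqint mu g2 ->
  is_weak_partial i u g1 -> is_weak_partial i u g2 ->
  {ae mu, forall x, g1 x = g2 x}.
Proof.
move=> s1 s2 w1 w2.
have := @fundamental_lemma R n (fun x => g1 x - g2 x) (sqintB s1 s2).
have h phi : test_function phi -> \int[mu]_x ((g1 x - g2 x) * phi x) = 0.
  move=> tphi; have sphi := test_sqint tphi.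
  transitivity (\int[mu]_x (g1 x * phi x - g2 x * phi x)).
    by apply: eq_Rintegral => x _; rewrite mulrBl.
  rewrite RintB; [|exact: sqint_mul..].
  by apply/eqP; rewrite subr_eq0 -eqr_opp -w1// -w2.
by move=> /(_ h); apply: filterS => x /eqP; rewrite subr_eq0 => /eqP.
Qed.

Lemma H1_sqint u : H1 u -> sqint mu u.
Proof. by move=> [/L2P]. Qed.

Lemma H1_meas u : H1 u -> measurable_fun setT u.
Proof. by move=> /H1_sqint[]. Qed.

Lemma H1_intro u (g : 'I_n -> E -> R) : sqint mu u ->
  (forall i, sqint mu (g i)) -> (forall i, is_weak_partial i u (g i)) -> H1 u.
Proof.
by move=> su sg wg; split=> [|i]; [exact/L2P|exists (g i); split => //; exact/L2P].
Qed.

Lemma weak_partialP i u : H1 u ->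
  sqint mu (weak_partial i u) /\ is_weak_partial i u (weak_partial i u).
Proof.
move=> [_ /(_ i)[g hg]]; rewrite /weak_partial.
by have [/L2P] := @xgetI _ (cst 0) [set g | L2 g /\ is_weak_partial i u g] g hg.
Qed.

Lemma weak_partial_sqint i u : H1 u -> sqint mu (weak_partial i u).
Proof. by move=> /(weak_partialP i)[]. Qed.

Lemma weak_partial_ae i u g : H1 u -> sqint mu g -> is_weak_partial i u g ->
  {ae mu, forall x, weak_partial i u x = g x}.
Proof.
move=> hu sg wg; have [s w] := weak_partialP i hu.
exact: weak_partial_unique s sg w wg.
Qed.

Lemma is_weak_partial_lin i u v gu gv (c : R) :
  sqint mu u -> sqint mu v -> sqint mu gu -> sqint mu gv ->
  is_weak_partial i u gu -> is_weak_partial i v gv ->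
  is_weak_partial i (fun x => u x + c * v x) (fun x => gu x + c * gv x).
Proof.
move=> su sv sgu sgv wu wv phi tphi.
have sphi := test_sqint tphi; have sdphi := test_sqint (test_partial i tphi).
transitivity (\int[mu]_x (u x * partial i phi x + c * (v x * partial i phi x))).
  by apply: eq_Rintegral => x _; ring.
rewrite RintD ?RintZ ?wu ?wv//; [|exact: sqint_mul|exact: sqint_mul|
  exact/RintegrableZ/sqint_mul].
transitivity (- \int[mu]_x (gu x * phi x + c * (gv x * phi x))); last first.
  by congr (- _); apply: eq_Rintegral => x _; ring.
rewrite RintD ?RintZ; [|exact: sqint_mul|exact: sqint_mul|
  exact/RintegrableZ/sqint_mul]; ring.
Qed.

Lemma H1_lin u v (c : R) : H1 u -> H1 v -> H1 (fun x => u x + c * v x).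
Proof.
move=> hu hv.
apply: (@H1_intro _ (fun i x => weak_partial i u x + c * weak_partial i v x)).
- by apply: sqintD; [exact: H1_sqint|exact/sqintZ/H1_sqint].
- by move=> i; apply: sqintD; [exact: weak_partial_sqint|
    exact/sqintZ/weak_partial_sqint].
- move=> i; have [su wu] := weak_partialP i hu; have [sv wv] := weak_partialP i hv.
  by apply: is_weak_partial_lin => //; exact: H1_sqint.
Qed.

Lemma weak_partial_lin i u v (c : R) : H1 u -> H1 v ->
  {ae mu, forall x, weak_partial i (fun y => u y + c * v y) x =
    weak_partial i u x + c * weak_partial i v x}.
Proof.
move=> hu hv; have [su wu] := weak_partialP i hu.
have [sv wv] := weak_partialP i hv.
apply: weak_partial_ae; first exact: H1_lin.
  by apply: sqintD => //; exact: sqintZ.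
by apply: is_weak_partial_lin => //; exact: H1_sqint.
Qed.

Lemma H1_0 : H1 ((fun=> 0) : E -> R).
Proof.
apply: (@H1_intro _ (fun _ _ => 0)); [exact: sqint0|by move=> _; exact: sqint0|].
move=> i phi _; rewrite (_ : (fun x => 0 * partial i phi x) = (fun=> 0)).
  rewrite Rint_cst0 (_ : (fun x => 0 * phi x) = (fun=> 0)) ?Rint_cst0 ?oppr0//.
  by apply/funext => x; rewrite mul0r.
by apply/funext => x; rewrite mul0r.
Qed.

Lemma H1D u v : H1 u -> H1 v -> H1 (fun x => u x + v x).
Proof.
move=> hu hv; rewrite (_ : (fun x => _) = (fun x => u x + 1 * v x)).
  exact: H1_lin.
by apply/funext => x; rewrite mul1r.
Qed.

Lemma H1B u v : H1 u -> H1 v -> H1 (fun x => u x - v x).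
Proof.
move=> hu hv; rewrite (_ : (fun x => _) = (fun x => u x + (-1) * v x)).
  exact: H1_lin.
by apply/funext => x; rewrite mulN1r.
Qed.

Lemma H1Z u (c : R) : H1 u -> H1 (fun x => c * u x).
Proof.
move=> hu; rewrite (_ : (fun x => _) = (fun x => 0 + c * u x)).
  exact: H1_lin H1_0 hu.
by apply/funext => x; rewrite add0r.
Qed.

Lemma test_H1 phi : test_function phi -> H1 phi.
Proof.
move=> tphi; apply: (@H1_intro _ (fun i => partial i phi)).
- exact: test_sqint.
- by move=> i; exact/test_sqint/test_partial.
- by move=> i; exact: test_weak_partial.
Qed.

Lemma sqint_affine u (t : R) (z : E) : 0 < t -> sqint mu u ->
  sqint mu (fun x => u (t *: x + z)).
Proof.
move=> t0 [mu' u2]; split.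
  by apply: (measurableT_comp mu'); exact: measurable_rV_affine.
exact: (Rintegrable_rV_affine z t0 u2).
Qed.

Lemma is_weak_partial_affine i u g (t : R) (z : E) : 0 < t ->
  sqint mu u -> sqint mu g -> is_weak_partial i u g ->
  is_weak_partial i (fun x => u (t *: x + z)) (fun x => t * g (t *: x + z)).
Proof.
move=> t0 su sg wu phi tphi.
(* The test function transported by the inverse affine map; the chain rule supplies the factor
   [t]. *)
pose psi x := phi (t^-1 *: x + - (t^-1 *: z)).
have ti0 : 0 < t^-1 by rewrite invr_gt0.
have tpsi : test_function psi by exact: test_affine.
have psiE x : psi (t *: x + z) = phi x.
  by rewrite /psi scalerDr scalerA mulVf ?gt_eqF// scale1r addrK.
have dpsiE x : partial i phi x = t * partial i psi (t *: x + z).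
  rewrite -partial_affine//; congr (partial i _ x).
  by apply/funext => y; rewrite psiE.
have spsi := test_sqint tpsi; have sdpsi := test_sqint (test_partial i tpsi).
have tn : t ^+ n != 0 by rewrite expf_neq0 ?gt_eqF.
apply: (mulfI tn).
transitivity (t * \int[mu]_x (u x * partial i psi x)).
  rewrite (@Rint_rV_affine _ _ t z _ t0 (sqint_mul su sdpsi)) mulrCA; congr (_ * _).
  rewrite -RintZ; last exact: (Rintegrable_rV_affine z t0 (sqint_mul su sdpsi)).
  by apply: eq_Rintegral => x _; rewrite dpsiE mulrCA.
rewrite wu// (@Rint_rV_affine _ _ t z _ t0 (sqint_mul sg spsi)) mulrN mulrCA.
rewrite mulrN; congr (- (_ * _)).
rewrite -RintZ; last exact: (Rintegrable_rV_affine z t0 (sqint_mul sg spsi)).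
by apply: eq_Rintegral => x _; rewrite psiE mulrA.
Qed.

Lemma H1_affine u (t : R) (z : E) : 0 < t -> H1 u -> H1 (fun x => u (t *: x + z)).
Proof.
move=> t0 hu.
apply: (@H1_intro _ (fun i x => t * weak_partial i u (t *: x + z))).
- exact/sqint_affine/H1_sqint.
- by move=> i; apply/sqintZ/sqint_affine/weak_partial_sqint.
- move=> i; have [s w] := weak_partialP i hu.
  by apply: is_weak_partial_affine => //; exact: H1_sqint.
Qed.

Lemma H1_shift u (z : E) : H1 u -> H1 (fun x => u (x + z)).
Proof.
move=> /(H1_affine z ltr01); rewrite (_ : (fun x => u (1 *: x + z)) =
  (fun x => u (x + z)))//; by apply/funext => x; rewrite scale1r.
Qed.

Lemma grad_sqr_int u : H1 u -> Rintegrable mu (grad_sqr u).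
Proof.
by move=> hu; apply: Rintegrable_sum => i; have [] := weak_partial_sqint i hu.
Qed.

Lemma dirichletE u : H1 u -> \int[mu]_x grad_sqr u x = dirichlet u u.
Proof.
move=> hu; rewrite /grad_sqr Rint_sum; last first.
  by move=> i; have [] := weak_partial_sqint i hu.
rewrite dirichlet.unlock.
by apply: eq_bigr => i _; apply: eq_Rintegral => x _; rewrite expr2.
Qed.

Lemma dirichlet_sqr u : dirichlet u u = \sum_i \int[mu]_x weak_partial i u x ^+ 2.
Proof. by rewrite dirichlet.unlock; apply: eq_bigr => i _; apply: eq_Rintegral => x _; rewrite expr2. Qed.

Lemma dirichlet_ge0 u : 0 <= dirichlet u u.
Proof.
rewrite dirichlet_sqr; apply: sumr_ge0 => i _.
by apply: Rint_ge0 => x; exact: sqr_ge0.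
Qed.

Lemma weak_partial_le_dirichlet i u :
  \int[mu]_x weak_partial i u x ^+ 2 <= dirichlet u u.
Proof.
rewrite dirichlet_sqr (bigD1 i)//= lerDl; apply: sumr_ge0 => j _.
by apply: Rint_ge0 => x; exact: sqr_ge0.
Qed.

Lemma dirichletC u v : dirichlet u v = dirichlet v u.
Proof.
rewrite dirichlet.unlock.
by apply: eq_bigr => i _; apply: eq_Rintegral => x _; rewrite mulrC.
Qed.

Lemma dirichlet_linl u v w (c : R) : H1 u -> H1 v -> H1 w ->
  dirichlet (fun x => u x + c * v x) w = dirichlet u w + c * dirichlet v w.
Proof.
move=> hu hv hw; rewrite dirichlet.unlock mulr_sumr -big_split/=; apply: eq_bigr => i _.
have su := weak_partial_sqint i hu; have sv := weak_partial_sqint i hv.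
have sw := weak_partial_sqint i hw.
have suv := weak_partial_sqint i (H1_lin c hu hv).
rewrite -RintZ; last exact: sqint_mul.
rewrite -RintD; [|exact: sqint_mul|exact/RintegrableZ/sqint_mul].
apply: Rint_ae_eq.
- exact: Rintegrable_meas (sqint_mul suv sw).
- exact: Rintegrable_meas (RintegrableD (sqint_mul su sw)
    (RintegrableZ c (sqint_mul sv sw))).
- by apply: filterS (weak_partial_lin i c hu hv) => x ->; ring.
Qed.

Lemma dirichlet_affine u (t : R) (z : E) : 0 < t -> H1 u ->
  t ^+ n * dirichlet (fun x => u (t *: x + z)) (fun x => u (t *: x + z)) =
  t ^+ 2 * dirichlet u u.
Proof.
move=> t0 hu; rewrite !dirichlet_sqr !mulr_sumr; apply: eq_bigr => i _.
have [s w] := weak_partialP i hu; have hu' := H1_affine z t0 hu.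
have s' := sqintZ t (sqint_affine z t0 s).
rewrite [X in t ^+ 2 * X](@Rint_rV_affine _ _ t z _ t0 (sqint_int s)) mulrCA.
congr (_ * _); rewrite -RintZ; last exact: (Rintegrable_rV_affine z t0 (sqint_int s)).
apply: Rint_ae_eq.
- exact: Rintegrable_meas (sqint_int (weak_partial_sqint i hu')).
- apply: measurable_funM => //.
  exact: Rintegrable_meas (sqint_int (sqint_affine z t0 s)).
- have := weak_partial_ae hu' s' (is_weak_partial_affine z t0 (H1_sqint hu) s w).
  by apply: filterS => x ->; rewrite exprMn.
Qed.

(** Used to identify limits: a weak limit of gradients is a weak gradient, but not the
    representative chosen by [weak_partial]. *)
Lemma dirichlet_eq_ae u v (g : 'I_n -> E -> R) : H1 u -> H1 v ->
  (forall i, sqint mu (g i)) -> (forall i, is_weak_partial i u (g i)) ->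
  dirichlet u v = \sum_i \int[mu]_x (g i x * weak_partial i v x).
Proof.
move=> hu hv sg wg; rewrite dirichlet.unlock.
apply: eq_bigr => i _; have sv := weak_partial_sqint i hv.
apply: Rint_ae_eq.
- exact: Rintegrable_meas (sqint_mul (weak_partial_sqint i hu) sv).
- exact: Rintegrable_meas (sqint_mul (sg i) sv).
- by apply: filterS (weak_partial_ae hu (sg i) (wg i)) => x ->.
Qed.

Lemma dirichlet_lin2 u v (c : R) : H1 u -> H1 v ->
  dirichlet (fun x => u x + c * v x) (fun x => u x + c * v x) =
  dirichlet u u + 2 * c * dirichlet u v + c ^+ 2 * dirichlet v v.
Proof.
move=> hu hv; have hw := H1_lin c hu hv.
have e w : H1 w -> dirichlet w (fun x => u x + c * v x) =
    dirichlet u w + c * dirichlet v w.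
  by move=> h; rewrite dirichletC dirichlet_linl.
by rewrite dirichlet_linl// e// e// (dirichletC v u); ring.
Qed.

Lemma dirichlet_sqrB u v : H1 u -> H1 v ->
  dirichlet (fun x => u x - v x) (fun x => u x - v x) =
  dirichlet u u - 2 * dirichlet u v + dirichlet v v.
Proof.
move=> hu hv; rewrite (_ : (fun x => _) = (fun x => u x + (-1) * v x)).
  by rewrite dirichlet_lin2//; ring.
by apply/funext => x; rewrite mulN1r.
Qed.

Lemma dirichlet_shift u (z : E) : H1 u ->
  dirichlet (fun x => u (x + z)) (fun x => u (x + z)) = dirichlet u u.
Proof.
move=> hu; have := dirichlet_affine z ltr01 hu.
rewrite (_ : (fun x => u (1 *: x + z)) = (fun x => u (x + z))); last first.
  by apply/funext => x; rewrite scale1r.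
by rewrite expr1n mul1r => ->; rewrite expr1n mul1r.
Qed.

End sobolev_H1.

(** * Mollification *)

Section real_fubini.
Context d1 d2 (T1 : measurableType d1) (T2 : measurableType d2) (R : realType).
Variable m1 : {sigma_finite_measure set T1 -> \bar R}.
Variable m2 : {sigma_finite_measure set T2 -> \bar R}.
Variable f : T1 -> T2 -> R.
Hypothesis mf : measurable_fun setT (fun p : T1 * T2 => f p.1 p.2).

Let F (p : T1 * T2) : \bar R := (f p.1 p.2)%:E.

Let mF : measurable_fun setT F.
Proof. exact/measurable_EFinP. Qed.

Lemma measurable_param2 y : measurable_fun setT (f ^~ y).
Proof. exact: (measurableT_comp mf (measurable_pair2 y)). Qed.

Lemma measurable_Rint_param : measurable_fun setT (fun x => \int[m2]_y f x y).
Proof.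
rewrite /Rintegral; apply: measurableT_comp => //.
rewrite (_ : (fun x => _) = (fun x =>
  fubini_F m2 F^\+ x - fubini_F m2 F^\- x)%E); last first.
  apply/funext => x; rewrite [LHS]integralE; congr (_ - _)%E.
    by apply: eq_integral => y _; rewrite !funeposE.
  by apply: eq_integral => y _; rewrite !funenegE.
by apply: emeasurable_funB; apply: measurable_fun_fubini_tonelli_F => //;
  [exact: measurable_funepos|exact: measurable_funeneg].
Qed.

Lemma Rintegrable_prod (b : T1 -> R) : (forall x, Rintegrable m2 (f x)) ->
  Rintegrable m1 b -> (forall x, \int[m2]_y `|f x y| <= b x) ->
  (m1 \x m2)%E.-integrable setT F.
Proof.
move=> fi bi fb; apply/integrable12ltyP => //.
have := integrable_lty measurableT bi; apply: le_lt_trans.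
apply: ge0_le_integral => //.
- by move=> x _; apply: integral_ge0.
- apply: (measurable_fun_fubini_tonelli_F (abse \o F)) => //=.
  exact: measurableT_comp.
- exact/measurable_EFinP/(Rintegrable_meas bi).
- move=> x _; rewrite (_ : (\int[m2]_y _)%E = (\int[m2]_y `|f x y|)%:E) ?lee_fin//.
  by rewrite -EFin_Rintegral//; exact: Rintegrable_abs.
Qed.

(** On a section that is not integrable the real integral may be a default value; sections are
    integrable almost everywhere, so real and extended iterated integrals agree almost
    everywhere. *)
Lemma Rint_fubini : (m1 \x m2)%E.-integrable setT F ->
  [/\ {ae m1, forall x, Rintegrable m2 (f x)},
      {ae m2, forall y, Rintegrable m1 (f ^~ y)},
      Rintegrable m1 (fun x => \int[m2]_y f x y),
      Rintegrable m2 (fun y => \int[m1]_x f x y) &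
      \int[m1]_x (\int[m2]_y f x y) = \int[m2]_y (\int[m1]_x f x y)].
Proof.
move=> iF.
have ae1 : {ae m1, forall x, Rintegrable m2 (f x)} by exact: ae_integrable1 iF.
have ae2 : {ae m2, forall y, Rintegrable m1 (f ^~ y)} by exact: ae_integrable2 iF.
have i1 := integrable_fubini_F iF; have m1F := measurable_fubini_F iF.
have m2G := measurable_fubini_G iF.
have i2 : m2.-integrable setT (fubini_G m1 F).
  apply/integrableP; split => //.
  have := (integrable21ltyP m1 m2 mF).1 iF; apply: le_lt_trans.
  apply: ge0_le_integral => //.
  - exact: measurableT_comp.
  - apply: (measurable_fun_fubini_tonelli_G (abse \o F)) => //=.
    exact: measurableT_comp.
  - by move=> y _; apply: le_abse_integral => //; exact/measurable_EFinP/measurable_param2.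
have e1 : ae_eq m1 setT (EFin \o (fun x => \int[m2]_y f x y)) (fubini_F m2 F).
  by apply: filterS ae1 => x h _ /=; rewrite -EFin_Rintegral.
have e2 : ae_eq m2 setT (EFin \o (fun y => \int[m1]_x f x y)) (fubini_G m1 F).
  by apply: filterS ae2 => y h _ /=; rewrite -EFin_Rintegral.
have mm1 : measurable_fun setT (fun x => \int[m2]_y f x y).
  exact: measurable_Rint_param.
have mm2 : measurable_fun setT (fun y => \int[m1]_x f x y).
  by rewrite /Rintegral; exact: measurableT_comp.
split=> //.
- apply/integrableP; split; first exact/measurable_EFinP.
  have /integrableP[_] := i1; apply: le_lt_trans.
  rewrite le_eqVlt; apply/orP; left; apply/eqP.
  apply: ae_eq_integral => //; [exact/measurableT_comp/measurable_EFinP|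
    exact: measurableT_comp|].
  by apply: filterS e1 => x /(_ I) h _; congr abse; exact: h.
- apply/integrableP; split; first exact/measurable_EFinP.
  have /integrableP[_] := i2; apply: le_lt_trans.
  rewrite le_eqVlt; apply/orP; left; apply/eqP.
  apply: ae_eq_integral => //; [exact/measurableT_comp/measurable_EFinP|
    exact: measurableT_comp|].
  by apply: filterS e2 => x /(_ I) h _; congr abse; exact: h.
- rewrite {1}/Rintegral [RHS]/Rintegral; congr fine.
  transitivity (\int[m1]_x fubini_F m2 F x)%E.
    by apply: ae_eq_integral => //; exact/measurable_EFinP.
  transitivity (\int[m2]_y fubini_G m1 F y)%E; first exact: (Fubini iF).
  by apply: ae_eq_integral => //; [exact/measurable_EFinP|exact: ae_eq_sym].
Qed.

End real_fubini.

Lemma lipschitz_sqr_continuous (R : realType) (V : normedModType R) (f : V -> R)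
    (K : R) : 0 <= K ->
  (forall x y, (f x - f y) ^+ 2 <= K * `|x - y| ^+ 2) -> continuous f.
Proof.
move=> K0 hf x; apply/cvgrPdist_lt => e e0.
have e1 : 0 < e / (K + 1) by rewrite divr_gt0// ltr_wpDl.
near=> y; have hxy : `|x - y| < e / (K + 1).
  by near: y; apply: (@cvgr_dist_lt _ _ _ _ _ id x); [exact: cvg_id|].
have hxy1 : `|x - y| < e.
  by near: y; apply: (@cvgr_dist_lt _ _ _ _ _ id x); [exact: cvg_id|].
rewrite -(@ltr_pXn2r _ 2)// ?nnegrE ?ltW// real_normK ?num_real//.
apply: (le_lt_trans (hf x y)); rewrite expr2 mulrA expr2.
apply: ltr_pM => //; first by rewrite mulr_ge0.
rewrite (@le_lt_trans _ _ ((K + 1) * `|x - y|))//.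
  by rewrite ler_wpM2r// lerDl.
by rewrite -ltr_pdivlMl ?ltr_wpDl// mulrC.
Unshelve. all: by end_near. Qed.

(** * Translation estimates and convolution with test functions *)

Section differences.
Context {R : realType} {n : nat}.
Local Notation E := 'rV[R]_n.
Local Notation mu := (lebesgue_rV n).
Implicit Types (u v w g phi rho : E -> R) (i : 'I_n).

(** Convolution with the reflected kernel: the value at [x] is the pairing of [u] with the test
    function [rho (_ - x)], so that weak derivatives and weak convergence apply to it directly. *)
Definition moll u rho : E -> R := fun x => \int[mu]_y (u y * rho (y - x)).

Lemma basis_vec_norm i : `|basis_vec i : E| <= 1.
Proof.
apply/rV_norm_leP => // j; rewrite !mxE eqxx/=.
by case: eqP; rewrite ?normr1 ?normr0.
Qed.

Lemma sqint_shift u (z : E) : sqint mu u -> sqint mu (fun x => u (x + z)).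
Proof.
move=> /(sqint_affine z ltr01); rewrite (_ : (fun x => u (1 *: x + z)) =
  (fun x => u (x + z)))//; by apply/funext => x; rewrite scale1r.
Qed.

Lemma moll_integrable u rho (x : E) : sqint mu u -> test_function rho ->
  Rintegrable mu (fun y => u y * rho (y - x)).
Proof. by move=> su trho; apply: sqint_mul => //; exact/sqint_shift/test_sqint. Qed.

Lemma mollE u rho (x : E) : sqint mu u -> test_function rho ->
  moll u rho x = \int[mu]_y (u (y + x) * rho y).
Proof.
move=> su trho; rewrite /moll -(Rint_rV_shift x); last exact: moll_integrable.
by apply: eq_Rintegral => y _; rewrite addrK.
Qed.

Lemma moll_lip u rho i (x : E) : sqint mu u -> test_function rho ->
  exists2 K : R, 0 <= K & forall h : R, `|h| <= 1 ->
    `|moll u rho (x + h *: basis_vec i) - moll u rho x| <= K * `|h|.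
Proof.
move=> su trho; have [M M0 hM] := test_support trho.
have tdr := test_partial i trho.
have [C C0 hC] : exists2 C : R, 0 <= C & forall y, `|partial i rho y| <= C.
  have [M' _ hM'] := test_support tdr.
  exact: continuous_support_bounded (test_continuous tdr) hM'.
(* Contains the supports of both translates of [rho] when [|h| <= 1]. *)
pose Q := rV_box (x + const_mx (- (M + 1))) (x + const_mx (M + 1)).
have iQ : Rintegrable mu (fun y => `|u y * \1_Q y|).
  apply: Rintegrable_abs; apply: sqint_mul => //; split.
    by apply/measurable_indicP; exact: measurable_rV_box.
  apply: eq_Rintegrable (Rintegrable_box (x + const_mx (- (M + 1)))
    (x + const_mx (M + 1))) => y.
  by rewrite indicE; case: (y \in _); rewrite ?expr1n ?expr0n.
exists (C * \int[mu]_y `|u y * \1_Q y|).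
  by rewrite mulr_ge0//; apply: Rint_ge0.
move=> h h1; rewrite /moll -RintB; [|exact: moll_integrable..].
apply: (le_trans (Rint_norm _)).
  by apply: RintegrableB; exact: moll_integrable.
rewrite mulrAC -RintZ//; apply: Rint_le.
- by apply: Rintegrable_abs; apply: RintegrableB; exact: moll_integrable.
- exact: RintegrableZ.
move=> y; rewrite -mulrBr !normrM.
have e : y - (x + h *: basis_vec i) = (y - x) + (- h) *: basis_vec i.
  by rewrite opprD addrA scaleNr.
have [Qy|nQy] := pselect (Q y).
  rewrite indicE mem_set// normr1 mulr1 mulrC ler_wpM2r// e.
  have := @mvt_line R n rho i (y - x) (- h) C; rewrite normrN; apply => //.
  by move=> z; exact: test_derivable.
rewrite indicE memNset// normr0 !mulr0.
have nb : ~ (`|y - x| <= M + 1).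
  move=> h2; apply: nQy => j; have := le_trans (rV_norm_coord (y - x) j) h2.
  rewrite !mxE ler_norml => /andP[h3 h4].
  by rewrite -lerBrDl h3 -lerBlDl h4.
suff [-> ->] : rho (y - (x + h *: basis_vec i)) = 0 /\ rho (y - x) = 0.
  by rewrite subrr normr0 mulr0.
split; apply/eqP; apply: contraT => /hM hs; exfalso; apply: nb; last first.
  by rewrite (le_trans hs)// lerDl.
have -> : y - x = (y - (x + h *: basis_vec i)) + h *: basis_vec i.
  by rewrite opprD addrA subrK.
rewrite (le_trans (ler_normD _ _))// lerD// normrZ mulr_ile1//.
exact: basis_vec_norm.
Qed.

(** The derivative is moved to [rho]; the mean value theorem, applied to [rho] and then to
    [partial i rho], bounds the error of the difference quotient by a multiple of [|h|]. *)
Lemma moll_is_derive u g rho i (x : E) : sqint mu u -> sqint mu g ->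
  is_weak_partial i u g -> test_function rho ->
  is_derive x (basis_vec i) (moll u rho) (moll g rho x).
Proof.
move=> su sg wu trho.
have tdr := test_partial i trho.
have gE y : moll g rho y = - moll u (partial i rho) y.
  rewrite /moll; have trho' := test_shift (- y) trho.
  have := wu _ trho'.
  under eq_Rintegral do rewrite partial_shift//.
  by move=> ->; rewrite opprK.
have [M M0 hM] := test_support trho.
have [C C0 hC] : exists2 C : R, 0 <= C & forall y, `|partial i (partial i rho) y| <= C.
  have tddr := test_partial i tdr; have [M' _ hM'] := test_support tddr.
  exact: continuous_support_bounded (test_continuous tddr) hM'.
pose Q := rV_box (x + const_mx (- (M + 1))) (x + const_mx (M + 1)).
have iQ : Rintegrable mu (fun y => `|u y * \1_Q y|).
  apply: Rintegrable_abs; apply: sqint_mul => //; split.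
    by apply/measurable_indicP; exact: measurable_rV_box.
  apply: eq_Rintegrable (Rintegrable_box (x + const_mx (- (M + 1)))
    (x + const_mx (M + 1))) => y.
  by rewrite indicE; case: (y \in _); rewrite ?expr1n ?expr0n.
pose K := C * \int[mu]_y `|u y * \1_Q y|.
have K0 : 0 <= K by rewrite mulr_ge0//; apply: Rint_ge0.
have key h : `|h| <= 1 ->
    `|moll u rho (h *: basis_vec i + x) - moll u rho x - h * moll g rho x|
      <= K * h ^+ 2.
  move=> h1; rewrite gE mulrN opprK addrC addrC /moll -RintB; [|exact: moll_integrable..].
  rewrite -RintZ; last exact: moll_integrable.
  have i1 : Rintegrable mu (fun y => u y * rho (y - (h *: basis_vec i + x)) -
      u y * rho (y - x)) by apply: RintegrableB; exact: moll_integrable.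
  have i2 : Rintegrable mu (fun y => h * (u y * partial i rho (y - x))).
    by apply: RintegrableZ; exact: moll_integrable.
  rewrite -RintD//; apply: (le_trans (Rint_norm _)); first exact: RintegrableD.
  rewrite /K mulrAC -RintZ//; apply: Rint_le.
  - by apply: Rintegrable_abs; exact: RintegrableD.
  - exact: RintegrableZ.
  move=> y; set z := y - x.
  have -> : y - (h *: basis_vec i + x) = z + (- h) *: basis_vec i.
    by rewrite /z opprD scaleNr addrCA addrC.
  have -> : u y * rho (z + - h *: basis_vec i) - u y * rho z +
      h * (u y * partial i rho z) =
      u y * (rho (z + - h *: basis_vec i) - rho z + h * partial i rho z) by ring.
  rewrite !normrM.
  have dr a : derivable rho a (basis_vec i) by exact: test_derivable.
  have ddr a : derivable (partial i rho) a (basis_vec i) by exact: test_derivable.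
  have [Qy|nQy] := pselect (Q y).
    rewrite indicE mem_set// normr1 mulr1 mulrC ler_wpM2r//.
    have [h0|hn0] := eqVneq h 0.
      by rewrite h0 oppr0 scale0r addr0 subrr mul0r add0r normr0 expr0n/= mulr0.
    have dl s := @is_derive_line R n rho z (basis_vec i) s (dr _).
    have cl a b : {within `[a, b], continuous (fun r => rho (z + r *: basis_vec i))}.
      by apply: derivable_within_continuous => s _; have [] := dl s.
    have [c hc ->] : exists2 c, `|c| <= `|h| &
        rho (z + - h *: basis_vec i) - rho z =
        partial i rho (z + c *: basis_vec i) * - h.
      have [hp|hp|hz] := ltgtP h 0; last by rewrite hz eqxx in hn0.
        have hp' : 0 < - h by rewrite oppr_gt0.
        have [c] := @MVT R _ (fun r => partial i rho (z + r *: basis_vec i)) 0 (- h)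
          hp' (fun s _ => dl s) (cl _ _).
        rewrite in_itv/= => /andP[c1 c2]; rewrite scale0r addr0 subr0 => ->.
        by exists c => //; rewrite gtr0_norm// (ltr0_norm hp) ltW.
      have hp' : - h < 0 by rewrite oppr_lt0.
      have [c] := @MVT R _ (fun r => partial i rho (z + r *: basis_vec i)) (- h) 0
        hp' (fun s _ => dl s) (cl _ _).
      rewrite in_itv/= => /andP[c1 c2]; rewrite scale0r addr0 sub0r opprK => e.
      exists c; first by rewrite ltr0_norm// gtr0_norm// lerNl ltW.
      by rewrite mulrN -e opprB.
    have -> : partial i rho (z + c *: basis_vec i) * - h + h * partial i rho z =
      - (h * (partial i rho (z + c *: basis_vec i) - partial i rho z)) by ring.
    rewrite normrN normrM -(real_normK (num_real h)) expr2 mulrCA ler_wpM2l//.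
    apply: (le_trans (@mvt_line R n (partial i rho) i z c C ddr hC)).
    by rewrite ler_wpM2l.
  rewrite indicE memNset// normr0 !mulr0.
  have nb : ~ (`|z| <= M + 1).
    move=> h2; apply: nQy => j; have := le_trans (rV_norm_coord z j) h2.
    rewrite !mxE ler_norml => /andP[h3 h4].
    by rewrite -lerBrDl h3 -lerBlDl h4.
  have r1 : rho (z + - h *: basis_vec i) = 0.
    apply/eqP; apply: contraT => /hM hs; exfalso; apply: nb.
    have -> : z = (z + - h *: basis_vec i) + h *: basis_vec i.
      by rewrite scaleNr subrK.
    rewrite (le_trans (ler_normD _ _))// lerD// normrZ mulr_ile1//.
    exact: basis_vec_norm.
  have r2 : rho z = 0.
    apply/eqP; apply: contraT => /hM hs; exfalso; apply: nb.
    by rewrite (le_trans hs)// lerDl.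
  have r3 : partial i rho z = 0.
    apply/eqP; apply: contraT => /(derive_support hM) hs; exfalso; apply: nb.
    by rewrite (le_trans hs)// lerDl.
  by rewrite r1 r2 r3 subrr mulr0 addr0 normr0 mulr0.
apply/is_deriveP; apply/cvgrPdist_lt => e e0.
near=> h.
have h0 : h != 0 by near: h; exact: nbhs_dnbhs_neq.
have h1 : `|h| <= 1 by near: h; exact: dnbhs0_le.
have h2 : `|h| < e / (K + 1).
  by near: h; apply: dnbhs0_lt; rewrite divr_gt0// ltr_wpDl.
rewrite distrC.
have -> : h^-1 *: (moll u rho (h *: basis_vec i + x) - moll u rho x) -
  moll g rho x = h^-1 * (moll u rho (h *: basis_vec i + x) - moll u rho x -
  h * moll g rho x) by rewrite mulrBr mulKf.
rewrite normrM normfV ltr_pdivrMl ?normr_gt0// (le_lt_trans (key _ h1))//.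
rewrite -(real_normK (num_real h)) expr2 mulrCA ltr_pM2l ?normr_gt0//.
rewrite (@le_lt_trans _ _ ((K + 1) * `|h|))//.
  by rewrite ler_wpM2r// lerDl.
by rewrite -ltr_pdivlMl ?ltr_wpDl// mulrC.
Unshelve. all: by end_near. Qed.

Lemma moll_line_continuous u rho i (x : E) : sqint mu u -> test_function rho ->
  continuous (fun s : R => moll u rho (x + s *: basis_vec i)).
Proof.
move=> su trho s; have [K K0 hK] := moll_lip i (x + s *: basis_vec i) su trho.
apply/cvgrPdist_lt => e e0.
have e1 : 0 < e / (K + 1) by rewrite divr_gt0// ltr_wpDl.
near=> r; have h1 : `|r - s| <= 1.
  by near: r; apply: filterS (@nbhsx_ballx _ _ s 1 ltr01) => r;
    rewrite /ball/= distrC => /ltW.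
have h2 : `|r - s| < e / (K + 1).
  by near: r; apply: filterS (@nbhsx_ballx _ _ s _ e1) => r; rewrite /ball/= distrC.
have := hK (r - s) h1.
rewrite -addrA -scalerDl subrKC distrC => h3; rewrite (le_lt_trans h3)//.
rewrite (@le_lt_trans _ _ ((K + 1) * `|r - s|))//.
  by rewrite ler_wpM2r// lerDl.
by rewrite -ltr_pdivlMl ?ltr_wpDl// mulrC.
Unshelve. all: by end_near. Qed.

Lemma moll_ftc u g rho i (x : E) (h : R) : sqint mu u -> sqint mu g ->
  is_weak_partial i u g -> test_function rho -> 0 < h ->
  moll u rho (x + h *: basis_vec i) - moll u rho x =
  \int[lebesgue_measure]_(s in `[0, h]) moll g rho (x + s *: basis_vec i).
Proof.
move=> su sg wu trho h0.
have dl (s : R) : is_derive s 1 (fun r : R => moll u rho (x + r *: basis_vec i))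
    (moll g rho (x + s *: basis_vec i)).
  have [d1 d2] := moll_is_derive (x + s *: basis_vec i) su sg wu trho.
  by apply: (is_derive_val (is_derive_line d1)); rewrite d2.
have cu := @moll_line_continuous _ _ i x su trho.
have := @continuous_FTC2 R (fun s => moll g rho (x + s *: basis_vec i))
  (fun s => moll u rho (x + s *: basis_vec i)) 0 h h0.
rewrite /Rintegral => ->.
- by rewrite /= scale0r addr0.
- by apply: continuous_subspaceT; exact: moll_line_continuous.
- split=> [s _||]; first by have [] := dl s.
  + by apply: cvg_at_right_filter; exact: cu.
  + by apply: cvg_at_left_filter; exact: cu.
- by move=> s _; rewrite derive1E; have [] := dl s.
Qed.

Local Notation lam := (@lebesgue_measure R).

(** When [g] is the weak derivative of [u] along a basis vector [e], [w] turns out to be the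
    increment [u (_ + h e) - u]. The bound is Cauchy-Schwarz on [[0, h]] followed by Fubini. *)
Lemma line_average g (e : E) (h : R) : sqint mu g -> 0 < h ->
  let w y := \int[lam]_(s in `[0, h]) g (y + s *: e) in
  [/\ sqint mu w, \int[mu]_y w y ^+ 2 <= h ^+ 2 * \int[mu]_y g y ^+ 2 &
    forall phi, sqint mu phi -> \int[mu]_y (w y * phi y) =
      \int[lam]_(s in `[0, h]) (\int[mu]_y (g (y + s *: e) * phi y))].
Proof.
move=> sg h0 w; have [mg g2] := sg; set A := \int[mu]_y g y ^+ 2.
have A0 : 0 <= A by apply: Rint_ge0 => x; exact: sqr_ge0.
(* Integrals over [[0, h]] become integrals over the line with this weight, to which the product
   measure applies. *)
pose J : R -> R := \1_`[0, h].
have mJ : measurable_fun setT J by exact/measurable_indicP.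
have J01 s : J s = 0 \/ J s = 1.
  by rewrite /J indicE; case: (s \in _); [right|left].
have J0 s : 0 <= J s by case: (J01 s) => ->.
have J2 s : J s ^+ 2 = J s by case: (J01 s) => ->; rewrite ?expr0n ?expr1n.
have [iJ IJ] : Rintegrable lam J /\ \int[lam]_s J s = h.
  have [|iJ] := @Rintegrable_indic _ _ _ lam `[0, h]%classic (measurable_itv _).
    by rewrite /= lebesgue_measure_itv/= lte_fin h0 -EFinB ltry.
  by rewrite /= lebesgue_measure_itv/= lte_fin h0 -EFinB subr0.
have onJ (f : R -> R) : \int[lam]_(s in `[0, h]) f s = \int[lam]_s (J s * f s).
  rewrite Rintegral_mkcond; apply: eq_Rintegral => s _; rewrite patchE /J indicE.
  by case: ifPn => _; rewrite ?mul1r ?mul0r.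
have wE y : w y = \int[lam]_s (J s * g (y + s *: e)) by exact: onJ.
have mline (f : E -> R) : measurable_fun setT f -> measurable_fun setT
    (fun p : measurableTypeR R * E => J p.1 * f (p.2 + p.1 *: e)).
  move=> mf; apply: measurable_funM.
    exact: (measurableT_comp mJ (@measurable_fst _ _ (measurableTypeR R) E)).
  apply: (measurable_fun_rV_comp mf) => j /=.
  under eq_fun do rewrite !mxE.
  apply: measurable_funD.
    exact: (measurableT_comp (measurable_rV_coord j)
      (@measurable_snd _ _ (measurableTypeR R) E)).
  by apply: measurable_funM.
have mw : measurable_fun setT w.
  rewrite (_ : w = fun y => \int[lam]_s (J s * g (y + s *: e))); last exact/funext.
  apply: (@measurable_Rint_param _ _ E (measurableTypeR R) R lam
    (fun y s => J s * g (y + s *: e))).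
  apply: (measurableT_comp (mline g mg) (_ : measurable_fun setT
    (fun p : E * measurableTypeR R => (p.2, p.1)))).
  by apply/measurable_fun_pairP; split;
    [exact: (@measurable_snd _ _ E (measurableTypeR R))|
     exact: (@measurable_fst _ _ E (measurableTypeR R))].
pose G2 (s : measurableTypeR R) (y : E) := J s * g (y + s *: e) ^+ 2.
have mG2 : measurable_fun setT (fun p : measurableTypeR R * E => G2 p.1 p.2).
  exact: (mline (fun y => g y ^+ 2) (measurable_funX 2 mg)).
have iG2 s : Rintegrable mu (G2 s).
  by apply: RintegrableZ; exact: (Rintegrable_rV_shift (s *: e) g2).
have IG2 s : \int[mu]_y G2 s y = J s * A.
  rewrite /G2 RintZ; last exact: (Rintegrable_rV_shift (s *: e) g2).
  by rewrite (Rint_rV_shift (s *: e) g2).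
have pG2 := @Rintegrable_prod _ _ (measurableTypeR R) E R lam mu G2 mG2
  (fun s => A * J s) iG2 (RintegrableZ A iJ).
have [_ ae2 _ iy2 E2] : [/\ {ae lam, forall s, Rintegrable mu (G2 s)},
      {ae mu, forall y, Rintegrable lam (G2 ^~ y)},
      Rintegrable lam (fun s => \int[mu]_y G2 s y),
      Rintegrable mu (fun y => \int[lam]_s G2 s y) &
      \int[lam]_s (\int[mu]_y G2 s y) = \int[mu]_y (\int[lam]_s G2 s y)].
  apply: (@Rint_fubini _ _ (measurableTypeR R) E R lam mu G2 mG2).
  apply: pG2 => s; rewrite (_ : \int[mu]_y `|G2 s y| = \int[mu]_y G2 s y).
    by rewrite IG2 mulrC.
  by apply: eq_Rintegral => y _; rewrite ger0_norm// mulr_ge0// sqr_ge0.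
have sJ : sqint lam J.
  by split => //; apply: eq_Rintegrable iJ => s; rewrite J2.
have sGy : {ae mu, forall y, sqint lam (fun s => J s * g (y + s *: e))}.
  apply: filterS ae2 => y hy; split.
    exact: (measurableT_comp (mline g mg) (@measurable_pair2 _ _ (measurableTypeR R) E y)).
  by apply: eq_Rintegrable hy => s; rewrite /G2 exprMn J2.
have wle : {ae mu, forall y, `|w y ^+ 2| <= h * \int[lam]_s G2 s y}.
  apply: filterS sGy => y hy; rewrite ger0_norm ?sqr_ge0// wE.
  have := cauchy_schwarz hy sJ.
  under eq_Rintegral do rewrite mulrAC -expr2 J2.
  under [X in _ <= _ * X -> _]eq_Rintegral do rewrite J2.
  under [X in _ <= X * _ -> _]eq_Rintegral do rewrite exprMn J2.
  by rewrite IJ mulrC.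
have iw2 : Rintegrable mu (fun y => w y ^+ 2).
  apply: (Rintegrable_ae_le _ (RintegrableZ h iy2) wle).
  exact: measurable_funX.
split; first by split.
  apply: (@le_trans _ _ (\int[mu]_y (h * \int[lam]_s G2 s y))).
    apply: Rint_ae_le => //; first exact: RintegrableZ.
    by apply: filterS wle => y; exact: le_trans (ler_norm _).
  rewrite RintZ// -E2; under eq_Rintegral do rewrite IG2 mulrC.
  by rewrite RintZ// IJ (_ : h * (A * h) = h ^+ 2 * A)//; ring.
move=> phi sphi; have [mphi phi2] := sphi.
pose G3 (s : measurableTypeR R) (y : E) := J s * g (y + s *: e) * phi y.
have mG3 : measurable_fun setT (fun p : measurableTypeR R * E => G3 p.1 p.2).
  apply: measurable_funM; first exact: mline.
  exact: (measurableT_comp mphi (@measurable_snd _ _ (measurableTypeR R) E)).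
have sgs s : sqint mu (fun y => g (y + s *: e)) by exact: sqint_shift.
have iG3 s : Rintegrable mu (G3 s).
  apply: eq_Rintegrable (RintegrableZ (J s) (sqint_mul (sgs s) sphi)) => y.
  by rewrite /G3 mulrA.
have pG3 : (lam \x mu)%E.-integrable setT
    (fun p : measurableTypeR R * E => (G3 p.1 p.2)%:E).
  apply: (@Rintegrable_prod _ _ (measurableTypeR R) E R lam mu G3 mG3
    (fun s => (A + \int[mu]_y phi y ^+ 2) * J s) iG3 (RintegrableZ _ iJ)) => s.
  have -> : (A + \int[mu]_y phi y ^+ 2) * J s =
      \int[mu]_y (J s * (g (y + s *: e) ^+ 2 + phi y ^+ 2)).
    have i1 := Rintegrable_rV_shift (s *: e) g2.
    by rewrite RintZ ?RintD ?(Rint_rV_shift (s *: e) g2) 1?mulrC//; exact: RintegrableD.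
  apply: Rint_le; first exact: Rintegrable_abs.
    apply: RintegrableZ; apply: RintegrableD => //.
    exact: (Rintegrable_rV_shift (s *: e) g2).
  move=> y; rewrite /G3 -mulrA normrM (ger0_norm (J0 s)) ler_wpM2l//.
  rewrite normrM; set a := g _; set b := phi y.
  rewrite -(real_normK (num_real a)) -(real_normK (num_real b)).
  have := sqr_ge0 (`|a| - `|b|); have := normr_ge0 a; have := normr_ge0 b; nra.
have [_ _ _ _ E3] := @Rint_fubini _ _ (measurableTypeR R) E R lam mu G3 mG3 pG3.
transitivity (\int[mu]_y (\int[lam]_s G3 s y)).
  apply: Rint_ae_eq.
  - exact: measurable_funM.
  - have [_ _ _ + _] := @Rint_fubini _ _ (measurableTypeR R) E R lam mu G3 mG3 pG3.
    exact: Rintegrable_meas.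
  - apply: filterS sGy => y hy; rewrite /G3.
    have ihy : Rintegrable lam (fun s => J s * g (y + s *: e)).
      apply: eq_Rintegrable (sqint_mul hy sJ) => s.
      by rewrite mulrAC -expr2 J2.
    under [RHS]eq_Rintegral do rewrite mulrC.
    by rewrite RintZ// mulrC wE.
rewrite -E3 onJ; apply: eq_Rintegral => s _.
rewrite -RintZ; last exact: sqint_mul.
by apply: eq_Rintegral => y _; rewrite /G3 mulrA.
Qed.

(** Tested with [phi], the increment of [u] is the difference of the values of [moll u phi] at [h e]
    and 0, which the fundamental theorem of calculus expresses by [g]; hence the increment is the
    line integral [w] almost everywhere. *)
Lemma diff_step_pos u g i (h : R) : sqint mu u -> sqint mu g ->
  is_weak_partial i u g -> 0 < h ->
  \int[mu]_x (u (x + h *: basis_vec i) - u x) ^+ 2 <= h ^+ 2 * \int[mu]_x g x ^+ 2.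
Proof.
move=> su sg wu h0.
have [] := line_average (basis_vec i) sg h0.
set w := fun y => _ => sw w2 wphi.
have sD : sqint mu (fun x => u (x + h *: basis_vec i) - u x).
  by apply: sqintB => //; exact: sqint_shift.
have : {ae mu, forall x, (u (x + h *: basis_vec i) - u x) - w x = 0}.
  apply: fundamental_lemma; first exact: sqintB.
  move=> phi tphi; have sphi := test_sqint tphi.
  transitivity (\int[mu]_x ((u (x + h *: basis_vec i) - u x) * phi x - w x * phi x)).
    by apply: eq_Rintegral => x _; rewrite mulrBl.
  rewrite RintB; [|exact: sqint_mul..]; rewrite wphi//.
  have := moll_ftc 0 su sg wu tphi h0; rewrite add0r => E1.
  under [X in _ - X]eq_Rintegral => s _ do
    rewrite -mollE// -[X in moll _ _ X]add0r.
  rewrite -E1 !mollE// -RintB.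
  - apply/eqP; rewrite subr_eq0; apply/eqP; apply: eq_Rintegral => x _.
    by rewrite addr0 mulrBl.
  - by apply: sqint_mul => //; exact: sqint_shift.
  - by apply: sqint_mul => //; exact: sqint_shift.
move=> ae0; apply: le_trans w2; rewrite le_eqVlt; apply/orP; left; apply/eqP.
apply: Rint_ae_eq.
- exact: Rintegrable_meas (sqint_int sD).
- exact: Rintegrable_meas (sqint_int sw).
- by apply: filterS ae0 => x /eqP; rewrite subr_eq0 => /eqP ->.
Qed.

Lemma diff_step u g i (h : R) : sqint mu u -> sqint mu g ->
  is_weak_partial i u g ->
  \int[mu]_x (u (x + h *: basis_vec i) - u x) ^+ 2 <= h ^+ 2 * \int[mu]_x g x ^+ 2.
Proof.
move=> su sg wu; have [h0|h0|->] := ltgtP h 0; last first.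
- rewrite expr0n/= mul0r; under eq_Rintegral do rewrite scale0r addr0 subrr expr0n/=.
  by rewrite Rint_cst0.
- exact: diff_step_pos.
have h1 : 0 < - h by rewrite oppr_gt0.
rewrite -sqrrN; apply: le_trans (diff_step_pos su sg wu h1).
have sD : sqint mu (fun x => u (x + - h *: basis_vec i) - u x).
  by apply: sqintB => //; exact: sqint_shift.
rewrite -(Rint_rV_shift (h *: basis_vec i) (sqint_int sD)).
rewrite le_eqVlt; apply/orP; left; apply/eqP; apply: eq_Rintegral => x _.
by rewrite scaleNr addrK -sqrrN opprB.
Qed.

Lemma Rint_sqrD_le (a b : E -> R) (t : R) : 0 < t -> sqint mu a -> sqint mu b ->
  \int[mu]_x (a x + b x) ^+ 2 <=
  (1 + t^-1) * \int[mu]_x a x ^+ 2 + (1 + t) * \int[mu]_x b x ^+ 2.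
Proof.
move=> t0 sa sb; have [ma a2] := sa; have [mb b2] := sb.
rewrite -!RintZ// -RintD; [|exact: RintegrableZ..].
apply: Rint_le; first exact: (sqint_int (sqintD sa sb)).
  by apply: RintegrableD; exact: RintegrableZ.
move=> x; rewrite -subr_ge0.
have -> : (1 + t^-1) * a x ^+ 2 + (1 + t) * b x ^+ 2 - (a x + b x) ^+ 2 =
  (a x - t * b x) ^+ 2 / t by field; rewrite gt_eqF.
by rewrite divr_ge0 ?sqr_ge0// ltW.
Qed.

(** The translation is performed one coordinate at a time; combining the squares of the steps costs
    the factor [n]. *)
Lemma diff_est u (z : E) : H1 u ->
  \int[mu]_x (u (x + z) - u x) ^+ 2 <= n%:R * `|z| ^+ 2 * dirichlet u u.
Proof.
move=> hu; have su := H1_sqint hu.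
pose zs (s : seq 'I_n) : E := \sum_(i <- s) z ord0 i *: basis_vec i.
have key s : \int[mu]_x (u (x + zs s) - u x) ^+ 2 <=
    (size s)%:R * \sum_(i <- s) `|z| ^+ 2 * \int[mu]_x weak_partial i u x ^+ 2.
  elim: s => [|i s IH].
    rewrite mul0r; under eq_Rintegral do rewrite /zs big_nil addr0 subrr expr0n/=.
    by rewrite Rint_cst0.
  have [sg wg] := weak_partialP i hu.
  set zi := z ord0 i *: basis_vec i.
  have st : \int[mu]_x (u (x + zi) - u x) ^+ 2 <=
      `|z| ^+ 2 * \int[mu]_x weak_partial i u x ^+ 2.
    apply: (le_trans (diff_step _ su sg wg)); rewrite ler_wpM2r//.
      by apply: Rint_ge0 => x; exact: sqr_ge0.
    by rewrite -(real_normK (num_real (z ord0 i))) ler_pXn2r ?nnegrE ?rV_norm_coord.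
  have zsE : zs (i :: s) = zs s + zi by rewrite /zs big_cons addrC.
  have sD : sqint mu (fun x => u (x + zi) - u x).
    by apply: sqintB => //; exact: sqint_shift.
  have E0 : \int[mu]_x (u (x + zs (i :: s)) - u x) ^+ 2 =
    \int[mu]_x ((u (x + zs s) - u x) + (u (x + zs s + zi) - u (x + zs s))) ^+ 2.
    by apply: eq_Rintegral => x _; rewrite zsE addrA; congr (_ ^+ 2); ring.
  have E1 : \int[mu]_x (u (x + zs s + zi) - u (x + zs s)) ^+ 2 =
      \int[mu]_x (u (x + zi) - u x) ^+ 2.
    by rewrite -(Rint_rV_shift (zs s) (sqint_int sD)).
  have sA : sqint mu (fun x => u (x + zs s) - u x).
    by apply: sqintB => //; exact: sqint_shift.
  have sB : sqint mu (fun x => u (x + zs s + zi) - u (x + zs s)).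
    exact: (sqint_shift (zs s) sD).
  case: s IH zsE E0 E1 sA sB => [|j s] IH zsE E0 E1 sA sB.
    rewrite E0 big_cons big_nil addr0 mul1r; apply: le_trans st.
    rewrite le_eqVlt -E1; apply/orP; left; apply/eqP; apply: eq_Rintegral => x _.
    by rewrite /zs big_nil !addr0 subrr add0r.
  (* With [k] directions treated, the weight [t = k] turns the constant [k] into [k + 1], since
     [(1 + 1 / k) k = k + 1 = 1 + t]. *)
  have k0 : 0 < (size (j :: s))%:R :> R by rewrite ltr0n.
  rewrite E0; apply: (le_trans (Rint_sqrD_le k0 sA sB)); rewrite E1.
  rewrite big_cons [size (i :: _)]/= -natr1 mulrDr addrC; apply: lerD.
    by rewrite addrC ler_wpM2l// addr_ge0// ltW.
  apply: (@le_trans _ _ ((1 + (size (j :: s))%:R^-1) * ((size (j :: s))%:R *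
    \sum_(i0 <- j :: s) `|z| ^+ 2 * \int[mu]_x weak_partial i0 u x ^+ 2))).
    by rewrite ler_wpM2l// addr_ge0// invr_ge0 ltW.
  by rewrite mulrA mulrDl mul1r mulVf ?gt_eqF.
have := key (index_enum 'I_n); rewrite -mulr_sumr -dirichlet_sqr.
have -> : zs (index_enum 'I_n) = z.
  rewrite /zs [RHS]row_sum_delta; apply: eq_bigr => i _; by [].
have -> : size (index_enum 'I_n) = n by rewrite -[RHS]card_ord cardE enumT.
by rewrite mulrA.
Qed.

(** Cauchy-Schwarz and the translation estimate for [rho]. The Lipschitz constant depends on [u]
    only through its L^2 norm, which is the equicontinuity behind [moll_cvg_uniform]. *)
Lemma moll_diff u rho (x x' : E) : sqint mu u -> test_function rho ->
  (moll u rho x - moll u rho x') ^+ 2 <=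
  n%:R * dirichlet rho rho * \int[mu]_y u y ^+ 2 * `|x - x'| ^+ 2.
Proof.
move=> su trho; have srho := test_sqint trho.
have ss (a : E) : sqint mu (fun y => rho (y - a)) by exact: sqint_shift.
rewrite /moll -RintB; [|exact: moll_integrable..].
have sB : sqint mu (fun y => rho (y + - x) - rho (y + - x')) by exact: sqintB.
rewrite (_ : \int[mu]_y _ = \int[mu]_y (u y * (rho (y + - x) - rho (y + - x')))).
  apply: (le_trans (cauchy_schwarz su sB)); rewrite mulrC.
  rewrite [leRHS]mulrAC ler_wpM2r//.
    by apply: Rint_ge0 => y; exact: sqr_ge0.
  have := diff_est (x' - x) (test_H1 trho); rewrite distrC [leRHS]mulrAC.
  apply: le_trans; rewrite le_eqVlt; apply/orP; left; apply/eqP.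
  have sB' : sqint mu (fun y => rho (y + (x' - x)) - rho y).
    by apply: sqintB => //; exact: sqint_shift.
  rewrite -(Rint_rV_shift (- x') (sqint_int sB')).
  by apply: eq_Rintegral => y _; rewrite addrA subrK.
by apply: eq_Rintegral => y _; rewrite mulrBr.
Qed.

Lemma moll_continuous u rho : sqint mu u -> test_function rho ->
  continuous (moll u rho).
Proof.
move=> su trho; apply: (@lipschitz_sqr_continuous _ _ _
  (n%:R * dirichlet rho rho * \int[mu]_y u y ^+ 2)) => [|x y]; last exact: moll_diff.
by rewrite !mulr_ge0// ?dirichlet_ge0//; apply: Rint_ge0 => y; exact: sqr_ge0.
Qed.

(** The variance of [a] for the probability density [r] is nonnegative. *)
Lemma weighted_jensen (a r : E -> R) : (forall x, 0 <= r x) ->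
  Rintegrable mu r -> \int[mu]_x r x = 1 -> Rintegrable mu (fun x => a x * r x) ->
  Rintegrable mu (fun x => a x ^+ 2 * r x) ->
  (\int[mu]_x (a x * r x)) ^+ 2 <= \int[mu]_x (a x ^+ 2 * r x).
Proof.
move=> r0 ir r1 i1 i2; set c := \int[mu]_x (a x * r x).
have : 0 <= \int[mu]_x ((a x - c) ^+ 2 * r x).
  by apply: Rint_ge0 => x; rewrite mulr_ge0// sqr_ge0.
rewrite (_ : \int[mu]_x _ =
  \int[mu]_x ((a x ^+ 2 * r x - 2 * c * (a x * r x)) + c ^+ 2 * r x)).
  rewrite RintD ?RintB ?RintZ//; [|exact: RintegrableZ|
    by apply: RintegrableB => //; exact: RintegrableZ|exact: RintegrableZ].
  by rewrite r1 -/c; nra.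
by apply: eq_Rintegral => x _; ring.
Qed.

Definition mollifier (e : R) rho : Prop :=
  [/\ test_function rho, forall x, 0 <= rho x, \int[mu]_x rho x = 1 &
    forall x, rho x != 0 -> `|x| <= e].

(** A bump at the origin with [k > 1 / e] vanishes outside the cube of half-width [1 / k] and is
    positive on the cube of half that size, so it can be normalised. *)
Lemma mollifier_exists (e : R) : 0 < e -> exists rho, mollifier e rho.
Proof.
move=> e0; pose k := (Num.trunc e^-1).+1.
have k0 : 0 < k%:R :> R by rewrite ltr0n.
have ke : k%:R^-1 <= e.
  by rewrite invf_ple ?posrE// ltW// truncnS_gt.
pose b := rV_bump (0%R : E) 0%R k.
have tb : test_function b by exact: bump_test.
have ib := test_integrable tb.
have b0 x : 0 <= b x by exact: bump_ge0.
have bsup x : b x != 0 -> `|x| <= e.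
  move=> bx; apply/rV_norm_leP; first exact: ltW.
  move=> i; apply: le_trans ke; move: bx.
  rewrite /b /rV_bump (bigD1 i)//= !mulf_eq0 !negb_or !mxE subr0 sub0r.
  move=> /andP[/andP[/flat_neq0 h1 /flat_neq0 h2] _].
  rewrite -(@ler_pM2l _ k%:R)// divff ?gt_eqF// -[k%:R in leLHS]gtr0_norm// -normrM.
  rewrite ler_norml; apply/andP; split; rewrite leNgt; apply/negP => h; nra.
have Ib : 0 < \int[mu]_x b x.
  rewrite lt_neqAle Rint_ge0 ?andbT//; apply/eqP => /esym Ib0.
  have ae0 := Rint_eq0 ib b0 Ib0.
  have [N [mN N0 sub]] := ae0.
  pose Q := rV_box (const_mx (- (k%:R^-1 / 2)) : E) (const_mx (k%:R^-1 / 2)).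
  have QN : Q `<=` N.
    move=> x Qx; apply: sub => /= bx0.
    suff : 0 < b x by rewrite bx0 ltxx.
    apply: prodr_gt0 => i _; have := Qx i; rewrite !mxE => /andP[h1 h2].
    have k1 : k%:R * (k%:R^-1 / 2) = 2^-1 :> R by rewrite mulrA divff ?gt_eqF// mul1r.
    have c1 : 0 < k%:R ^+ 2 * (x ord0 i - 0) + k%:R.
      rewrite subr0 expr2 -mulrA -[X in _ + X]mulr1 -mulrDr mulr_gt0//.
      by rewrite -(ler_pM2l k0) mulrN k1 in h1; lra.
    have c2 : 0 < k%:R ^+ 2 * (0 - x ord0 i) + k%:R.
      rewrite sub0r expr2 -mulrA -[X in _ + X]mulr1 -mulrDr mulr_gt0//.
      by rewrite -(ler_pM2l k0) k1 in h2; lra.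
    by rewrite /flat c1 c2 !expr0 !invr1 !mul1r mulr_gt0// expR_gt0.
  have : (mu Q <= mu N)%E by apply: le_measure; rewrite ?inE//; exact: measurable_rV_box.
  rewrite N0 lebesgue_rV_box; last first.
    by move=> i; rewrite !mxE; have := divr_ge0 (ltW k0) (ler0n R 2);
      have : 0 <= k%:R^-1 / 2 :> R; [rewrite divr_ge0// invr_ge0 ltW|lra].
  rewrite leNgt lte_fin => /negP; apply; apply: prodr_gt0 => i _; rewrite !mxE.
  by have : 0 < k%:R^-1 / 2 :> R; [rewrite divr_gt0// invr_gt0|lra].
exists (fun x => (\int[mu]_y b y)^-1 * b x); split.
- split; last first.
    have [_ cb] := tb; apply: subclosed_compact cb _; first exact: closed_closure.
    apply: closure_subset => x /=; apply: contra => /eqP ->; exact/eqP/mulr0.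
  move=> m; apply: flat_alg_Ck; apply: flat_algM; first exact: flat_alg_cst.
  exact: bump_flat_alg.
- by move=> x; rewrite mulr_ge0// invr_ge0 ltW.
- by rewrite RintZ// mulVf// gt_eqF.
- by move=> x; rewrite mulf_eq0 negb_or => /andP[_ /bsup].
Qed.

Lemma mollifier_shift_int (e : R) rho (x : E) : mollifier e rho ->
  Rintegrable mu (fun y => rho (y - x)) /\ \int[mu]_y rho (y - x) = 1.
Proof.
move=> [trho _ r1 _]; have ir := test_integrable trho.
by split; [exact: Rintegrable_rV_shift|rewrite Rint_rV_shift].
Qed.

Lemma test_bounded rho : test_function rho ->
  exists2 C : R, 0 <= C & forall x, `|rho x| <= C.
Proof.
move=> trho; have [M _ hM] := test_support trho.
exact: continuous_support_bounded (test_continuous trho) hM.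
Qed.

Lemma moll_sqr_integrable u rho (x : E) : sqint mu u -> test_function rho ->
  Rintegrable mu (fun y => u y ^+ 2 * rho (y - x)).
Proof.
move=> su trho; have [C C0 hC] := test_bounded trho.
apply: (Rintegrable_le _ (RintegrableZ C (sqint_int su))).
  apply: measurable_funM; first exact: Rintegrable_meas (sqint_int su).
  exact: sqint_meas (sqint_shift (- x) (test_sqint trho)).
by move=> y; rewrite normrM ger0_norm ?sqr_ge0// mulrC ler_wpM2r// sqr_ge0.
Qed.

Lemma moll_jensen (e : R) u rho (x : E) : sqint mu u -> mollifier e rho ->
  moll u rho x ^+ 2 <= \int[mu]_y (u y ^+ 2 * rho (y - x)).
Proof.
move=> su mrho; have [ir r1] := mollifier_shift_int x mrho.
have [trho r0 _ _] := mrho.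
apply: weighted_jensen => //; first exact: moll_integrable.
exact: moll_sqr_integrable.
Qed.

Lemma moll_meas u rho : sqint mu u -> test_function rho ->
  measurable_fun setT (moll u rho).
Proof. by move=> su trho; apply: rV_continuous_measurable; exact: moll_continuous. Qed.

Lemma measurable_rV_add_comp rho : measurable_fun setT rho ->
  measurable_fun setT (fun p : E * E => rho (p.2 + p.1)).
Proof.
move=> mr; apply: (measurable_fun_rV_comp mr) => j /=.
under eq_fun do rewrite !mxE.
apply: measurable_funD.
  exact: (measurableT_comp (measurable_rV_coord j) (@measurable_snd _ _ E E)).
exact: (measurableT_comp (measurable_rV_coord j) (@measurable_fst _ _ E E)).
Qed.

(** A mollification is an average of translates for the probability density [rho]; after Jensen,
    Fubini reduces integral bounds on it to bounds on each translate. *)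
Lemma moll_average_le (e : R) rho (q : E -> E -> R) (B : R) : mollifier e rho ->
  measurable_fun setT (fun p : E * E => q p.1 p.2) -> (forall z x, 0 <= q z x) ->
  (forall z, Rintegrable mu (q z)) ->
  (forall z, `|z| <= e -> \int[mu]_x q z x <= B) ->
  Rintegrable mu (fun x => \int[mu]_z (q z x * rho z)) /\
  \int[mu]_x (\int[mu]_z (q z x * rho z)) <= B.
Proof.
move=> [trho r0 r1 rs] mq q0 iq qB.
have ir := test_integrable trho; have mr := test_measurable trho.
pose f (z x : E) := q z x * rho z.
have mf : measurable_fun setT (fun p : E * E => f p.1 p.2).
  apply: measurable_funM => //.
  exact: (measurableT_comp mr (@measurable_fst _ _ E E)).
have ife z : Rintegrable mu (f z).
  by apply: eq_Rintegrable (RintegrableZ (rho z) (iq z)) => x; rewrite mulrC.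
have If z : \int[mu]_x f z x <= B * rho z.
  rewrite /f; under eq_Rintegral do rewrite mulrC.
  rewrite RintZ// mulrC; have [->|/rs/qB h] := eqVneq (rho z) 0.
    by rewrite !mulr0.
  by rewrite ler_wpM2r.
have pf : (mu \x mu)%E.-integrable setT (fun p : E * E => (f p.1 p.2)%:E).
  apply: (Rintegrable_prod mf ife (RintegrableZ B ir)) => z.
  apply: le_trans (If z); rewrite le_eqVlt; apply/orP; left; apply/eqP.
  by apply: eq_Rintegral => x _; rewrite ger0_norm// mulr_ge0.
have [_ _ i1 i2 <-] := Rint_fubini mf pf; split => //.
apply: (@le_trans _ _ (\int[mu]_z (B * rho z))); last by rewrite RintZ// r1 mulr1.
by apply: Rint_le => //; exact: RintegrableZ.
Qed.

Lemma moll_sqint (e : R) u rho : sqint mu u -> mollifier e rho ->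
  sqint mu (moll u rho) /\ \int[mu]_x moll u rho x ^+ 2 <= \int[mu]_x u x ^+ 2.
Proof.
move=> su mrho; have [trho r0 _ _] := mrho; have [mmu u2] := su.
have [||||i1 i2] := @moll_average_le e rho (fun z x => u (x + z) ^+ 2)
  (\int[mu]_x u x ^+ 2) mrho.
- exact: (measurable_rV_add_comp (measurable_funX 2 mmu)).
- by move=> z x; exact: sqr_ge0.
- by move=> z; exact: (Rintegrable_rV_shift z u2).
- by move=> z _; rewrite (Rint_rV_shift z u2).
have le x : moll u rho x ^+ 2 <= \int[mu]_z (u (x + z) ^+ 2 * rho z).
  apply: (le_trans (moll_jensen x su mrho)).
  rewrite -(Rint_rV_shift x (moll_sqr_integrable x su trho)).
  rewrite le_eqVlt; apply/orP; left; apply/eqP; apply: eq_Rintegral => z _.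
  by rewrite addrK addrC.
have mm := moll_meas su trho.
have im : Rintegrable mu (fun x => moll u rho x ^+ 2).
  apply: (Rintegrable_le (measurable_funX 2 mm) i1) => x.
  by rewrite ger0_norm ?sqr_ge0.
by split; [split|apply: le_trans i2; exact: Rint_le].
Qed.

(** Jensen against [rho], then [diff_est] for translations of length at most [e]; the rate is
    uniform on bounded sets of H^1. *)
Lemma moll_approx (e : R) u rho : 0 <= e -> H1 u -> mollifier e rho ->
  \int[mu]_x (moll u rho x - u x) ^+ 2 <= n%:R * e ^+ 2 * dirichlet u u.
Proof.
move=> e0 hu mrho; have su := H1_sqint hu; have [mmu u2] := su.
have [trho r0 r1 _] := mrho; have ir := test_integrable trho.
have sd z : sqint mu (fun x => u (x + z) - u x).
  by apply: sqintB => //; exact: sqint_shift.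
have [||||i1 i2] := @moll_average_le e rho (fun z x => (u (x + z) - u x) ^+ 2)
  (n%:R * e ^+ 2 * dirichlet u u) mrho.
- apply: measurable_funX; apply: measurable_funB.
    exact: (measurable_rV_add_comp mmu).
  exact: (measurableT_comp mmu (@measurable_snd _ _ E E)).
- by move=> z x; exact: sqr_ge0.
- by move=> z; exact: (sqint_int (sd z)).
- move=> z ze; apply: (le_trans (diff_est z hu)).
  by rewrite ler_wpM2r ?dirichlet_ge0// ler_wpM2l// ler_pXn2r ?nnegrE.
have [sm _] := moll_sqint su mrho.
apply: le_trans i2; apply: Rint_le => //; first exact: (sqint_int (sqintB sm su)).
have [C C0 hC] := test_bounded trho.
move=> x; have sux : sqint mu (fun z => u (z + x)) by exact: sqint_shift.
have srho := test_sqint trho.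
have iux := sqint_mul sux srho.
have icx : Rintegrable mu (fun z => u x * rho z) by exact: RintegrableZ.
have -> : moll u rho x - u x = \int[mu]_z ((u (x + z) - u x) * rho z).
  rewrite mollE// -[X in _ - X]mulr1 -r1 -RintZ// -RintB//.
  by apply: eq_Rintegral => z _; rewrite mulrBl (addrC x).
apply: weighted_jensen => //.
  apply: eq_Rintegrable (RintegrableB iux icx) => z.
  by rewrite mulrBl (addrC x).
apply: eq_Rintegrable (RintegrableD (RintegrableB
  (Rintegrable_rV_shift x (moll_sqr_integrable x su trho))
  (RintegrableZ (2 * u x) iux)) (RintegrableZ (u x ^+ 2) ir)) => z.
by rewrite addrK (addrC z); ring.
Qed.

Lemma moll_sup u rho : sqint mu u -> test_function rho ->
  exists C : R, 0 <= C /\ forall x : E, `|moll u rho x| <= C.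
Proof.
move=> su trho; have srho := test_sqint trho.
exists (Num.sqrt (\int[mu]_y u y ^+ 2 * \int[mu]_y rho y ^+ 2)).
split=> [|x]; first exact: sqrtr_ge0.
rewrite -sqrtr_sqr ler_wsqrtr//.
apply: (le_trans (cauchy_schwarz su (sqint_shift (- x) srho))).
by rewrite (Rint_rV_shift (- x) (sqint_int srho)).
Qed.

(** By Jensen the square is at most the integral of [u^2] against a copy of [rho] that moves to
    infinity. The decay provides the boundary value 0 in the line estimates. *)
Lemma moll_decay (e : R) u rho i (x : E) : sqint mu u -> mollifier e rho ->
  moll u rho (x - k%:R *: basis_vec i) @[k --> \oo] --> (0 : R).
Proof.
move=> su mrho; have [trho r0 r1 rs] := mrho.
have [C C0 hC] := test_bounded trho.
pose f (k : nat) (y : E) := u y ^+ 2 * rho (y - (x - k%:R *: basis_vec i)).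
have [|||_ h] := @Rint_dominated _ _ _ mu f (fun=> 0)
  (fun y => C * u y ^+ 2) _ (measurable_cst _) _ (RintegrableZ C (sqint_int su)) _.
- by move=> k; exact: Rintegrable_meas (moll_sqr_integrable _ su trho).
- apply: aeW => y; apply: cvg_near_cst; near=> k; rewrite /f.
  suff -> : rho (y - (x - k%:R *: basis_vec i)) = 0 by rewrite mulr0.
  apply/eqP; apply: contraT => /rs h; exfalso.
  have := le_trans (rV_norm_coord _ i) h; rewrite !mxE !eqxx/= mulr1.
  have h2 : e + `|y ord0 i - x ord0 i| < k%:R by near: k; exact: nbhs_infty_gtr.
  have := ler_norm (- (y ord0 i - x ord0 i)); rewrite normrN.
  have := ler_norm (y ord0 i - (x ord0 i - k%:R)); lra.
- apply: aeW => y k; rewrite /f normrM ger0_norm ?sqr_ge0// mulrC.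
  by rewrite ler_wpM2r// sqr_ge0.
move: h; rewrite Rint_cst0 => h.
have h2 : moll u rho (x - k%:R *: basis_vec i) ^+ 2 @[k --> \oo] --> (0 : R).
  apply: (squeeze_cvgr _ (cvg_cst 0) h); apply: nearW => k.
  by rewrite sqr_ge0 (moll_jensen _ su mrho).
apply/cvgr0Pnorm_lt => d d0.
have d2 : 0 < d ^+ 2 by rewrite exprn_gt0.
near=> k; rewrite -(@ltr_pXn2r _ 2)// ?nnegrE ?ltW// -normrX.
by near: k; move/cvgr0Pnorm_lt : h2; exact.
Unshelve. all: by end_near. Qed.

End differences.

(** * The Sobolev inequality *)

Section gagliardo_nirenberg.
Context {R : realType}.
Local Notation lam := (@lebesgue_measure R).

(** The Hoelder inequality with exponents [q] and [p] for the product of [u ^ (1 / q)] and [u]. *)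
Lemma holder_interpolation d (T : measurableType d) (m : {measure set T -> \bar R})
    (u : T -> R) (p q : R) : 0 < p -> 0 < q -> p^-1 + q^-1 = 1 ->
  measurable_fun setT u -> (forall x, 0 <= u x) ->
  (\int[m]_x (u x `^ (q^-1 + 1))%:E <=
   (\int[m]_x (u x)%:E) `^ q^-1 * (\int[m]_x (u x `^ p)%:E) `^ p^-1)%E.
Proof.
move=> p0 q0 pq mu' u0.
have mv : measurable_fun setT (fun x => u x `^ q^-1).
  exact: (measurableT_comp (measurable_powR _)).
have qi0 : 0 < q^-1 by rewrite invr_gt0.
have := @hoelder _ _ _ m (fun x => u x `^ q^-1) u q p mv mu' q0 p0.
rewrite addrC => /(_ pq); rewrite Lnorm1 unlock.
rewrite (_ : (\int[m]_x `|_|)%E = (\int[m]_x (u x `^ (q^-1 + 1))%:E)%E); last first.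
  apply: eq_integral => x _ /=; rewrite ger0_norm ?mulr_ge0 ?powR_ge0//.
  rewrite powRD ?powRr1//; apply/implyP => /eqP h.
  by have := addr_gt0 qi0 (@ltr01 R); rewrite h ltxx.
move=> h; apply: (le_trans h); rewrite le_eqVlt; apply/orP; left; apply/eqP.
congr (_ `^ _ * _ `^ _)%E; apply: eq_integral => x _ /=.
  by rewrite ger0_norm ?powR_ge0// -powRrM mulVf ?gt_eqF// powRr1.
by rewrite ger0_norm.
Qed.

Definition rV_upd {n : nat} (x : 'rV[R]_n) (i : 'I_n) (s : R) : 'rV[R]_n :=
  \row_j (if j == i then s else x ord0 j).

Lemma rV_upd_cons0 n (a s : R) (y : 'rV[R]_n) :
  rV_upd (rV_cons (a, y)) ord0 s = rV_cons (s, y).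
Proof.
apply/rowP => i; rewrite mxE; have [j ->|->] := unliftP ord0 i.
  by rewrite !rV_consS.
by rewrite eqxx rV_cons0.
Qed.

Lemma rV_upd_consS n (a s : R) (y : 'rV[R]_n) j :
  rV_upd (rV_cons (a, y)) (lift ord0 j) s = rV_cons (a, rV_upd y j s).
Proof.
apply/rowP => i; rewrite mxE; have [k ->|->] := unliftP ord0 i.
  by rewrite !rV_consS mxE (inj_eq lift_inj).
by rewrite !rV_cons0.
Qed.

Section tonelli.
Context {n : nat} (f : 'rV[R]_n.+1 -> \bar R).
Hypotheses (mf : measurable_fun setT f) (f0 : forall x, (0 <= f x)%E).

Let mfc : measurable_fun setT (f \o @rV_cons R n).
Proof. by apply: measurableT_comp => //; exact: measurable_rV_cons. Qed.

Let prodE : (\int[lebesgue_rV n.+1]_x f x =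
  \int[(lam \x lebesgue_rV n)%E]_p f (rV_cons p))%E.
Proof.
rewrite -[LHS]/(\int[lebesgue_rV_succ (lebesgue_rV n)]_x f x)%E.
have := @ge0_integral_pushforward _ _ _ _ R _ (@measurable_rV_cons R n)
  (lam \x lebesgue_rV n)%E setT f measurableT mf (fun x _ => f0 x).
by rewrite preimage_setT => <-.
Qed.

Lemma integral_rV_cons : (\int[lebesgue_rV n.+1]_x f x =
  \int[lam]_a \int[lebesgue_rV n]_y f (rV_cons (a, y)))%E.
Proof. by rewrite prodE fubini_tonelli1//= => p; exact: f0. Qed.

Lemma integral_rV_cons_swap : (\int[lebesgue_rV n.+1]_x f x =
  \int[lebesgue_rV n]_y \int[lam]_a f (rV_cons (a, y)))%E.
Proof. by rewrite prodE fubini_tonelli2//= => p; exact: f0. Qed.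

Lemma measurable_rV_cons1 a : measurable_fun setT (fun y => f (rV_cons (a, y))).
Proof. exact: (measurableT_comp mfc (measurable_pair1 a)). Qed.

Lemma measurable_integral_rV_cons1 : measurable_fun setT
  (fun a : measurableTypeR R => \int[lebesgue_rV n]_y f (rV_cons (a, y)))%E.
Proof.
apply: (@measurable_fun_fubini_tonelli_F _ _ (measurableTypeR R) _ R
  (lebesgue_rV n) (f \o @rV_cons R n)) => //= p; exact: f0.
Qed.

Lemma measurable_integral_rV_cons2 : measurable_fun setT
  (fun y => \int[lam]_a f (rV_cons (a, y)))%E.
Proof.
apply: (@measurable_fun_fubini_tonelli_G _ _ (measurableTypeR R) _ R
  lam (f \o @rV_cons R n)) => //= p; exact: f0.
Qed.

End tonelli.

Lemma integral_rV0 (f : 'rV[R]_0 -> \bar R) : measurable_fun setT f ->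
  (\int[lebesgue_rV 0]_x f x = f 0%R)%E.
Proof. by move=> mf; rewrite /= integral_dirac// diracT mul1e. Qed.

(* By slicing: the estimate in the hyperplanes [x_0 = a] is interpolated with the
   bound on the integral over these hyperplanes given by the first coordinate. *)
Lemma gagliardo_nirenberg_succ n (u : 'rV[R]_n.+2 -> R) (g : 'I_n.+2 -> 'rV[R]_n.+2 -> R) :
  measurable_fun setT u -> (forall x, 0 <= u x) ->
  (forall i, measurable_fun setT (g i)) -> (forall i x, 0 <= g i x) ->
  (forall i x, (u x)%:E <= \int[lam]_s (g i (rV_upd x i s))%:E)%E ->
  (\int[lebesgue_rV n.+2]_x (u x `^ (n.+2%:R / n.+1%:R))%:E <=
   (\sum_i \int[lebesgue_rV n.+2]_x (g i x)%:E) `^ (n.+2%:R / n.+1%:R))%E.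
Proof.
elim: n u g => [|n IH] u g mu' u0 mg g0 hu.
all: pose G i := (\int[lebesgue_rV _]_x (g i x)%:E)%E.
all: have G0 i : (0 <= G i)%E by apply: integral_ge0 => x _; rewrite lee_fin.
all: have mEg i : measurable_fun setT (EFin \o g i) by exact/measurable_EFinP.
all: have Eg0 i x : (0 <= (EFin \o g i) x)%E by rewrite lee_fin.
(* In dimension two [u] is bounded by a function of each coordinate alone, so [u^2 <= A a * b y] and
   the integral of the product factors. *)
- rewrite divr1; pose b (y : 'rV[R]_1) := (\int[lam]_s (g ord0 (rV_cons (s, y)))%:E)%E.
  pose i1 : 'I_2 := lift ord0 ord0.
  pose A (a : measurableTypeR R) :=
    (\int[lebesgue_rV 1]_y (g i1 (rV_cons (a, y)))%:E)%E.
  have b0 y : (0 <= b y)%E by apply: integral_ge0 => s _; rewrite lee_fin.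
  have A0 a : (0 <= A a)%E by apply: integral_ge0 => s _; rewrite lee_fin.
  have mb : measurable_fun setT b.
    exact: (measurable_integral_rV_cons2 (mEg ord0) (Eg0 ord0)).
  have mA : measurable_fun setT A.
    exact: (measurable_integral_rV_cons1 (mEg i1) (Eg0 i1)).
  have ub a y : ((u (rV_cons (a, y)))%:E <= b y)%E.
    have := hu ord0 (rV_cons (a, y)).
    by under eq_integral do rewrite rV_upd_cons0.
  have uA a y : ((u (rV_cons (a, y)))%:E <= A a)%E.
    have := hu i1 (rV_cons (a, y)).
    under eq_integral do rewrite rV_upd_consS.
    rewrite /A integral_rV_cons; last 2 first.
    - exact: (measurable_rV_cons1 (mEg i1)).
    - by move=> x; exact: (Eg0 i1).
    move=> h; apply: (le_trans h); rewrite le_eqVlt; apply/orP; left; apply/eqP.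
    apply: eq_integral => s _; rewrite integral_rV0.
      congr (EFin (g i1 (rV_cons (a, _)))).
      by apply/rowP => j; rewrite mxE ord1 eqxx rV_cons0.
    apply: (measurableT_comp (measurable_rV_cons1 (mEg i1) a)).
    exact: (measurableT_comp (@measurable_rV_cons R 0) (measurable_pair1 s)).
  have mu2 : measurable_fun setT (fun x => (u x `^ 2)%:E).
    by apply/measurable_EFinP; exact: (measurableT_comp (measurable_powR _)).
  rewrite integral_rV_cons//; last by move=> x; rewrite lee_fin powR_ge0.
  apply: (@le_trans _ _ (\int[lam]_a (A a * G ord0))%E).
    apply: ge0_le_integral => //.
    - by move=> a _; apply: integral_ge0 => y _; rewrite lee_fin powR_ge0.
    - apply: (measurable_integral_rV_cons1 mu2) => x; by rewrite lee_fin powR_ge0.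
    - exact: emeasurable_funM.
    move=> a _; rewrite /G (integral_rV_cons_swap (mEg ord0) (Eg0 ord0)) -/(b _).
    rewrite -[X in (_ <= A a * X)%E]/(\int[lebesgue_rV 1]_y b y)%E.
    rewrite -(ge0_integralZl _ measurableT mb (fun y _ => b0 y) (A0 a)).
    apply: ge0_le_integral => //.
    - by move=> y _; rewrite lee_fin powR_ge0.
    - exact: (measurable_rV_cons1 mu2).
    - exact: emeasurable_funM.
    move=> y _; rewrite (powR_mulrn 2)// expr2 EFinM.
    by apply: lee_pmul; rewrite ?lee_fin.
  rewrite ge0_integralZr// /A.
  rewrite -(integral_rV_cons (mEg i1) (Eg0 i1)) -/(G i1).
  rewrite big_ord_recl big_ord1 -/(G ord0) -/(G i1).
  have -> : (2%:R : R) = 1 + 1 by [].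
  have S0 : (0 <= G ord0 + G i1)%E by exact: adde_ge0.
  rewrite poweRD; last by apply: add_neq0_poweRD_def; rewrite gt_eqF// addr_gt0.
  by rewrite poweRe1// lee_pmul// ?leeDl ?leeDr.
(* The exponent on the slices and its conjugate; the exponent in the next dimension is [1 / q + 1],
   which is what the interpolation yields. *)
pose p : R := n.+2%:R / n.+1%:R; pose q : R := n.+2%:R.
have p0 : 0 < p by rewrite divr_gt0.
have q0 : 0 < q by rewrite ltr0n.
have pq : p^-1 + q^-1 = 1.
  rewrite /p /q -(natr1 n.+1) -(natr1 n); field.
  by rewrite !natr1 !pnatr_eq0.
have qe : n.+3%:R / n.+2%:R = q^-1 + 1 :> R.
  by rewrite -natr1 mulrDl divff ?pnatr_eq0// addrC mul1r.
rewrite qe.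
pose A (a : measurableTypeR R) :=
  (\sum_(j < n.+2) \int[lebesgue_rV n.+2]_y (g (lift ord0 j) (rV_cons (a, y)))%:E)%E.
have A0 a : (0 <= A a)%E.
  by apply: sume_ge0 => j _; apply: integral_ge0 => s _; rewrite lee_fin.
have mA : measurable_fun setT A.
  apply: emeasurable_sum => j.
  exact: (measurable_integral_rV_cons1 (mEg (lift ord0 j)) (Eg0 (lift ord0 j))).
pose ua (a : measurableTypeR R) (y : 'rV[R]_n.+2) := u (rV_cons (a, y)).
have ua0 a y : 0 <= ua a y by exact: u0.
have mEu : measurable_fun setT (EFin \o u) by exact/measurable_EFinP.
have mua a : measurable_fun setT (ua a).
  by apply/measurable_EFinP; exact: (measurable_rV_cons1 mEu a).
have slice a : (\int[lebesgue_rV n.+2]_y (ua a y `^ p)%:E <= A a `^ p)%E.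
  apply: IH => //.
  - move=> j; apply/measurable_EFinP.
    exact: (measurable_rV_cons1 (mEg (lift ord0 j)) a).
  - move=> j y; have := hu (lift ord0 j) (rV_cons (a, y)).
    by under eq_integral do rewrite rV_upd_consS.
have ua1 a : (\int[lebesgue_rV n.+2]_y (ua a y)%:E <= G ord0)%E.
  rewrite /G (integral_rV_cons_swap (mEg ord0) (Eg0 ord0)).
  apply: ge0_le_integral => //.
  - by move=> y _; rewrite lee_fin.
  - exact/measurable_EFinP.
  - exact: (measurable_integral_rV_cons2 (mEg ord0) (Eg0 ord0)).
  - move=> y _; have := hu ord0 (rV_cons (a, y)).
    by under eq_integral do rewrite rV_upd_cons0.
have step a : (\int[lebesgue_rV n.+2]_y (ua a y `^ (q^-1 + 1))%:E <=
    G ord0 `^ q^-1 * A a)%E.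
  apply: (le_trans (@holder_interpolation _ _ (lebesgue_rV n.+2) (ua a) p q
    p0 q0 pq (mua a) (ua0 a))).
  apply: lee_pmul; rewrite ?poweR_ge0//.
    apply: gt0_ler_poweR => //; rewrite ?in_itv/= ?leey ?andbT//.
      by rewrite invr_ge0 ltW.
    by apply: integral_ge0 => y _; rewrite lee_fin.
  have -> : A a = ((A a `^ p) `^ p^-1)%E.
    by rewrite -poweRrM divff ?gt_eqF// poweRe1.
  apply: gt0_ler_poweR => //; rewrite ?in_itv/= ?leey ?andbT ?poweR_ge0//.
    by rewrite invr_ge0 ltW.
  by apply: integral_ge0 => y _; rewrite lee_fin powR_ge0.
have muq : measurable_fun setT (fun x => (u x `^ (q^-1 + 1))%:E).
  by apply/measurable_EFinP; exact: (measurableT_comp (measurable_powR _)).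
have uq0 x : (0 <= (u x `^ (q^-1 + 1))%:E)%E by rewrite lee_fin powR_ge0.
rewrite integral_rV_cons//.
apply: (@le_trans _ _ (\int[lam]_a (G ord0 `^ q^-1 * A a))%E).
  apply: ge0_le_integral => //.
  - by move=> a _; apply: integral_ge0.
  - exact: (measurable_integral_rV_cons1 muq uq0).
  - exact: emeasurable_funM.
  - by move=> a _; exact: step.
rewrite ge0_integralZl// ?poweR_ge0//.
have -> : (\int[lam]_a A a = \sum_(j < n.+2) G (lift ord0 j))%E.
  rewrite /A ge0_integral_sum//.
  - apply: eq_bigr => j _.
    by rewrite -(integral_rV_cons (mEg (lift ord0 j)) (Eg0 (lift ord0 j))).
  - move=> j.
    exact: (measurable_integral_rV_cons1 (mEg (lift ord0 j)) (Eg0 (lift ord0 j))).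
  - by move=> j a _; apply: integral_ge0 => y _; rewrite lee_fin.
(* With [S] the sum over the other directions, [G_0 ^ (1 / q) S] is at most
   [(G_0 + S) ^ (1 / q + 1)]. *)
rewrite [X in (_ <= X `^ _)%E]big_ord_recl -/(G ord0).
set S := (\sum_(i < n.+2) _)%E.
have S0 : (0 <= S)%E by apply: sume_ge0 => j _; exact: G0.
have qi0 : 0 < q^-1 by rewrite invr_gt0.
rewrite poweRD; last first.
  by apply: add_neq0_poweRD_def; rewrite gt_eqF// addr_gt0.
rewrite poweRe1; last exact: adde_ge0.
have G00 := G0 ord0.
apply: lee_pmul; rewrite ?poweR_ge0//; last by rewrite leeDr.
apply: gt0_ler_poweR; first exact: ltW.
- by rewrite in_itv/= leey G00.
- by rewrite in_itv/= leey andbT; exact: adde_ge0.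
by rewrite leeDl.
Qed.

Lemma gagliardo_nirenberg n (u : 'rV[R]_n -> R) (g : 'I_n -> 'rV[R]_n -> R) :
  (2 <= n)%N -> measurable_fun setT u -> (forall x, 0 <= u x) ->
  (forall i, measurable_fun setT (g i)) -> (forall i x, 0 <= g i x) ->
  (forall i x, (u x)%:E <= \int[lam]_s (g i (rV_upd x i s))%:E)%E ->
  (\int[lebesgue_rV n]_x (u x `^ (n%:R / (n%:R - 1)))%:E <=
   (\sum_i \int[lebesgue_rV n]_x (g i x)%:E) `^ (n%:R / (n%:R - 1)))%E.
Proof.
case: n u g => [//|[//|n]] u g _ mu' u0 mg g0 hu.
by have := gagliardo_nirenberg_succ mu' u0 mg g0 hu; rewrite -(natr1 n.+1) addrK.
Qed.

End gagliardo_nirenberg.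

Section abs_powR.
Context {R : realType}.
Implicit Types (p t : R).
Local Notation lam := (@lebesgue_measure R).

Lemma powR_continuous_gt0 p (a : R) : 0 < a -> {for a, continuous (@powR R ^~ p)}.
Proof.
move=> a0; apply: differentiable_continuous; apply/derivable1_diffP.
by apply: derivable_powR; rewrite in_itv/= a0.
Qed.

Lemma abs_powR_continuous p : 0 < p -> continuous (fun t => `|t| `^ p).
Proof.
move=> p0 t; have [->|t0] := eqVneq t 0; last first.
  apply: (@continuous_comp _ _ _ (fun s : R => `|s|) (@powR R ^~ p)).
    exact: norm_continuous.
  by apply: powR_continuous_gt0; rewrite normr_gt0.
apply/cvgrPdist_lt => e e0; have ep : 0 < e `^ p^-1 by rewrite powR_gt0.
near=> s; rewrite normr0 powR0 ?gt_eqF// sub0r normrN ger0_norm ?powR_ge0//.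
have -> : e = (e `^ p^-1) `^ p by rewrite -powRrM mulVf ?gt_eqF// powRr1// ltW.
apply: gt0_ltr_powR; rewrite ?nnegrE ?powR_ge0//.
Unshelve. end_near. Qed.

Lemma measurable_abs_powR p : measurable_fun setT (fun t : R => `|t| `^ p).
Proof. exact: (measurableT_comp (measurable_powR _)). Qed.

Lemma is_derive_powR p (a : R) : 0 < a ->
  is_derive a 1 (@powR R ^~ p) (p * a `^ (p - 1)).
Proof.
move=> a0; have ai : a \in `]0, +oo[ by rewrite in_itv/= a0.
apply: DeriveDef; first exact: derivable_powR.
by rewrite -derive1E powR_derive1.
Qed.

(** Away from 0 this is the power rule up to a sign; at 0 the difference quotient has absolute value
    [|h| ^ (p - 1)], which tends to 0. *)
Lemma is_derive_abs_powR p t : 2 < p ->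
  is_derive t 1 (fun s => `|s| `^ p) (p * (`|t| `^ (p - 2) * t)).
Proof.
move=> p2; have p1 : 0 < p - 1 by lra.
have pE (s : R) : 0 <= s -> s `^ (p - 2) * s = s `^ (p - 1).
  by move=> s0; rewrite mulrC -(mulr_powRB1 s0 p1); congr (_ * _ `^ _); ring.
have [t0|t0|t0] := ltgtP t 0; last first.
- apply/is_deriveP; rewrite t0 mulr0 mulr0.
  apply/cvgr0Pnorm_lt => e e0.
  have := @abs_powR_continuous _ p1 (0 : R).
  rewrite /continuous_at normr0 powR0 ?gt_eqF// => /cvgr0Pnorm_lt/(_ e e0) H.
  near=> h; have h0 : h != 0 by near: h; exact: nbhs_dnbhs_neq.
  rewrite /= addr0 (@powR0 _ p) ?subr0 ?gt_eqF//; last by lra.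
  rewrite [h%:A]mulr1 normrM normfV (ger0_norm (powR_ge0 _ _)).
  rewrite -(mulr_powRB1 (normr_ge0 h))//; last by lra.
  rewrite mulKf ?normr_eq0//.
  rewrite -(ger0_norm (powR_ge0 `|h| (p - 1))).
  by near: h; apply: nbhs_dnbhs.
- rewrite gtr0_norm// pE ?ltW//; apply: near_eq_is_derive (is_derive_powR p t0).
  by near=> s => /=; rewrite gtr0_norm//; near: s; exact: lt_nbhsr.
have t0' : 0 < - t by rewrite oppr_gt0.
have dN : is_derive t 1 (fun s : R => - s) (-1).
  by apply: is_deriveN.
have := @is_derive1_comp R (@powR R ^~ p) (fun s => - s) t _ _ (is_derive_powR p t0') dN.
move=> h; rewrite ltr0_norm//.
have -> : p * ((- t) `^ (p - 2) * t) = -1 * (p * (- t) `^ (p - 1)).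
  by rewrite -pE ?ltW//; ring.
apply: near_eq_is_derive (is_derive_val h _); last by rewrite mulrC.
by near=> s => /=; rewrite ltr0_norm//; near: s; exact: lt_nbhsl.
Unshelve. all: end_near. Qed.

(** The fundamental theorem of calculus for [|v| ^ p] on [[b - k, b]]; the left boundary value
    disappears as [k] grows. The right side may be infinite. *)
Lemma abs_powR_line p (v g : R -> R) (b : R) : 2 < p -> continuous g ->
  (forall s : R, is_derive s 1 v (g s)) -> v (b - k%:R) @[k --> \oo] --> (0 : R) ->
  ((`|v b| `^ p)%:E <= \int[lam]_s (p * (`|v s| `^ (p - 1) * `|g s|))%:E)%E.
Proof.
move=> p2 cg dv vb; set I := (\int[lam]_s _)%E.
have cv : continuous v.
  by move=> s; apply: differentiable_continuous; apply/derivable1_diffP; have [] := dv s.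
pose w s := p * (`|v s| `^ (p - 2) * v s) * g s.
have cw : continuous w.
  move=> s; apply: (@continuousM R R (fun s => p * (`|v s| `^ (p - 2) * v s)) g);
    last exact: cg.
  apply: (@continuousM R R (cst p) (fun s => `|v s| `^ (p - 2) * v s)).
    exact: cst_continuous.
  apply: (@continuousM R R (fun s => `|v s| `^ (p - 2)) v); last exact: cv.
  apply: (@continuous_comp _ _ _ v (fun t => `|t| `^ (p - 2))); first exact: cv.
  by apply: abs_powR_continuous; lra.
have dF (s : R) : is_derive s 1 (fun s => `|v s| `^ p) (w s).
  apply: (is_derive_val (is_derive1_comp (is_derive_abs_powR (v s) p2) (dv s))).
  by rewrite /w mulrC.
have cF : continuous (fun s => `|v s| `^ p).
  by move=> s; apply: differentiable_continuous; apply/derivable1_diffP; have [] := dF s.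
have wE s : `|w s| = p * (`|v s| `^ (p - 1) * `|g s|).
  rewrite /w !normrM (gtr0_norm (lt_trans _ p2))// (ger0_norm (powR_ge0 _ _)).
  have -> : `|v s| `^ (p - 2) * `|v s| = `|v s| `^ (p - 1).
    rewrite mulrC -(@mulr_powRB1 _ _ (p - 1))//; last by lra.
    by congr (_ * _ `^ _); ring.
  by rewrite mulrA.
have step (k : nat) : ((`|v b| `^ p - `|v (b - k.+1%:R)| `^ p)%:E <= I)%E.
  have bk : b - k.+1%:R < b by rewrite ltrBlDr ltrDl ltr0n.
  rewrite EFinB -(@continuous_FTC2 R w (fun s => `|v s| `^ p) _ _ bk).
  - apply: (le_trans (lee_abs _)); apply: (le_trans (le_abse_integral lam _ _)).
    + exact: measurable_itv.
    + apply/measurable_EFinP; apply: measurable_funTS.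
      exact: continuous_measurable_fun.
    rewrite /I; under [leRHS]eq_integral do rewrite -wE.
    apply: ge0_subset_integral => //.
    apply/measurable_EFinP; apply: measurableT_comp => //.
    exact: continuous_measurable_fun.
  - exact: continuous_subspaceT.
  - split=> [s _||]; first by have [] := dF s.
    + by apply: cvg_at_right_filter; exact: cF.
    + by apply: cvg_at_left_filter; exact: cF.
  - by move=> s _; rewrite derive1E; have [] := dF s.
have I0 : (0 <= I)%E.
  by apply: integral_ge0 => s _; rewrite lee_fin -wE.
have [->|Ify] := eqVneq I +oo%E; first exact: leey.
have If : I \is a fin_num by rewrite ge0_fin_numE// ltey.
rewrite -(fineK If) lee_fin.
have cvk : `|v b| `^ p - `|v (b - k.+1%:R)| `^ p @[k --> \oo] --> `|v b| `^ p.
  rewrite -[X in _ --> X]subr0; apply: cvgB; first exact: cvg_cst.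
  have p0 : 0 < p by lra.
  have h := @abs_powR_continuous _ p0 (0 : R); rewrite /continuous_at normr0 powR0 ?gt_eqF// in h.
  have vb' : v (b - k.+1%:R) @[k --> \oo] --> (0 : R).
    by have := vb; rewrite -(cvg_shiftS (fun k => v (b - k%:R))).
  exact: (cvg_comp _ _ vb' h).
rewrite -(cvg_lim (@Rhausdorff R) cvk); apply: limr_le.
  by apply/cvg_ex; exists (`|v b| `^ p).
by apply: nearW => k; rewrite -lee_fin fineK.
Qed.

End abs_powR.

Section summable.
Context d (T : measurableType d) (R : realType).
Variable m : {measure set T -> \bar R}.

Lemma ae_cvg0_of_summable (f_ : (T -> R)^nat) (C : R) :
  (forall n, Rintegrable m (f_ n)) -> (forall n x, 0 <= f_ n x) ->
  (forall n, \sum_(k < n) \int[m]_x f_ k x <= C) ->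
  {ae m, forall x, f_ ^~ x @ \oo --> (0 : R)}.
Proof.
move=> if_ f0 fC; have [H [_ _ _ hH]] := Rint_series if_ f0 fC.
apply: filterS hH => x hx; apply: cvg_series_cvg_0; apply: nondecreasing_is_cvgn.
  by apply/nondecreasing_seqP => n; rewrite !seriesEnat/= big_nat_recr//= lerDl.
by exists (H x) => _ [n _ <-]; rewrite seriesEord; exact: hx.
Qed.

End summable.

Section sobolev_inequality.
Context {R : realType} {n : nat} (n3 : (3 <= n)%N).
Local Notation E := 'rV[R]_n.
Local Notation mu := (lebesgue_rV n : {sigma_finite_measure set E -> \bar R}).
Local Notation lam := (@lebesgue_measure R).
Local Notation a := n%:R.
Local Notation s2 := (critical_exponent n).

Let a3 : 3 <= a :> R.
Proof. by rewrite ler_nat. Qed.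

Let a2 : a - 2 != 0 :> R.
Proof. by rewrite gt_eqF//; have := a3; lra. Qed.

Let a1 : a - 1 != 0 :> R.
Proof. by rewrite gt_eqF//; have := a3; lra. Qed.

Lemma critical_exponent_gt2 : 2 < s2 :> R.
Proof. by rewrite /critical_exponent ltr_pdivlMr; have := a3; lra. Qed.

Let s20 : s2 != 0 :> R.
Proof. by rewrite gt_eqF// (lt_trans _ critical_exponent_gt2). Qed.

Lemma rV_upd_line (x : E) i s : rV_upd x i s = rV_upd x i 0 + s *: basis_vec i.
Proof.
apply/rowP => j; rewrite !mxE eqxx /=; case: eqP => _.
  by rewrite add0r mulr1.
by rewrite mulr0 addr0.
Qed.

Lemma rV_upd_id (x : E) i : rV_upd x i (x ord0 i) = x.
Proof. by apply/rowP => j; rewrite mxE; case: eqP => [->|]. Qed.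

Lemma moll_line_powR (e : R) (u g : E -> R) rho i (x : E) (p : R) : 2 < p ->
  sqint mu u -> sqint mu g -> is_weak_partial i u g -> mollifier e rho ->
  ((`|moll u rho x| `^ p)%:E <= \int[lam]_s (p *
    (`|moll u rho (rV_upd x i s)| `^ (p - 1) * `|moll g rho (rV_upd x i s)|))%:E)%E.
Proof.
move=> p2 su sg wu mrho; have [trho _ _ _] := mrho.
pose y := rV_upd x i 0.
have := @abs_powR_line R p (fun s => moll u rho (y + s *: basis_vec i))
  (fun s => moll g rho (y + s *: basis_vec i)) (x ord0 i) p2.
rewrite -rV_upd_line rV_upd_id.
under [X in (_ -> _ -> _ -> _ <= X)%E -> _]eq_integral do rewrite -!rV_upd_line.
apply.
- exact: moll_line_continuous.
- move=> s; have [d1 d2] := moll_is_derive (y + s *: basis_vec i) su sg wu trho.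
  by apply: (is_derive_val (is_derive_line d1)); rewrite d2.
- have := moll_decay i x su mrho.
  apply: cvg_trans; apply: near_eq_cvg; apply: nearW => k /=; congr (moll _ _ _).
  by rewrite scalerBl addrA -rV_upd_line rV_upd_id.
Qed.

(** With [q = n / (n - 1)] the factor [X ^ (q / 2)] is absorbed into the left side, which is
    legitimate since [X] is finite; then [q / (1 - q / 2)] is the critical exponent. *)
Lemma sobolev_exponent_arith (X D K : R) : 0 <= X -> 0 <= D -> 0 <= K ->
  X <= (K * Num.sqrt (X * D)) `^ (a / (a - 1)) ->
  X <= K `^ s2 * D `^ (a / (a - 2)).
Proof.
move=> X0 D0 K0; have [->|Xn0] := eqVneq X 0.
  by rewrite mulr_ge0// powR_ge0.
have Xp : 0 < X by rewrite lt_neqAle eq_sym Xn0.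
pose q : R := a / (a - 1); rewrite -/q.
have q0 : 0 < q by rewrite divr_gt0//; have := a3; lra.
rewrite sqrtrM// mulrCA powRM ?sqrtr_ge0 ?mulr_ge0 ?sqrtr_ge0//.
rewrite -(powR12_sqrt X0) -powRrM => h.
have c0 : 0 < 1 - 2^-1 * q.
  have -> : 1 - 2^-1 * q = (a - 2) / (2 * (a - 1)) by rewrite /q; field.
  by rewrite divr_gt0//; have := a3; lra.
have h1 : X `^ (1 - 2^-1 * q) <= (K * Num.sqrt D) `^ q.
  rewrite powRB; last by rewrite Xn0 implybT.
  rewrite powRr1// ler_pdivrMr ?powR_gt0//; by rewrite mulrC.
have := ge0_ler_powR (ltW (_ : 0 < (1 - 2^-1 * q)^-1)) _ _ h1.
rewrite invr_gt0 => /(_ c0); rewrite !nnegrE !powR_ge0 => /(_ isT isT).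
rewrite -!powRrM divff ?gt_eqF// powRr1//.
have -> : q / (1 - 2^-1 * q) = s2.
  by rewrite /q /critical_exponent; field; rewrite a2 a1.
rewrite powRM ?sqrtr_ge0// -(powR12_sqrt D0) -powRrM.
by have -> : 2^-1 * s2 = a / (a - 2) :> R by rewrite /critical_exponent; field.
Qed.

(** Gagliardo-Nirenberg for [|v| ^ p]: the choice [p = 2 (n - 1) / (n - 2)] makes both
    [p n / (n - 1)] and [2 (p - 1)] equal to the critical exponent, so Cauchy-Schwarz on the right
    reproduces the left side. That side is finite since [v] is bounded and square integrable. *)
Lemma moll_sobolev (e : R) (u : E -> R) rho : H1 u -> mollifier e rho ->
  Rintegrable mu (fun x => `|moll u rho x| `^ s2) /\
  \int[mu]_x `|moll u rho x| `^ s2 <=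
    (a * (2 * (a - 1) / (a - 2))) `^ s2 * dirichlet u u `^ (a / (a - 2)).
Proof.
move=> hu mrho; have su := H1_sqint hu; have [trho _ _ _] := mrho.
have [C [C0 hC]] := moll_sup su trho; have [sv _] := moll_sqint su mrho.
set v := moll u rho in hC sv *; have mv := sqint_meas sv.
pose p : R := 2 * (a - 1) / (a - 2).
have p2 : 2 < p by rewrite ltr_pdivlMr; have := a3; lra.
have mvp q : measurable_fun setT (fun x => `|v x| `^ q).
  exact: (measurableT_comp (measurable_abs_powR q)).
have s22 : 0 <= s2 - 2 :> R by have := critical_exponent_gt2; lra.
have iX : Rintegrable mu (fun x => `|v x| `^ s2).
  apply: (Rintegrable_le (mvp _) (RintegrableZ (C `^ (s2 - 2)) (sqint_int sv))) => x.
  rewrite ger0_norm ?powR_ge0//.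
  have -> : `|v x| `^ s2 = `|v x| `^ (s2 - 2) * v x ^+ 2.
    rewrite -real_normK ?num_real// -(powR_mulrn 2)// -powRD subrK//.
    by apply/implyP => /eqP h; move: s20; rewrite h eqxx.
  apply: ler_wpM2r; first exact: sqr_ge0.
  by apply: ge0_ler_powR => //; rewrite nnegrE.
split=> //; set X := \int[mu]_x _; have X0 : 0 <= X.
  by apply: Rint_ge0 => x; exact: powR_ge0.
have D0 := dirichlet_ge0 u.
apply: sobolev_exponent_arith => //.
  by rewrite mulr_ge0 ?divr_ge0 ?mulr_ge0//; have := a3; lra.
pose h x := `|v x| `^ (p - 1).
have h2 x : h x ^+ 2 = `|v x| `^ s2.
  rewrite /h -(powR_mulrn 2) ?powR_ge0// -powRrM; congr (_ `^ _).
  by rewrite /p /critical_exponent; field.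
have sh : sqint mu h.
  by split; [exact: mvp|apply: eq_Rintegrable iX => x; rewrite h2].
pose g i := moll (weak_partial i u) rho.
have sg i : sqint mu (g i) by have [] := moll_sqint (weak_partial_sqint i hu) mrho.
have sng i : sqint mu (fun x => `|g i x|).
  apply: (sqint_le _ (sg i)); last by move=> x; rewrite normr_id.
  by apply: measurableT_comp => //; exact: sqint_meas (sg i).
have gD i : \int[mu]_x `|g i x| ^+ 2 <= dirichlet u u.
  have [_ h1] := moll_sqint (weak_partial_sqint i hu) mrho.
  under eq_Rintegral do rewrite real_normK ?num_real//.
  by apply: (le_trans h1); exact: weak_partial_le_dirichlet.
have iJ i : Rintegrable mu (fun x => p * (h x * `|g i x|)).
  by apply: RintegrableZ; exact: sqint_mul.
have JE i : \int[mu]_x (p * (h x * `|g i x|)) <= p * Num.sqrt (X * dirichlet u u).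
  rewrite RintZ; last exact: sqint_mul.
  rewrite ler_wpM2l//; first by lra.
  apply: (le_trans (ler_norm _)); rewrite -sqrtr_sqr ler_sqrt; last first.
    by rewrite mulr_ge0.
  apply: (le_trans (cauchy_schwarz sh (sng i))).
  under eq_Rintegral do rewrite h2.
  by rewrite -/X ler_wpM2l.
have gi0 i x : 0 <= p * (h x * `|g i x|).
  apply: mulr_ge0; first by rewrite ltW// (lt_trans _ p2).
  by rewrite mulr_ge0 ?powR_ge0.
have := @gagliardo_nirenberg R n (fun x => `|v x| `^ p)
  (fun i x => p * (h x * `|g i x|)) (ltnW n3) (mvp p) (fun x => powR_ge0 _ _) (fun i => Rintegrable_meas (iJ i)) gi0.
have -> : (\int[lebesgue_rV n]_x ((`|v x| `^ p) `^ (a / (a - 1)))%:E)%E = X%:E.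
  rewrite /X -(EFin_Rintegral iX); apply: eq_integral => x _; rewrite -powRrM.
  congr (EFin (_ `^ _)); rewrite /p /critical_exponent.
  by field; rewrite a1 a2.
under [X in (_ -> _ <= X `^ _)%E -> _]eq_bigr do rewrite (EFin_Rintegral (iJ _)).
rewrite sumEFin poweR_EFin lee_fin => H.
apply: (le_trans (H _)).
  move=> i x; have [sw ww] := weak_partialP i hu.
  exact: moll_line_powR p2 su sw ww mrho.
apply: ge0_ler_powR; rewrite ?nnegrE.
- by rewrite divr_ge0//; have := a3; lra.
- by apply: sumr_ge0 => i _; apply: Rint_ge0 => x.
- rewrite -/p mulr_ge0 ?sqrtr_ge0// mulr_ge0//.
  by rewrite ltW// (lt_trans _ p2).
apply: (le_trans (ler_sum _ (fun i _ => JE i))).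
by rewrite sumr_const card_ord -[leLHS]mulr_natl [leLHS]mulrA.
Qed.

(** The bound for mollifications is independent of the scale. At scales [2 ^ - k] the squared L^2
    errors are summable, which gives convergence almost everywhere, and Fatou's lemma passes to
    [u]. *)
Lemma sobolev : exists2 S : R, 0 <= S & forall u : E -> R, H1 u ->
  Rintegrable mu (fun x => `|u x| `^ s2) /\
  \int[mu]_x `|u x| `^ s2 <= S * dirichlet u u `^ (a / (a - 2)).
Proof.
exists ((a * (2 * (a - 1) / (a - 2))) `^ s2); first exact: powR_ge0.
move=> u hu; have su := H1_sqint hu; have mmu := H1_meas hu.
have /choice[rho_ mrho] (k : nat) : exists rho : E -> R, mollifier ((2^-1) ^+ k) rho.
  by apply: mollifier_exists; rewrite exprn_gt0.
have sd k : sqint mu (fun x => moll u (rho_ k) x - u x).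
  by apply: sqintB => //; have [] := moll_sqint su (mrho k).
have D0 := dirichlet_ge0 u.
have hae : {ae mu, forall x, (moll u (rho_ k) x - u x) ^+ 2 @[k --> \oo] --> (0 : R)}.
  apply: (@ae_cvg0_of_summable _ _ _ mu (fun k x => (moll u (rho_ k) x - u x) ^+ 2)
    (a * dirichlet u u * 2)).
  - by move=> k; exact: sqint_int (sd k).
  - by move=> k x; exact: sqr_ge0.
  move=> k; apply: (@le_trans _ _ (\sum_(j < k) a * dirichlet u u * (2^-1) ^+ j)).
    apply: ler_sum => j _.
    apply: (le_trans (moll_approx _ hu (mrho j))); first by rewrite exprn_ge0.
    rewrite -mulrA (mulrC (_ ^+ 2)) mulrA ler_wpM2l ?mulr_ge0//.
    rewrite expr2 ler_piMl ?exprn_ge0// exprn_ile1//; lra.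
  by rewrite -mulr_sumr ler_wpM2l ?mulr_ge0// sum_half_le.
have [|||||iu bu _] := @Rint_fatou _ _ _ mu
  (fun k x => `|moll u (rho_ k) x| `^ s2) (fun x => `|u x| `^ s2)
  ((a * (2 * (a - 1) / (a - 2))) `^ s2 * dirichlet u u `^ (a / (a - 2))).
- by move=> k; have [] := moll_sobolev hu (mrho k).
- by move=> k x; exact: powR_ge0.
- exact: (measurableT_comp (measurable_abs_powR s2)).
- apply: filterS hae => x hx.
  have hx' : moll u (rho_ k) x @[k --> \oo] --> u x.
    apply/cvgrPdist_lt => e e0.
    move/cvgrPdist_lt : hx => /(_ (e ^+ 2)); rewrite exprn_gt0// => /(_ isT).
    apply: filterS => k; rewrite sub0r normrN ger0_norm ?sqr_ge0// => hk.
    rewrite distrC -(ltr_pXn2r (ltn0Sn 1)) ?nnegrE ?normr_ge0 ?(ltW e0)//.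
    by rewrite real_normK ?num_real.
  have s2p : 0 < s2 :> R by exact: lt_trans critical_exponent_gt2.
  have cp := @abs_powR_continuous R s2 s2p (u x).
  exact: (@cvg_comp _ _ _ _ (fun t => `|t| `^ s2) _ _ _ hx' cp).
- by move=> k; have [] := moll_sobolev hu (mrho k).
by split.
Qed.

End sobolev_inequality.

(** * The nonlinear term *)

Section primitive.
Context {R : realType}.
Variable f : R -> R.
Hypothesis cf : continuous f.
Local Notation lam := (@lebesgue_measure R).

Let int_itv (a b : R) : lam.-integrable `[a, b] (EFin \o f).
Proof.
apply: continuous_compact_integrable; first exact: segment_compact.
exact: continuous_subspaceT.
Qed.

Lemma Rint_itvB (a x b : R) : a <= x <= b ->
  \int[lam]_(t in `[a, b]) f t - \int[lam]_(t in `[a, x]) f t =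
  \int[lam]_(t in `[x, b]) f t.
Proof.
move=> /andP[ax xb]; rewrite Rintegral_itvB//.
rewrite Rintegral_itv_obnd_cbnd//; apply: integrableS (int_itv x b) => //.
by apply: subset_itvr; rewrite bnd_simp.
Qed.

Lemma primitive0 : primitive f 0 = 0.
Proof. by rewrite /primitive lexx set_itv1 Rintegral_set1. Qed.

(** Near [t] the primitive is [F s - F 0], where [F] integrates from a point [A] below both 0 and
    [t]; this covers both cases of its definition at once. *)
Lemma primitive_is_derive (t : R) : is_derive t 1 (primitive f) (f t).
Proof.
pose A := - `|t| - 1; pose B := `|t| + 1.
have /andP[tA tB] : A < t < B.
  rewrite /A /B; have := ler_norm t; have := ler_norm (- t); rewrite normrN.
  by move=> ? ?; apply/andP; split; lra.
have t0 := normr_ge0 t.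
have [A0 B0] : A < 0 /\ 0 < B by rewrite /A /B; split; lra.
have [d1 d2] := continuous_FTC1_closed tB (int_itv A B) tA (@cf t).
pose F s := \int[lam]_(x in `[A, s]) f x.
have dF : is_derive t 1 F (f t) by apply: (DeriveDef d1); rewrite -derive1E; exact: d2.
have dF' : is_derive t 1 (fun s => F s - F 0) (f t).
  by apply: (is_derive_val (is_deriveB dF (is_derive_cst (F 0) t 1))); rewrite subr0.
apply: near_eq_is_derive dF'; near=> s; rewrite /F /primitive.
have sA : A <= s by apply: ltW; near: s; exact: lt_nbhsr.
case: ifPn => s0; first by rewrite Rint_itvB// s0 ltW.
have {}s0 : s <= 0 by rewrite ltW// ltNge.
by rewrite -(@Rint_itvB A s 0) ?sA// opprB.
Unshelve. end_near. Qed.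

End primitive.

Section mixed_power.
Context {R : realType}.
Implicit Types (a b c e t p : R).

(** By the Sobolev inequality it is integrable along every [u] in H^1 when [p] is the critical
    exponent, so one growth function replaces the pair of spaces L^2 and L^p. [mixed_dpow] is the
    matching growth of a derivative. *)
Definition mixed_pow p t := t ^+ 2 + `|t| `^ p.

Definition mixed_dpow p t := `|t| + `|t| `^ (p - 1).

Section mixed_pow_lemmas.
Variable p : R.
Hypothesis p2 : 2 < p.
Local Notation Np := (mixed_pow p).
Local Notation Dp := (mixed_dpow p).

Lemma mixed_pow_ge0 t : 0 <= Np t.
Proof. by rewrite addr_ge0 ?sqr_ge0 ?powR_ge0. Qed.

Lemma mixed_dpow_ge0 t : 0 <= Dp t.
Proof. by rewrite addr_ge0 ?powR_ge0. Qed.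

Let p0 : p != 0.
Proof. by rewrite gt_eqF// (lt_trans _ p2). Qed.

Lemma mixed_pow_norm t : Np `|t| = Np t.
Proof. by rewrite /mixed_pow normr_id real_normK// num_real. Qed.

Lemma sqr_le_mixed_pow t : t ^+ 2 <= Np t.
Proof. by rewrite lerDl powR_ge0. Qed.

Lemma mixed_powE t : `|t| * Dp t = Np t.
Proof.
rewrite mulrDr mulr_powRB1//; first by rewrite -expr2 real_normK// num_real.
exact: lt_trans p2.
Qed.

Lemma mixed_pow_le a b : `|a| <= `|b| -> Np a <= Np b.
Proof.
move=> ab; apply: lerD.
  by rewrite -real_normK ?num_real// -[leRHS]real_normK ?num_real// lerXn2r.
by apply: ge0_ler_powR => //; rewrite ltW// (lt_trans _ p2).
Qed.

Lemma mixed_dpow_le a b : `|a| <= `|b| -> Dp a <= Dp b.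
Proof.
move=> ab; apply: lerD => //.
by apply: ge0_ler_powR => //; have := p2; lra.
Qed.

Lemma mixed_powZ c t : 0 <= c -> Np (c * t) <= (c ^+ 2 + c `^ p) * Np t.
Proof.
move=> c0; rewrite /mixed_pow exprMn normrM (ger0_norm c0) powRM// mulrDl !mulrDr.
have := powR_ge0 c p; have := powR_ge0 `|t| p; have := sqr_ge0 c; have := sqr_ge0 t.
move=> *; apply: lerD; rewrite ?lerDl ?lerDr mulr_ge0//.
Qed.

Lemma mixed_powZ_le1 c t : 0 <= c <= 1 -> Np (c * t) <= c ^+ 2 * Np t.
Proof.
move=> /andP[c0 c1]; rewrite /mixed_pow exprMn normrM (ger0_norm c0) powRM// mulrDr.
rewrite lerD2l ler_wpM2r ?powR_ge0//.
have [->|cn0] := eqVneq c 0; first by rewrite powR0// expr0n.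
rewrite -(powR_mulrn 2)//; apply: ger_powR; last exact: ltW.
by rewrite c1 lt_neqAle eq_sym cn0 c0.
Qed.

Lemma mixed_powD a b : Np (a + b) <= (4 + 2 `^ p) * (Np a + Np b).
Proof.
have c4 : 2 ^+ 2 = 4 :> R by rewrite -natrX.
wlog ab : a b / `|a| <= `|b| => [H|].
  have [/H//|/ltW/H] := leP `|a| `|b|; by rewrite addrC [X in _ * X]addrC.
apply: (@le_trans _ _ (Np (2 * b))).
  apply: mixed_pow_le; rewrite normrM (ger0_norm (ler0n _ _)).
  by rewrite (le_trans (ler_normD _ _))// mulr_natl mulr2n lerD2r.
apply: (le_trans (@mixed_powZ 2 b _)) => //.
rewrite c4 ler_wpM2l ?addr_ge0 ?powR_ge0//.
by rewrite lerDr mixed_pow_ge0.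
Qed.

(** Either [|a| <= e |b|], and [|b| * Dp b = Np b] finishes, or [|b| < |a| / e] and everything is
    bounded in terms of [a]. [young_mixedr] puts the small coefficient on the other term. *)
Lemma young_mixedl e : 0 < e -> exists2 C, 0 <= C &
  forall a b, `|a| * Dp b <= e * Np b + C * Np a.
Proof.
move=> e0; exists (e * (e^-1 ^+ 2 + e^-1 `^ p)).
  by rewrite mulr_ge0 ?ltW// addr_gt0 ?powR_gt0 ?exprn_gt0 ?invr_gt0.
move=> a b; have Na := mixed_pow_ge0 a; have Nb := mixed_pow_ge0 b.
have ei : 0 <= e^-1 by rewrite invr_ge0 ltW.
have [ab|/ltW ab] := leP `|a| (e * `|b|).
  rewrite -[leLHS]addr0; apply: lerD.
    by rewrite -mixed_powE mulrA ler_wpM2r// mixed_dpow_ge0.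
  by rewrite mulr_ge0// mulr_ge0 ?(ltW e0)// addr_ge0 ?exprn_ge0 ?powR_ge0.
rewrite -[leLHS]add0r; apply: lerD; first by rewrite mulr_ge0// ltW.
rewrite -mulrA; apply: (@le_trans _ _ (e * Np (e^-1 * a))); last first.
  by rewrite ler_wpM2l ?(ltW e0)//; exact: mixed_powZ.
rewrite -mixed_powE normrM (ger0_norm ei) mulrA mulrA divff ?gt_eqF// mul1r.
rewrite ler_wpM2l//; apply: mixed_dpow_le; rewrite normrM (ger0_norm ei).
by rewrite mulrC ler_pdivlMr// mulrC.
Qed.

Lemma young_mixedr e : 0 < e -> exists2 C, 0 <= C &
  forall a b, `|a| * Dp b <= e * Np a + C * Np b.
Proof.
(* Capping at 1 gives [c ^ (p - 1) <= c]. *)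
move=> e0; pose c := Num.min e 1; have c0 : 0 < c by rewrite lt_min e0 ltr01.
have c1 : c <= 1 by rewrite ge_min lexx orbT.
have ce : c <= e by rewrite ge_min lexx.
exists c^-1; first by rewrite invr_ge0 ltW.
move=> a b; have Na := mixed_pow_ge0 a; have Nb := mixed_pow_ge0 b.
have [ab|/ltW ab] := leP `|b| (c * `|a|).
  rewrite -[leLHS]addr0; apply: lerD; last by rewrite mulr_ge0// invr_ge0 ltW.
  rewrite -(mixed_powE a) mulrCA ler_wpM2l//.
  apply: (@le_trans _ _ (c * Dp a)); last by rewrite ler_wpM2r// mixed_dpow_ge0.
  apply: (@le_trans _ _ (Dp (c * a))).
    by apply: mixed_dpow_le; rewrite normrM (gtr0_norm c0).
  rewrite /mixed_dpow normrM (gtr0_norm c0) powRM// ?(ltW c0)// mulrDr lerD2l.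
  rewrite ler_wpM2r ?powR_ge0//; apply: ge1r_powR; first by rewrite c0.
  by have := p2; lra.
rewrite -[leLHS]add0r; apply: lerD; first by rewrite mulr_ge0// ltW.
rewrite -(mixed_powE b) mulrA ler_wpM2r ?mixed_dpow_ge0//.
by rewrite mulrC ler_pdivlMr// mulrC.
Qed.

Lemma mixed_pow_continuous : continuous Np.
Proof.
move=> t; apply: (@continuousD R R R (fun t => t ^+ 2) (fun t => `|t| `^ p)).
  exact: exprn_continuous.
by apply: abs_powR_continuous; exact: lt_trans p2.
Qed.

End mixed_pow_lemmas.
End mixed_power.

(** * Integral functionals under mixed growth *)

Section nemytskii.
Context {R : realType}.
Variables (p C : R) (g G : R -> R).
Hypotheses (p2 : 2 < p) (C0 : 0 <= C) (cg : continuous g) (G0 : G 0 = 0).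
Hypothesis dG : forall t : R, is_derive t 1 G (g t).
Hypothesis hg : forall t, `|g t| <= C * mixed_dpow p t.
Local Notation Np := (mixed_pow p).
Local Notation Dp := (mixed_dpow p).

Lemma nem_continuous : continuous G.
Proof.
move=> t; apply: differentiable_continuous.
by apply/derivable1_diffP; have [] := dG t.
Qed.

Lemma nem_mvt (a b : R) : exists2 c, `|c| <= `|a| + `|b| & G (a + b) - G b = g c * a.
Proof.
have main (x y : R) : x <= y -> exists2 c, x <= c <= y & G y - G x = g c * (y - x).
  move=> xy; have [|c] := @MVT_segment R G g x y xy (fun z _ => dG z).
    exact: continuous_subspaceT nem_continuous.
  by rewrite in_itv/=; exists c.
have bn := ler_norm b; have bN := ler_norm (- b); rewrite normrN in bN.
have an := ler_norm a; have aN := ler_norm (- a); rewrite normrN in aN.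
have [a0|/ltW a0] := leP 0 a.
  have [|c /andP[bc cb] cE] := main b (a + b); first by lra.
  by exists c; [rewrite ler_norml; apply/andP; split; lra|rewrite cE addrK].
have [|c /andP[bc cb] cE] := main (a + b) b; first by lra.
exists c; first by rewrite ler_norml; apply/andP; split; lra.
by rewrite -opprB cE; ring.
Qed.

Lemma nem_diff_le (a b : R) :
  `|G (a + b) - G b| <= C * (`|a| * Dp (`|a| + `|b|)).
Proof.
have [c cab ->] := nem_mvt a b; rewrite normrM mulrC mulrCA ler_wpM2l//.
apply: (le_trans (hg c)); rewrite ler_wpM2l//; apply: mixed_dpow_le => //.
by rewrite (le_trans cab)// ler_norm.
Qed.

Lemma nem_le (t : R) : `|G t| <= C * Np t.
Proof.
have := nem_diff_le t 0; rewrite addr0 G0 subr0 normr0 addr0.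
by rewrite -(mixed_powE p2) /mixed_dpow normr_id.
Qed.

(** The pointwise condition behind the Brezis-Lieb splitting: the growth of [b], whose integral will
    only stay bounded, gets an arbitrarily small coefficient. *)
Lemma nem_split (e : R) : 0 < e -> exists2 K, 0 <= K &
  forall a b, `|G (a + b) - G b| <= e * Np b + K * Np a.
Proof.
move=> e0; pose c := 4 + 2 `^ p : R.
have c0 : 0 < c by rewrite ltr_wpDr ?powR_ge0.
have C1 : 0 < C + 1 by rewrite ltr_wpDl.
pose e' := e / ((C + 1) * c); have e'0 : 0 < e' by rewrite divr_gt0// mulr_gt0.
have [K K0 hK] := young_mixedl p2 e'0.
exists (e + (C + 1) * K); first by rewrite addr_ge0 ?mulr_ge0// ltW.
move=> a b; have Na := mixed_pow_ge0 p a; have Nb := mixed_pow_ge0 p b.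
apply: (le_trans (nem_diff_le a b)).
apply: (@le_trans _ _ ((C + 1) * (e' * (c * (Np a + Np b)) + K * Np a))).
  apply: ler_pM => //; rewrite ?mulr_ge0 ?mixed_dpow_ge0 ?lerDl//.
  apply: (le_trans (hK a (`|a| + `|b|))); rewrite lerD2r ler_wpM2l ?(ltW e'0)//.
  apply: (le_trans (mixed_powD p2 `|a| `|b|)).
  by rewrite !mixed_pow_norm.
have -> : (C + 1) * (e' * (c * (Np a + Np b)) + K * Np a) =
    e * (Np a + Np b) + (C + 1) * K * Np a.
  by rewrite /e'; field; rewrite !gt_eqF.
lra.
Qed.

Lemma nem_derive (t e : R) : 0 < e -> exists2 r, 0 < r & forall h, `|h| < r ->
  `|G (h + t) - G t - g t * h| <= e * `|h|.
Proof.
move=> e0; have /is_deriveP/cvgrPdist_lt/(_ e e0) := dG t.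
move=> -[r/= r0 hr]; exists r => // h hr'.
have [->|h0] := eqVneq h 0; first by rewrite add0r subrr mulr0 subrr normr0 mulr0.
have := hr h; rewrite /ball_/= sub0r normrN => /(_ hr' h0); rewrite [h%:A]mulr1 => /ltW.
have -> : G (h + t) - G t - g t * h = - (g t - h^-1 *: (G (h + t) - G t)) * h.
  rewrite /GRing.scale/=; by field.
by rewrite normrM normrN => hh; rewrite ler_wpM2r.
Qed.

Section integral.
Context d (T : measurableType d).
Variable mu : {measure set T -> \bar R}.
Local Notation Int := (Rintegrable mu).

Definition mixed_class (u : T -> R) :=
  measurable_fun setT u /\ Int (fun x => Np (u x)).

Lemma nem_meas (u : T -> R) : measurable_fun setT u ->
  measurable_fun setT (fun x => G (u x)).
Proof.
by apply: measurableT_comp; apply: continuous_measurable_fun; exact: nem_continuous.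
Qed.

Lemma nem_integrable (u : T -> R) : mixed_class u -> Int (fun x => G (u x)).
Proof.
move=> [mu' iu]; apply: (Rintegrable_le (nem_meas mu') (RintegrableZ C iu)) => x.
exact: nem_le.
Qed.

Lemma mixed_meas (u : T -> R) : measurable_fun setT u ->
  measurable_fun setT (fun x => Np (u x)).
Proof.
apply: measurableT_comp; apply: continuous_measurable_fun.
exact: mixed_pow_continuous.
Qed.

Lemma mixed_classD (u v : T -> R) : mixed_class u -> mixed_class v ->
  mixed_class (fun x => u x + v x).
Proof.
move=> [mu' iu] [mv iv]; have muv := measurable_funD mu' mv; split => //.
apply: (Rintegrable_le (mixed_meas muv)
  (RintegrableZ (4 + 2 `^ p) (RintegrableD iu iv))) => x.
by rewrite ger0_norm ?mixed_pow_ge0//; exact: mixed_powD.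
Qed.

Lemma nem_deriv_integrable (u h : T -> R) : mixed_class u -> mixed_class h ->
  Int (fun x => g (u x) * h x).
Proof.
move=> [mu' iu] [mh ih]; have [K K0 hK] := young_mixedl p2 ltr01.
apply: (Rintegrable_le _ (RintegrableZ C (RintegrableD iu (RintegrableZ K ih)))).
  apply: measurable_funM => //; apply: measurableT_comp => //.
  exact: continuous_measurable_fun.
move=> x; rewrite normrM; apply: (@le_trans _ _ (C * (`|h x| * Dp (u x)))).
  by rewrite mulrCA mulrC ler_wpM2l//; exact: hg.
rewrite ler_wpM2l//; apply: (le_trans (hK _ _)); by rewrite mul1r.
Qed.

(* Dominated convergence for the positive part of [|D_ n| - e * B_ n]. *)
Lemma Rint_excess_near (D_ B_ : (T -> R)^nat) (Q : T -> R) (M e : R) : 0 < e ->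
  (forall n, Int (D_ n)) -> (forall n, Int (B_ n)) -> Int Q ->
  (forall n, \int[mu]_x B_ n x <= M) ->
  {ae mu, forall x, forall n, `|D_ n x| <= e * B_ n x + Q x} ->
  {ae mu, forall x, forall r, 0 < r -> \forall n \near \oo,
    `|D_ n x| <= e * B_ n x + r} ->
  \forall n \near \oo, `|\int[mu]_x D_ n x| <= e * (M + 1).
Proof.
move=> e0 iD iB iQ BM hQ hD.
pose z n x := `|D_ n x| - e * B_ n x; pose phi n x := 2^-1 * (`|z n x| + z n x).
have iz n : Int (z n).
  by apply: RintegrableB; [exact: Rintegrable_abs|exact: RintegrableZ].
have iphi n : Int (phi n).
  by apply: RintegrableZ; apply: RintegrableD => //; exact: Rintegrable_abs.
have phiP n x (q : R) : 0 <= q -> z n x <= q -> `|phi n x| <= q.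
  move=> q0 zq; have := ler_norm (z n x); have := ler_norm (- z n x).
  rewrite normrN => h1 h2.
  rewrite ger0_norm /phi; last by lra.
  by have [h|h] := leP 0 (z n x); [rewrite ger0_norm//|rewrite ltr0_norm//]; lra.
have zphi n x : z n x <= phi n x by have := ler_norm (z n x); rewrite /phi; lra.
have [|||||_ cphi] := @Rint_dominated _ _ _ mu phi (fun=> 0) (fun x => `|Q x|).
- by move=> n; exact: Rintegrable_meas (iphi n).
- exact: measurable_cst.
- apply: filterS hD => x hx; apply/cvgr0Pnorm_lt => r r0.
  have r2 : 0 < r / 2 by rewrite divr_gt0.
  apply: filterS (hx _ r2) => n hn.
  apply: (@le_lt_trans _ _ (r / 2)); last by lra.
  by apply: phiP; [exact: ltW|rewrite /z lerBlDl].
- exact: Rintegrable_abs.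
- apply: filterS hQ => x hx n; apply: phiP => //.
  by rewrite /z lerBlDl (le_trans (hx n))// lerD2l ler_norm.
rewrite Rint_cst0 in cphi.
move/cvgr0Pnorm_lt : cphi => /(_ e e0); apply: filterS => n hn.
apply: (le_trans (Rint_norm (iD n))).
have -> : \int[mu]_x `|D_ n x| = \int[mu]_x z n x + e * \int[mu]_x B_ n x.
  rewrite -RintZ// -RintD//; last exact: RintegrableZ.
  by apply: eq_Rintegral => x _; rewrite /z subrK.
rewrite mulrDr mulr1 [leRHS]addrC; apply: lerD; last first.
  by rewrite ler_wpM2l// ltW.
apply: (le_trans (Rint_le (iz n) (iphi n) (zphi n))).
exact: le_trans (ler_norm _) (ltW hn).
Qed.

(** [Rint_excess_near] for the splitting defect [D_]: [nem_split] bounds it by [e'] times the growth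
    of [v_n], whose integrals stay below [M], plus a fixed integrable function of [u], and it tends
    to 0 almost everywhere. *)
Lemma brezis_lieb (u : T -> R) (v_ : (T -> R)^nat) (M : R) :
  mixed_class u -> (forall n, mixed_class (v_ n)) ->
  (forall n, \int[mu]_x Np (v_ n x) <= M) ->
  {ae mu, forall x, v_ ^~ x @ \oo --> (0 : R)} ->
  \int[mu]_x G (u x + v_ n x) - \int[mu]_x G (v_ n x) @[n --> \oo] -->
    \int[mu]_x G (u x).
Proof.
move=> mcu mcv vM v0.
have iu := nem_integrable mcu; have iv n := nem_integrable (mcv n).
have iuv n := nem_integrable (mixed_classD mcu (mcv n)).
pose D_ n x := G (u x + v_ n x) - G (v_ n x) - G (u x).
have iD n : Int (D_ n) by apply: RintegrableB => //; exact: RintegrableB.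
have M0 : 0 <= M.
  by apply: le_trans (vM 0%N); apply: Rint_ge0 => x; exact: mixed_pow_ge0.
apply/cvgrPdist_le => e e0; pose e' := e / (M + 1).
have M1 : 0 < M + 1 by rewrite ltr_wpDl.
have e'0 : 0 < e' by rewrite divr_gt0.
have [K K0 hK] := nem_split e'0.
have := @Rint_excess_near D_ (fun n x => Np (v_ n x))
  (fun x => K * Np (u x) + C * Np (u x)) M e' e'0 iD (fun n => (mcv n).2).
have <- : e = e' * (M + 1) by rewrite /e' divfK// gt_eqF.
move=> /(_ _ vM) H.
have : \forall n \near \oo, `|\int[mu]_x D_ n x| <= e.
  apply: H.
  - by apply: RintegrableD; apply: RintegrableZ; exact: mcu.2.
  - apply: nearW => x n; rewrite addrA; apply: (le_trans (ler_normB _ _)).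
    by apply: lerD; [exact: hK|exact: nem_le].
  - apply: filterS v0 => x vx r r0.
    have cD : D_ n x @[n --> \oo] --> G (u x + 0) - G 0 - G (u x).
      apply: cvgB; last exact: cvg_cst.
      apply: cvgB.
        have h : u x + v_ n x @[n --> \oo] --> u x + 0.
          by apply: cvgD => //; exact: cvg_cst.
        exact: (@cvg_comp _ _ _ _ G _ _ _ h (@nem_continuous _)).
      exact: (@cvg_comp _ _ _ _ G _ _ _ vx (@nem_continuous _)).
    rewrite addr0 G0 subr0 subrr in cD.
    move/cvgr0Pnorm_le : cD => /(_ r r0); apply: filterS => n /le_trans; apply.
    by rewrite lerDr mulr_ge0 ?mixed_pow_ge0// ltW.
apply: filterS => n; rewrite distrC.
by rewrite /D_ RintB// ?RintB//; exact: RintegrableB.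
Qed.

(** The remainder divided by [t_n] is at most a small multiple of the growth of [h_n / t_n], whose
    integrals stay bounded, plus a multiple of the growths of [h_n] and [u]. As [t_n] is
    geometrically small, the growths of [h_n] have summable integrals; this provides a common
    majorant and the convergence of [h_n] to 0 almost everywhere. *)
Lemma nem_frechet_seq (u : T -> R) (h_ : (T -> R)^nat) (t_ : R^nat) (S e : R) :
  mixed_class u -> (forall n, measurable_fun setT (h_ n)) ->
  (forall n, 0 < t_ n <= (2^-1) ^+ n) ->
  (forall n, Int (fun x => Np ((t_ n)^-1 * h_ n x)) /\
     \int[mu]_x Np ((t_ n)^-1 * h_ n x) <= S) -> 0 < e ->
  \forall n \near \oo, `|\int[mu]_x G (h_ n x + u x) - \int[mu]_x G (u x) -
    \int[mu]_x (g (u x) * h_ n x)| <= e * t_ n.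
Proof.
move=> mcu mh ht hS e0.
have t0 n : 0 < t_ n by have /andP[] := ht n.
have t1 n : t_ n <= 1.
  have /andP[_ /le_trans] := ht n; apply; rewrite exprn_ile1//; lra.
have S0 : 0 <= S.
  by apply: le_trans (hS 0%N).2; apply: Rint_ge0 => x; exact: mixed_pow_ge0.
pose w n x := (t_ n)^-1 * h_ n x.
have hE n x : h_ n x = t_ n * w n x by rewrite /w mulVKf// gt_eqF.
have Nh n x : Np (h_ n x) <= t_ n ^+ 2 * Np (w n x).
  by rewrite {1}hE; apply: mixed_powZ_le1; rewrite ?t1 ?andbT ?ltW.
have mch n : mixed_class (h_ n).
  split => //; apply: (Rintegrable_le (mixed_meas (mh n))
    (RintegrableZ (t_ n ^+ 2) (hS n).1)) => x.
  by rewrite ger0_norm ?mixed_pow_ge0//; exact: Nh.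
have hsum n : \sum_(k < n) \int[mu]_x Np (h_ k x) <= S * 2.
  apply: (@le_trans _ _ (\sum_(k < n) S * (2^-1) ^+ k)); last first.
    by rewrite -mulr_sumr ler_wpM2l// sum_half_le.
  apply: ler_sum => k _.
  apply: (@le_trans _ _ (\int[mu]_x (t_ k ^+ 2 * Np (w k x)))).
    by apply: Rint_le; [exact: (mch k).2|apply: RintegrableZ; exact: (hS k).1|].
  rewrite RintZ; last exact: (hS k).1.
  rewrite mulrC; apply: ler_pM; rewrite ?sqr_ge0 ?(hS k).2//.
    by apply: Rint_ge0 => x; exact: mixed_pow_ge0.
  have /andP[_ tk] := ht k; apply: le_trans tk.
  by rewrite expr2 ler_piMl// ltW.
have Nh0 n x : 0 <= Np (h_ n x) by exact: mixed_pow_ge0.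
have [Q [iQ Q0 _ hQ]] := Rint_series (fun n => (mch n).2) Nh0 hsum.
have hN0 := ae_cvg0_of_summable (fun n => (mch n).2) Nh0 hsum.
pose D_ n x := (t_ n)^-1 * (G (h_ n x + u x) - G (u x) - g (u x) * h_ n x).
have iGh n : Int (fun x => G (h_ n x + u x)).
  exact: nem_integrable (mixed_classD (mch n) mcu).
have iG := nem_integrable mcu; have igh n := nem_deriv_integrable mcu (mch n).
have iD n : Int (D_ n).
  by apply: RintegrableZ; apply: RintegrableB => //; exact: RintegrableB.
pose e' := e / (S + 1); have S1 : 0 < S + 1 by rewrite ltr_wpDl.
have e'0 : 0 < e' by rewrite divr_gt0.
have C21 : 0 < 2 * C + 1 by rewrite ltr_wpDl// mulr_ge0.
pose e2 := e' / (2 * C + 1); have e20 : 0 < e2 by rewrite divr_gt0.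
have [K K0 hK] := young_mixedr p2 e20; pose c := 4 + 2 `^ p : R.
have c0 : 0 <= c by rewrite addr_ge0// powR_ge0.
have Dle n x : `|D_ n x| <= e' * Np (w n x) +
    (2 * C + 1) * K * c * (Np (h_ n x) + Np (u x)).
  rewrite /D_ normrM gtr0_norm ?invr_gt0//.
  have step : `|G (h_ n x + u x) - G (u x) - g (u x) * h_ n x| <=
      (2 * C) * (`|h_ n x| * Dp (`|h_ n x| + `|u x|)).
    apply: (le_trans (ler_normB _ _)).
    have -> : 2 * C * (`|h_ n x| * Dp (`|h_ n x| + `|u x|)) =
      C * (`|h_ n x| * Dp (`|h_ n x| + `|u x|)) +
      C * (`|h_ n x| * Dp (`|h_ n x| + `|u x|)) by ring.
    apply: lerD; first exact: nem_diff_le.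
    rewrite normrM mulrC mulrCA ler_wpM2l//; apply: (le_trans (hg _)).
    rewrite ler_wpM2l//; apply: mixed_dpow_le => //.
    by rewrite [leRHS]ger0_norm ?addr_ge0// lerDr.
  apply: (@le_trans _ _ ((2 * C) * (`|w n x| * Dp (`|h_ n x| + `|u x|)))).
    rewrite mulrC ler_pdivrMr// (le_trans step)//.
    rewrite {1}hE normrM (gtr0_norm (t0 n)); 
    by rewrite le_eqVlt; apply/orP; left; apply/eqP; ring.
  apply: (@le_trans _ _ ((2 * C + 1) * (e2 * Np (w n x) + K * (c * (Np (h_ n x) + Np (u x)))))).
    apply: ler_pM; rewrite ?mulr_ge0 ?mixed_dpow_ge0 ?lerDl//.
    apply: (le_trans (hK _ _)); rewrite lerD2l ler_wpM2l//.
    by apply: (le_trans (mixed_powD p2 _ _)); rewrite !mixed_pow_norm.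
  rewrite mulrDr [X in X + _ <= _]mulrA (_ : (2 * C + 1) * e2 = e'); last first.
    by rewrite /e2 mulrC divfK// gt_eqF.
  by rewrite lerD2l !mulrA.
have := @Rint_excess_near D_ (fun n x => Np (w n x))
  (fun x => (2 * C + 1) * K * c * (Q x + Np (u x))) S e' e'0 iD (fun n => (hS n).1).
have <- : e = e' * (S + 1) by rewrite /e' divfK// gt_eqF.
move=> /(_ _ (fun n => (hS n).2)) H.
have : \forall n \near \oo, `|\int[mu]_x D_ n x| <= e.
  apply: H.
  - by apply: RintegrableZ; apply: RintegrableD => //; exact: mcu.2.
  - apply: filterS hQ => x hx n; apply: (le_trans (Dle n x)); rewrite lerD2l.
    rewrite ler_wpM2l ?mulr_ge0// ?(ltW C21)// lerD2r; apply: le_trans (hx n.+1).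
    by rewrite big_ord_recr/= lerDr sumr_ge0.
  - apply: filterS hN0 => x hx r r0.
    (* Chosen so that [dl y <= e' y^2 + r] for all [y]. *)
    pose dl := Num.sqrt (e' * r); have dl0 : 0 < dl by rewrite sqrtr_gt0 mulr_gt0.
    have [rr rr0 hr] := nem_derive (u x) dl0.
    have rr2 : 0 < rr ^+ 2 by rewrite exprn_gt0.
    move/cvgr0Pnorm_lt : hx => /(_ _ rr2); apply: filterS => n hn.
    have hnr : `|h_ n x| < rr.
      rewrite -(ltr_pXn2r (ltn0Sn 1)) ?nnegrE ?normr_ge0 ?(ltW rr0)//.
      rewrite real_normK ?num_real//; apply: le_lt_trans hn.
      by rewrite ger0_norm ?mixed_pow_ge0// sqr_le_mixed_pow.
    rewrite /D_ normrM gtr0_norm ?invr_gt0//.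
    apply: (@le_trans _ _ (dl * `|w n x|)).
      rewrite mulrC ler_pdivrMr// (le_trans (hr _ hnr))//.
      by rewrite {1}hE normrM (gtr0_norm (t0 n)) mulrCA mulrC.
    apply: (@le_trans _ _ (e' * `|w n x| ^+ 2 + r)); last first.
      rewrite lerD2r ler_wpM2l ?(ltW e'0)// real_normK ?num_real//.
      exact: sqr_le_mixed_pow.
    have dlE : dl ^+ 2 = e' * r by rewrite sqr_sqrtr// mulr_ge0// ltW.
    have := normr_ge0 (w n x); set y := `|w n x| => y0.
    rewrite -(ler_pM2l e'0) mulrDr -dlE.
    have := sqr_ge0 (2 * e' * y - dl); have := sqr_ge0 dl.
    by rewrite !expr2; nra.
apply: filterS => n; rewrite /D_ RintZ; last first.
  by apply: RintegrableB => //; exact: RintegrableB.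
rewrite RintB//; last exact: RintegrableB.
rewrite RintB// normrM gtr0_norm ?invr_gt0// mulrC ler_pdivrMr//.
Qed.

End integral.
End nemytskii.

(** * Growth of the nonlinearity and of its primitive *)

Section growth.
Context {R : realType}.
Variables (f : R -> R) (p : R).
Hypotheses (p2 : 2 < p) (cf : continuous f).
Hypothesis hf_growth : exists2 C0 : R, 0 < C0 &
  forall t : R, `|f t| <= C0 * (1 + `|t| `^ (p - 1)).
Hypothesis hf_zero : f t / t @[t --> (0 : R)^'] --> (0 : R).
Hypothesis hf_pinfty : `|f t| / `|t| `^ (p - 1) @[t --> +oo] --> (0 : R).
Hypothesis hf_ninfty : `|f t| / `|t| `^ (p - 1) @[t --> -oo] --> (0 : R).

Lemma growth_f0 : f 0 = 0.
Proof.
have h1 : f t @[t --> (0 : R)^'] --> f 0.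
  by apply: cvg_trans (@cf 0); apply: cvg_app; exact: nbhs_dnbhs.
have h2 : f t @[t --> (0 : R)^'] --> (0 : R) * 0.
  have h : f t / t * t @[t --> (0 : R)^'] --> (0 : R) * 0.
    by apply: cvgM => //; exact: nbhs_dnbhs.
  apply: cvg_trans h; apply: near_eq_cvg; near=> t.
  by rewrite divfK//; near: t; exact: nbhs_dnbhs_neq.
by rewrite mulr0 in h2; apply: (cvg_unique _ h1 h2); exact: Rhausdorff.
Unshelve. end_near. Qed.

Lemma growth_zero (e : R) : 0 < e -> exists2 d, 0 < d &
  forall t, `|t| < d -> `|f t| <= e * `|t|.
Proof.
move=> e0; move/cvgr0Pnorm_lt : hf_zero => /(_ e e0)[d/= d0 hd].
exists d => // t td; have [->|t0] := eqVneq t 0.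
  by rewrite growth_f0 normr0 mulr0.
have := hd t; rewrite /ball_/= sub0r normrN => /(_ td t0) /ltW.
by rewrite normrM normfV ler_pdivrMr ?normr_gt0.
Qed.

Lemma growth_infty (e : R) : 0 < e -> exists2 K, 0 <= K &
  forall t, K < `|t| -> `|f t| <= e * `|t| `^ (p - 1).
Proof.
move=> e0; move/cvgr0Pnorm_lt : hf_pinfty => /(_ e e0)[M1 [_ h1]].
move/cvgr0Pnorm_lt : hf_ninfty => /(_ e e0)[M2 [_ h2]].
exists (Num.max 0 (Num.max M1 (- M2))); first by rewrite le_max lexx.
move=> t; rewrite !gt_max => /and3P[t0 tM1 tM2].
have tp : 0 < `|t| `^ (p - 1) by rewrite powR_gt0.
have key : `| `|f t| / `|t| `^ (p - 1)| < e -> `|f t| <= e * `|t| `^ (p - 1).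
  rewrite normrM normr_id normfV (gtr0_norm tp) => /ltW.
  by rewrite ler_pdivrMr.
have [tt|tt] := leP 0 t; first by apply/key/h1; move: tM1; rewrite ger0_norm.
by apply/key/h2; move: tM2; rewrite ltr0_norm// ltrN2.
Qed.

Lemma growth_global : exists2 C, 0 <= C & forall t, `|f t| <= C * mixed_dpow p t.
Proof.
have [C0 C00 hC] := hf_growth; have [d d0 hd] := growth_zero ltr01.
(* Below [d] the linear bound at 0 applies; beyond [d] the constant [C0] is at most
   [C0 / d * |t|]. *)
exists (1 + C0 + C0 / d); first by rewrite !addr_ge0 ?divr_ge0// ltW.
move=> t; have tp : 0 <= `|t| `^ (p - 1) by exact: powR_ge0.
have t0 := normr_ge0 t; have C0d : 0 <= C0 / d by rewrite divr_ge0// ltW.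
have h1 := mulr_ge0 (ltW C00) t0; have h2 := mulr_ge0 C0d tp.
have h3 := mulr_ge0 (ltW C00) tp; have h4 := mulr_ge0 C0d t0.
rewrite /mixed_dpow mulrDr !mulrDl !mul1r; have [td|td] := ltP `|t| d.
  by apply: (le_trans (hd t td)); lra.
apply: (le_trans (hC t)).
have : C0 <= C0 / d * `|t| by rewrite mulrAC ler_pdivlMr// ler_wpM2l// ltW.
rewrite mulrDr mulr1; lra.
Qed.

Lemma primitive_mvt (t : R) : exists2 c, `|c| <= `|t| & primitive f t = f c * t.
Proof.
have [c] := nem_mvt (primitive_is_derive cf) t 0.
by rewrite addr0 normr0 addr0 primitive0 subr0; exists c.
Qed.

(** The smallness of [f] at 0 and at infinity is relative to the two terms of [mixed_pow]; what
    remains is a bounded amount, paid only where [|t| >= d]. This localisation later bounds from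
    below the measure of the set where a function is large. *)
Lemma primitive_small (e : R) : 0 < e -> exists2 d : R, 0 < d &
  exists2 K : R, 0 <= K &
  forall t, `|primitive f t| <= e * mixed_pow p t + K * (d <= `|t|)%R%:R.
Proof.
move=> e0; have [d d0 hd] := growth_zero e0; exists d => //.
have [K K0 hK] := growth_infty e0; have [C C0 hC] := growth_global.
(* [M] bounds [|f|] on [[- K, K]]; the resulting term [M |t|] is at most [e t^2 + M^2 / e]. *)
pose M := C * mixed_dpow p K; have M0 : 0 <= M by rewrite mulr_ge0 ?mixed_dpow_ge0.
exists (M ^+ 2 / e); first by rewrite divr_ge0 ?sqr_ge0// ltW.
move=> t; have [c ct ->] := primitive_mvt t; rewrite normrM.
have tp := powR_ge0 `|t| p.
have [td|td] := ltP `|t| d.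
  rewrite mulr0 addr0 /mixed_pow mulrDr -[leLHS]addr0; apply: lerD; last first.
    by rewrite mulr_ge0// ltW.
  rewrite -[t ^+ 2]real_normK ?num_real// expr2 mulrA ler_wpM2r//.
  apply: (le_trans (hd c _)); first exact: le_lt_trans td.
  by rewrite ler_wpM2l// ltW.
rewrite mulr1.
have fc : `|f c| <= e * `|t| `^ (p - 1) + M.
  have [cK|cK] := ltP K `|c|.
    rewrite -[leLHS]addr0; apply: lerD => //; apply: (le_trans (hK c cK)).
    rewrite ler_wpM2l ?(ltW e0)//; apply: ge0_ler_powR => //; have := p2; lra.
  rewrite -[leLHS]add0r; apply: lerD; first by rewrite mulr_ge0 ?powR_ge0// ltW.
  apply: (le_trans (hC c)); rewrite ler_wpM2l//; apply: mixed_dpow_le => //.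
  by rewrite (ger0_norm K0).
apply: (le_trans (ler_wpM2r (normr_ge0 t) fc)); rewrite mulrDl -mulrA.
rewrite [_ `^ _ * _]mulrC mulr_powRB1//; last exact: lt_trans p2.
rewrite /mixed_pow mulrDr [X in _ <= X + _]addrC -addrA lerD2l.
rewrite -[t ^+ 2]real_normK ?num_real//.
rewrite -(ler_pM2r e0) mulrDl divfK ?gt_eqF//.
have := sqr_ge0 (2 * (e * `|t|) - M); have := sqr_ge0 M.
by rewrite !expr2; nra.
Qed.

End growth.

(** * Differentiability and local compactness *)

Section H1_nemytskii.
Context {R : realType} {n : nat} (n3 : (3 <= n)%N).
Local Notation E := 'rV[R]_n.
Local Notation mu := (lebesgue_rV n : {sigma_finite_measure set E -> \bar R}).
Local Notation a := n%:R.
Local Notation p := (critical_exponent n : R).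
Local Notation Np := (mixed_pow p).
Let p2 : 2 < p := critical_exponent_gt2 n3.

Let a3 : 3 <= a :> R.
Proof. by rewrite ler_nat. Qed.

Lemma H1_mixed : exists2 S : R, 0 <= S & forall u : E -> R, H1 u ->
  [/\ mixed_class p mu u, Rintegrable mu (fun x => `|u x| `^ p),
      \int[mu]_x `|u x| `^ p <= S * dirichlet u u `^ (a / (a - 2)) &
      \int[mu]_x Np (u x) = \int[mu]_x u x ^+ 2 + \int[mu]_x `|u x| `^ p].
Proof.
have [S S0 hS] := @sobolev R n n3; exists S => // u hu.
have [iu bu] := hS u hu; have [mmu u2] := H1_sqint hu; split => //.
  by split => //; exact: RintegrableD.
by rewrite RintD.
Qed.

Lemma H1_mixed_class (u : E -> R) : H1 u -> mixed_class p mu u.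
Proof. by have [S _ hS] := H1_mixed => /hS[]. Qed.

Lemma H1_dirichlet0 (u : E -> R) : H1 u -> dirichlet u u = 0 ->
  {ae mu, forall x, u x = 0}.
Proof.
have [S _ hS] := H1_mixed => hu u0; have [_ iu bu _] := hS u hu.
move: bu; rewrite u0 powR0 ?mulr0; last by rewrite gt_eqF// divr_gt0//; have := a3; lra.
move=> bu; have := @Rint_eq0 _ _ _ mu _ iu (fun x => powR_ge0 _ _).
have -> : \int[mu]_x `|u x| `^ p = 0.
  by apply/eqP; rewrite eq_le bu/=; apply: Rint_ge0 => x; exact: powR_ge0.
move=> /(_ erefl); apply: filterS => x /powR_eq0_eq0/eqP.
by rewrite normr_eq0 => /eqP.
Qed.

Lemma H1norm_sqr (u : E -> R) : H1 u ->
  H1norm u ^+ 2 = dirichlet u u + \int[mu]_x u x ^+ 2.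
Proof.
move=> hu; have [mmu u2] := H1_sqint hu; have iu := grad_sqr_int hu.
rewrite /H1norm RintD// dirichletE// sqr_sqrtr//.
by rewrite addr_ge0 ?dirichlet_ge0//; apply: Rint_ge0 => x; exact: sqr_ge0.
Qed.

Lemma H1norm_ge0 (u : E -> R) : 0 <= H1norm u.
Proof. exact: sqrtr_ge0. Qed.

Lemma dirichletZ (h : E -> R) (c : R) : H1 h ->
  dirichlet (fun x => c * h x) (fun x => c * h x) = c ^+ 2 * dirichlet h h.
Proof.
move=> hh; have Z0 (v : E -> R) : H1 v -> dirichlet (fun=> 0) v = 0.
  move=> hv; have := dirichlet_linl (-1) (@H1_0 R n) (@H1_0 R n) hv.
  rewrite (_ : (fun x : E => 0 + -1 * 0) = (fun=> 0)); last first.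
    by apply/funext => x; rewrite mulr0 addr0.
  by move=> h0; rewrite {1}h0; set z := dirichlet _ _; ring.
have := dirichlet_lin2 c (@H1_0 R n) hh.
rewrite (_ : (fun x => 0 + c * h x) = (fun x => c * h x)); last first.
  by apply/funext => x; rewrite add0r.
by rewrite !Z0 ?mulr0 ?add0r//; exact: H1_0.
Qed.

(** Rescaling by [1 / t] puts the increments into the unit ball of H^1; this supplies the bound of
    [nem_frechet_seq] with one constant. *)
Lemma H1_mixed_unit : exists2 S : R, 0 <= S & forall (h : E -> R) (t : R),
  H1 h -> 0 < t -> H1norm h <= t ->
  Rintegrable mu (fun x => Np (t^-1 * h x)) /\ \int[mu]_x Np (t^-1 * h x) <= S.
Proof.
have [S S0 hS] := H1_mixed; exists (1 + S); first by rewrite addr_ge0.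
move=> h t hh t0 ht; have hw := H1Z t^-1 hh.
have [[_ iw] _ bw ->] := hS _ hw; split => //.
have h2 : H1norm h ^+ 2 <= t ^+ 2 by rewrite lerXn2r// nnegrE ?H1norm_ge0// ltW.
have ti : 0 < t^-1 ^+ 2 by rewrite exprn_gt0 ?invr_gt0.
have tt : t^-1 ^+ 2 * t ^+ 2 = 1 by rewrite -exprMn mulVf ?gt_eqF// expr1n.
have D0 := dirichlet_ge0 h.
have I0 : 0 <= \int[mu]_x h x ^+ 2 by apply: Rint_ge0 => x; exact: sqr_ge0.
rewrite H1norm_sqr// in h2.
have DE := dirichletZ t^-1 hh.
apply: lerD.
  have -> : \int[mu]_x (t^-1 * h x) ^+ 2 = t^-1 ^+ 2 * \int[mu]_x h x ^+ 2.
    rewrite -RintZ; last exact: sqint_int (H1_sqint hh).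
    by apply: eq_Rintegral => x _; rewrite exprMn.
  by rewrite -tt ler_wpM2l ?(ltW ti)//; lra.
apply: (le_trans bw); rewrite -[leRHS]mulr1 ler_wpM2l//.
have one : 1 `^ (a / (a - 2)) = 1 :> R by rewrite powR1.
rewrite -[leRHS]one; apply: ge0_ler_powR.
- by rewrite divr_ge0//; have := a3; lra.
- by rewrite nnegrE dirichlet_ge0.
- by rewrite nnegrE.
by rewrite DE -tt ler_wpM2l ?(ltW ti)//; lra.
Qed.

(** If no [d] works, the failures at the scales [2 ^ - k] form a sequence that contradicts
    [nem_frechet_seq]. *)
Lemma H1_frechet (g G : R -> R) (C : R) (u : E -> R) (e : R) :
  0 <= C -> continuous g -> G 0 = 0 -> (forall t : R, is_derive t 1 G (g t)) ->
  (forall t, `|g t| <= C * mixed_dpow p t) -> H1 u -> 0 < e ->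
  exists2 d : R, 0 < d & forall h, H1 h -> H1norm h <= d ->
    `|\int[mu]_x G (h x + u x) - \int[mu]_x G (u x) - \int[mu]_x (g (u x) * h x)|
    <= e * H1norm h.
Proof.
move=> C0 cg G0 dG hg hu e0; apply: contrapT => Hn.
pose Dl (h : E -> R) := `|\int[mu]_x G (h x + u x) - \int[mu]_x G (u x) -
  \int[mu]_x (g (u x) * h x)|.
have /choice[z hz] (k : nat) : exists ht : (E -> R) * R,
    [/\ H1 ht.1, 0 < ht.2 <= (2^-1) ^+ k, H1norm ht.1 <= ht.2 & e * ht.2 < Dl ht.1].
  have k0 : 0 < (2^-1 : R) ^+ k by rewrite exprn_gt0.
  apply: contrapT => Hk; apply: Hn; exists ((2^-1) ^+ k) => // h hh hk.
  rewrite -/(Dl h) leNgt; apply/negP => hD; apply: Hk.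
  have [h0|h0] := eqVneq (H1norm h) 0; last first.
    by exists (h, H1norm h) => /=; split => //; rewrite hk lt_neqAle eq_sym h0 H1norm_ge0.
  rewrite h0 mulr0 in hD.
  (* The norm of [h] is 0 here; the scale is shrunk until [e] times it is below the positive
     quantity [Dl h]. *)
  exists (h, Num.min ((2^-1) ^+ k) (Dl h / (2 * e))) => /=; split => //.
  - by rewrite lt_min k0 divr_gt0 ?mulr_gt0//= ge_min lexx.
  - by rewrite h0 le_min ltW//= divr_ge0 ?mulr_ge0// ltW.
  apply: (@le_lt_trans _ _ (e * (Dl h / (2 * e)))).
    by rewrite ler_wpM2l ?(ltW e0)// ge_min lexx orbT.
  have -> : e * (Dl h / (2 * e)) = Dl h / 2 by field; rewrite gt_eqF.
  by lra.
have [S S0 hS] := H1_mixed_unit.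
have [k _ hk] : \forall k \near \oo, Dl (z k).1 <= e * (z k).2.
  apply: (nem_frechet_seq p2 C0 cg G0 dG hg (H1_mixed_class hu)
    (h_ := fun k => (z k).1) (t_ := fun k => (z k).2) (S := S)) => // k.
  - by have [/H1_meas] := hz k.
  - by have [] := hz k.
  - by have [h1 /andP[h2 _] h3 _] := hz k; exact: hS.
by have [_ _ _] := hz k; rewrite ltNge hk//= leqnn.
Qed.

End H1_nemytskii.

Section local_compactness.
Context {R : realType} {n : nat}.
Local Notation E := 'rV[R]_n.
Local Notation mu := (lebesgue_rV n : {sigma_finite_measure set E -> \bar R}).
Variables (U : set_system nat) (w_ : (E -> R)^nat) (M B : R).
Hypothesis UU : ProperFilter U.
Hypothesis hw : forall k, H1 (w_ k).
Hypothesis wM : forall k, \int[mu]_x w_ k x ^+ 2 <= M.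
Hypothesis wB : forall k, dirichlet (w_ k) (w_ k) <= B.
Hypothesis w0 : forall phi : E -> R, sqint mu phi ->
  \int[mu]_x (w_ k x * phi x) @[k --> U] --> (0 : R).

Let sw k : sqint mu (w_ k) := H1_sqint (hw k).

Lemma rV_cube_compact k : compact (rV_cube k : set E).
Proof.
have := @rV_compact R n (fun i => `[- k%:R, k%:R]%classic).
have -> : [set v : E | forall i, `[- k%:R, k%:R]%classic (v ord0 i)] = rV_cube k.
  by apply/seteqP; split => x h i; have := h i; rewrite /= !mxE in_itv.
by apply=> i; exact: segment_compact.
Qed.

(** Weak convergence gives convergence at each point, because the value there is a pairing with a
    translate of [rho]; the common Lipschitz bound spreads it to balls, and compactness to the
    cube. *)
Lemma moll_cvg_uniform (rho : E -> R) (j : nat) (e : R) : test_function rho -> 0 < e ->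
  \forall k \near U, forall x : E, rV_cube j x -> `|moll (w_ k) rho x| <= e.
Proof.
move=> trho e0.
have M0 : 0 <= M.
  by apply: le_trans (wM 0%N); apply: Rint_ge0 => x; exact: sqr_ge0.
pose L := n%:R * dirichlet rho rho * M.
have L0 : 0 <= L by rewrite !mulr_ge0// dirichlet_ge0.
have lip k (x y : E) : (moll (w_ k) rho x - moll (w_ k) rho y) ^+ 2 <= L * `|x - y| ^+ 2.
  apply: (le_trans (moll_diff x y (sw k) trho)); rewrite ler_wpM2r ?sqr_ge0//.
  by rewrite ler_wpM2l// mulr_ge0// dirichlet_ge0.
have /compact_near_coveringP cov := @rV_cube_compact j.
apply: (cov nat U (fun k x => `|moll (w_ k) rho x| <= e)) => x _.
have [r r0 hr] : exists2 r : R, 0 < r & L * r ^+ 2 <= (e / 2) ^+ 2.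
  exists (e / 2 / Num.sqrt (L + 1)).
    by rewrite divr_gt0 ?divr_gt0 ?sqrtr_gt0 ?ltr_wpDl.
  rewrite expr_div_n sqr_sqrtr ?addr_ge0// mulrA ler_pdivrMr ?ltr_wpDl//.
  by rewrite mulrC ler_wpM2l ?sqr_ge0// lerDl.
have cx : moll (w_ k) rho x @[k --> U] --> (0 : R).
  exact/w0/test_sqint/test_shift.
have e2 : 0 < e / 2 by rewrite divr_gt0.
move/cvgr0Pnorm_le : cx => /(_ _ e2) hU.
exists (ball x r, [set k | `|moll (w_ k) rho x| <= e / 2]).
  by split => //=; exact: nbhsx_ballx.
move=> [y k] [/= xy hk].
have d : `|moll (w_ k) rho x - moll (w_ k) rho y| <= e / 2.
  rewrite -(ler_pXn2r (ltn0Sn 1)) ?nnegrE ?normr_ge0 ?(ltW e2)//.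
  rewrite real_normK ?num_real// (le_trans (lip _ _ _))// (le_trans _ hr)//.
  rewrite ler_wpM2l// lerXn2r// ?nnegrE ?normr_ge0 ?(ltW r0)//.
  by move: xy; rewrite -ball_normE /= => /ltW.
rewrite -(subKr (moll (w_ k) rho x) (moll (w_ k) rho y)).
by apply: (le_trans (ler_normB _ _)); lra.
Qed.

(** On the cube [w_k] equals its mollification, uniformly small along [U], up to an L^2 error
    controlled by the scale and [B]. The scale is fixed first; each contribution is at most
    [e / 2]. *)
Lemma rellich (j : nat) (e : R) : 0 < e ->
  \forall k \near U, \int[mu]_x (\1_(rV_cube j) x * w_ k x ^+ 2) <= e.
Proof.
move=> e0.
have B0 : 0 <= B by apply: le_trans (wB 0%N); exact: dirichlet_ge0.
have [r r0 hr] : exists2 r : R, 0 < r & 2 * (n%:R * r ^+ 2 * B) <= e / 2.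
  have c0 : 0 < 4 * n%:R * B + 1 :> R by rewrite ltr_wpDl ?mulr_ge0.
  exists (Num.sqrt (e / (4 * n%:R * B + 1))); first by rewrite sqrtr_gt0 divr_gt0.
  rewrite sqr_sqrtr ?divr_ge0 ?(ltW e0) ?(ltW c0)//.
  have -> : 2 * (n%:R * (e / (4 * n%:R * B + 1)) * B) =
    e / 2 * (4 * n%:R * B / (4 * n%:R * B + 1)) by field; rewrite gt_eqF.
  by rewrite ler_piMr ?divr_ge0 ?(ltW e0)// ler_pdivrMr// mul1r lerDl ler01.
have [rho mrho] := @mollifier_exists R n r r0; have [trho _ _ _] := mrho.
have iQ : Rintegrable mu (\1_(rV_cube j) : E -> R) := Rintegrable_box _ _.
pose vol := \int[mu]_x (\1_(rV_cube j) x : R).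
have v0 : 0 <= vol by apply: Rint_ge0 => x; rewrite indicE.
pose d := Num.sqrt (e / (4 * (vol + 1))).
have ed0 : 0 < e / (4 * (vol + 1)) by rewrite divr_gt0// mulr_gt0// ltr_wpDl.
have d0 : 0 < d by rewrite sqrtr_gt0.
apply: filterS (moll_cvg_uniform j trho d0) => k hk.
have sd : sqint mu (fun x => moll (w_ k) rho x - w_ k x).
  by apply: sqintB => //; have [] := moll_sqint (sw k) mrho.
have mw := sqint_meas (sw k).
have bnd x : \1_(rV_cube j) x * w_ k x ^+ 2 <=
    2 * (moll (w_ k) rho x - w_ k x) ^+ 2 + 2 * d ^+ 2 * \1_(rV_cube j) x.
  have s0 := sqr_ge0 (moll (w_ k) rho x - w_ k x).
  rewrite indicE; have [xQ|xQ] := boolP (x \in _); last first.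
    by rewrite mul0r mulr0 addr0 mulr_ge0.
  rewrite mul1r mulr1; have /hk hx := set_mem xQ.
  have : moll (w_ k) rho x ^+ 2 <= d ^+ 2.
    by rewrite -real_normK ?num_real// lerXn2r// nnegrE ?normr_ge0 ?(ltW d0).
  have := sqr_ge0 (w_ k x - 2 * moll (w_ k) rho x).
  by rewrite !expr2; nra.
apply: (@le_trans _ _ (\int[mu]_x (2 * (moll (w_ k) rho x - w_ k x) ^+ 2 +
    2 * d ^+ 2 * \1_(rV_cube j) x))).
  apply: Rint_le => //.
  - apply: (Rintegrable_le _ (sqint_int (sw k))).
      apply: measurable_funM; last exact: measurable_funX.
      by apply/measurable_indicP; exact: measurable_rV_box.
    move=> x; rewrite ger0_norm; last by apply: mulr_ge0 => //; exact: sqr_ge0.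
    by rewrite ler_piMl ?sqr_ge0// indicE lern1 leq_b1.
  - apply: RintegrableD; first exact: RintegrableZ (sqint_int sd).
    exact: RintegrableZ.
rewrite RintD; last 2 first.
- exact: RintegrableZ (sqint_int sd).
- exact: RintegrableZ.
rewrite (@RintZ _ _ _ mu 2 _ (sqint_int sd)) (@RintZ _ _ _ mu (2 * d ^+ 2) _ iQ) -/vol.
have -> : e = e / 2 + e / 2 by field.
apply: lerD.
  apply: le_trans hr; rewrite ler_wpM2l//.
  apply: (le_trans (moll_approx (ltW r0) (hw k) mrho)).
  by rewrite ler_wpM2l// mulr_ge0 ?sqr_ge0.
rewrite /d sqr_sqrtr ?(ltW ed0)//.
have -> : 2 * (e / (4 * (vol + 1))) * vol = e / 2 * (vol / (vol + 1)).
  by field; rewrite gt_eqF// ltr_wpDl.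
by rewrite ler_piMr ?divr_ge0 ?(ltW e0)// ler_pdivrMr ?ltr_wpDl// mul1r lerDl.
Qed.

End local_compactness.

Section local_ae.
Context {R : realType} {n : nat}.
Local Notation E := 'rV[R]_n.
Local Notation mu := (lebesgue_rV n : {sigma_finite_measure set E -> \bar R}).

(** The cubes grow with [k], so every point lies in all but finitely many of them, and the bounds
    are summable. *)
Lemma ae_cvg0_of_local (w_ : (E -> R)^nat) : (forall k, sqint mu (w_ k)) ->
  (forall k, \int[mu]_x (\1_(rV_cube k) x * w_ k x ^+ 2) <= (2^-1) ^+ k) ->
  {ae mu, forall x, w_ ^~ x @ \oo --> (0 : R)}.
Proof.
move=> sw wk.
have : {ae mu, forall x, \1_(rV_cube k) x * w_ k x ^+ 2 @[k --> \oo] --> (0 : R)}.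
  apply: (@ae_cvg0_of_summable _ _ _ mu
    (fun k x => \1_(rV_cube k) x * w_ k x ^+ 2) 2).
  - move=> k; apply: (Rintegrable_le _ (sqint_int (sw k))).
      apply: measurable_funM; last by apply: measurable_funX; exact: sqint_meas (sw k).
      by apply/measurable_indicP; exact: measurable_rV_box.
    move=> x; rewrite ger0_norm; last by apply: mulr_ge0 => //; exact: sqr_ge0.
    by rewrite ler_piMl ?sqr_ge0// indicE lern1 leq_b1.
  - by move=> k x; apply: mulr_ge0 => //; exact: sqr_ge0.
  move=> k; apply: (@le_trans _ _ (\sum_(i < k) (2^-1) ^+ i)).
    by apply: ler_sum => i _; exact: wk.
  exact: sum_half_le.
apply: filterS => x hx; apply/cvgr0Pnorm_lt => e e0.
have e2 : 0 < e ^+ 2 by rewrite exprn_gt0.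
move/cvgr0Pnorm_lt : hx => /(_ _ e2) h.
near=> k.
have xk : rV_cube k x.
  apply/rV_cubeP; near: k; exact: nbhs_infty_ger.
have : `|\1_(rV_cube k) x * w_ k x ^+ 2| < e ^+ 2 by near: k.
rewrite indicE mem_set// mul1r ger0_norm ?sqr_ge0// => hk.
rewrite -(ltr_pXn2r (ltn0Sn 1)) ?nnegrE ?normr_ge0 ?(ltW e0)//.
by rewrite real_normK ?num_real.
Unshelve. end_near. Qed.

End local_ae.

(** * The minimisation problem *)

(* The ratio of the scaling exponents of the Dirichlet integral and of [nem_int G]. *)
Definition dim_ratio (R : realType) (n : nat) : R := (n%:R - 2) / n%:R.

Definition nem_int {R : realType} {n : nat} (G : R -> R) (u : 'rV[R]_n -> R) : R :=
  \int[lebesgue_rV n]_x G (u x).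

Section dim_ratio.
Context {R : realType} {n : nat} (n3 : (3 <= n)%N).
Local Notation th := (dim_ratio R n).

Let a3 : 3 <= n%:R :> R.
Proof. by rewrite ler_nat. Qed.

Lemma dim_ratio_gt0 : 0 < th.
Proof. by rewrite divr_gt0//; have := a3; lra. Qed.

Lemma dim_ratio_lt1 : th < 1.
Proof. by rewrite ltr_pdivrMr ?mul1r; have := a3; lra. Qed.

Lemma dim_ratioV : n%:R / (n%:R - 2) = th^-1.
Proof. by rewrite /dim_ratio invf_div. Qed.

Lemma dim_ratioB : 1 - th = 2 / n%:R.
Proof. by rewrite /dim_ratio; field; rewrite gt_eqF//; have := a3; lra. Qed.

End dim_ratio.

Section minimisation.
Context {R : realType} {n : nat} (n3 : (3 <= n)%N).
Local Notation E := 'rV[R]_n.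
Local Notation mu := (lebesgue_rV n : {sigma_finite_measure set E -> \bar R}).
Local Notation a := n%:R.
Local Notation p := (critical_exponent n : R).
Local Notation Np := (mixed_pow p).
Variables (V C : R) (g G : R -> R).
Hypotheses (V0 : 0 < V) (C0 : 0 <= C) (cg : continuous g) (G0 : G 0 = 0).
Hypothesis dG : forall t : R, is_derive t 1 G (g t).
Hypothesis hg : forall t, `|g t| <= C * mixed_dpow p t.
Hypothesis hG : forall e : R, 0 < e -> exists2 d : R, 0 < d & exists2 K : R, 0 <= K &
  forall t, G t <= e * Np t + K * (d <= `|t|)%R%:R - V / 2 * t ^+ 2.
Hypothesis hs : exists2 s : R, 0 < s & 0 < G s.

Let p2 : 2 < p := critical_exponent_gt2 n3.

Let a3 : 3 <= a :> R.
Proof. by rewrite ler_nat. Qed.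

Local Notation W := (nem_int G).
Local Notation th := (dim_ratio R n).

Let th0 : 0 < th := dim_ratio_gt0 n3.
Let th1 : th < 1 := dim_ratio_lt1 n3.
Let thE := @dim_ratioV R n.

Let iG (u : E -> R) : H1 u -> Rintegrable mu (fun x => G (u x)).
Proof. by move=> hu; apply: (nem_integrable p2 C0 G0 dG hg (H1_mixed_class n3 hu)). Qed.

Lemma nem_affine (u : E -> R) (t : R) (z : E) : 0 < t -> H1 u ->
  W u = t ^+ n * W (fun x => u (t *: x + z)).
Proof. by move=> t0 hu; rewrite /nem_int (Rint_rV_affine z t0 (iG hu)). Qed.

Lemma nem_shift (u : E -> R) (z : E) : H1 u -> W (fun x => u (x + z)) = W u.
Proof. by move=> hu; exact: Rint_rV_shift (iG hu). Qed.

(** Smooth approximations of [s] times the indicator of the unit cube; as the cube has volume 1, the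
    integrals converge to [G s > 0]. *)
Lemma nem_pos_exists : exists2 u : E -> R, H1 u & 0 < W u.
Proof.
have [s s0 Gs] := hs; pose o : E := const_mx 0; pose b : E := const_mx 1.
pose f_ k x := G (s * rV_bump o b k.+1 x).
pose Q := rV_box (o - const_mx 1) (b + const_mx 1).
have tb k : test_function (rV_bump o b k.+1) by exact: bump_test.
have hb k : H1 (fun x => s * rV_bump o b k.+1 x) by exact/H1Z/test_H1.
have [|||||_] := @Rint_dominated _ _ _ mu f_ (fun x => G s * \1_(rV_box o b) x)
  (fun x => C * Np s * \1_Q x).
- by move=> k; exact: Rintegrable_meas (iG (hb k)).
- apply: measurable_funM => //.
  by apply/measurable_indicP; exact: measurable_rV_box.
- apply: nearW => x; rewrite /f_.
  have -> : G s * \1_(rV_box o b) x = G (s * \1_(rV_box o b) x).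
    by rewrite indicE; case: (x \in _); rewrite ?mulr1// !mulr0 G0.
  have h : s * rV_bump o b k.+1 x @[k --> \oo] --> s * (\1_(rV_box o b) x : R).
    apply: cvgM; first exact: cvg_cst.
    have := @cvg_bump R n o b x.
    by rewrite -(cvg_shiftS (fun k => rV_bump o b k x)).
  exact: (@cvg_comp _ _ _ _ G _ _ _ h (@nem_continuous _ _ _ dG _)).
- by apply: RintegrableZ; exact: Rintegrable_box.
- apply: nearW => x k; rewrite /f_ indicE.
  have [xQ|xQ] := boolP (x \in Q).
    rewrite mulr1 (le_trans (nem_le p2 C0 G0 dG hg _))// ler_wpM2l//.
    apply: mixed_pow_le => //; rewrite normrM ler_piMr//.
    by rewrite ger0_norm ?bump_ge0 ?bump_le1.
  have -> : rV_bump o b k.+1 x = 0.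
    apply/eqP; apply: contraNT xQ => h; apply/mem_set.
    exact: bump_support h.
  by rewrite mulr0 G0 normr0 mulr0.
have iQ := @Rintegrable_box R n o b.
have Iv : \int[mu]_x (\1_(rV_box o b) x : R) = 1.
  have [_ ->] := @Rintegrable_indic _ _ _ mu _ (measurable_rV_box o b)
    (lebesgue_rV_box_lty o b).
  have h := @lebesgue_rV_box R n o b (fun i => ltac:(by rewrite !mxE)).
  transitivity (fine (\prod_i (b ord0 i - o ord0 i))%:E); first by congr fine.
  by rewrite /= big1// => i _; rewrite !mxE subr0.
rewrite (RintZ _ iQ) Iv mulr1.
move=> /cvgrPdist_lt/(_ _ Gs)[k _ /(_ k (leqnn k))] /= hk.
exists (fun x => s * rV_bump o b k.+1 x) => //.
by move: hk; rewrite /f_ -/(W _) => hk; have := ler_norm (G s - W (fun x => s * rV_bump o b k.+1 x)); lra.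
Qed.

(** With [e = V / 4] the quadratic terms combine to [- V / 4 t^2], and the indicator of [d <= |t|]
    is at most [|t| ^ p / d ^ p]; then Sobolev. The bound serves twice: it makes the infimum
    positive, and it bounds the L^2 norm of functions with [W = 1]. *)
Lemma nem_upper : exists2 K : R, 0 < K & forall u : E -> R, H1 u ->
  W u + V / 4 * \int[mu]_x u x ^+ 2 <= K * dirichlet u u `^ th^-1.
Proof.
have V4 : 0 < V / 4 by rewrite divr_gt0.
have [d d0 [K K0 hK]] := hG V4; have [S S0 hS] := H1_mixed n3 (R := R).
have dp : 0 < d `^ p by rewrite powR_gt0.
pose K1 := V / 4 + K / d `^ p.
have K10 : 0 <= K1 by rewrite addr_ge0 ?divr_ge0// ltW.
have bnd t : G t + V / 4 * t ^+ 2 <= K1 * `|t| `^ p.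
  have : K * (d <= `|t|)%R%:R <= K / d `^ p * `|t| `^ p.
    have [dt|dt] := leP d `|t|; last first.
      by rewrite mulr0 mulr_ge0 ?powR_ge0// divr_ge0// ltW.
    rewrite mulr1 -mulrA ler_peMr// mulrC ler_pdivlMr// mul1r.
    by apply: ge0_ler_powR; rewrite ?nnegrE// ltW// (lt_trans _ p2).
  by have := hK t; rewrite /mixed_pow /K1; lra.
exists (K1 * S + 1); first by rewrite ltr_wpDl ?mulr_ge0.
move=> u hu; have [_ iu bu _] := hS u hu; have su := sqint_int (H1_sqint hu).
rewrite -RintZ// -RintD//; [|exact: iG|exact: RintegrableZ].
apply: (@le_trans _ _ (K1 * (S * dirichlet u u `^ (a / (a - 2))))).
  apply: (@le_trans _ _ (\int[mu]_x (K1 * `|u x| `^ p))).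
    apply: Rint_le; [|exact: RintegrableZ|by move=> x; exact: bnd].
    by apply: RintegrableD; [exact: iG|exact: RintegrableZ].
  by rewrite RintZ// ler_wpM2l.
by rewrite thE [leRHS]mulrDl mul1r [leLHS]mulrA lerDl powR_ge0.
Qed.

Lemma min_const : exists m : R, [/\ 0 < m,
  forall u : E -> R, H1 u -> 0 < W u -> m * W u `^ th <= dirichlet u u &
  forall e : R, 0 < e -> exists u : E -> R,
    [/\ H1 u, W u = 1 & dirichlet u u <= m + e]].
Proof.
have [K K0 hK] := nem_upper.
pose Q := [set r | exists u : E -> R, [/\ H1 u, 0 < W u & r = dirichlet u u / W u `^ th]].
have lbQ r : Q r -> (K `^ th)^-1 <= r.
  move=> [u [hu Wu ->]]; have Wp : 0 < W u `^ th by rewrite powR_gt0.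
  have Kp : 0 < K `^ th by rewrite powR_gt0.
  rewrite ler_pdivlMr// mulrC ler_pdivrMr// mulrC.
  have D0 := dirichlet_ge0 u.
  have -> : K `^ th * dirichlet u u = (K * dirichlet u u `^ th^-1) `^ th.
    rewrite powRM ?powR_ge0 ?(ltW K0)// -powRrM mulVf ?gt_eqF//.
    by rewrite powRr1.
  apply: ge0_ler_powR; rewrite ?nnegrE ?(ltW th0) ?(ltW Wu)//.
    by rewrite mulr_ge0 ?powR_ge0// ltW.
  apply: le_trans (hK u hu); rewrite lerDl mulr_ge0 ?divr_ge0 ?(ltW V0)//.
  by apply: Rint_ge0 => x; exact: sqr_ge0.
have [u0 hu0 Wu0] := nem_pos_exists.
have Q0 : Q !=set0 by exists (dirichlet u0 u0 / W u0 `^ th); exists u0.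
have hQ : has_inf Q.
  by split => //; exists (K `^ th)^-1 => r; exact: lbQ.
exists (inf Q); split.
- apply: (@lt_le_trans _ _ (K `^ th)^-1); first by rewrite invr_gt0 powR_gt0.
  by apply: lb_le_inf => // r; exact: lbQ.
- move=> u hu Wu; rewrite -ler_pdivlMr ?powR_gt0//.
  by apply: ge_inf; [exact: hQ.2|exists u].
move=> e e0; have [r [u [hu Wu ->]] hr] := inf_adherent e0 hQ.
have a0 : 0 < a :> R by have := a3; lra.
(* Passing to [u (t x)] divides [W u] by [t ^ n], so this choice normalises it to 1; the Dirichlet
   form becomes the scale invariant quotient. *)
pose t := W u `^ a^-1; have t0 : 0 < t by rewrite powR_gt0.
have tn : t ^+ n = W u.
  by rewrite -powR_mulrn ?(ltW t0)// -powRrM mulVf ?gt_eqF// powRr1// ltW.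
exists (fun x => u (t *: x + 0%R)); split.
- exact: H1_affine.
- have := nem_affine 0%R t0 hu; rewrite tn => h.
  by apply: (mulfI (lt0r_neq0 Wu)); rewrite mulr1 -h.
have := dirichlet_affine 0%R t0 hu; rewrite tn => h.
have t2 : t ^+ 2 / W u = (W u `^ th)^-1.
  rewrite -powR_mulrn ?(ltW t0)// -powRrM -[X in _ / X](powRr1 (ltW Wu)) -powRB.
    rewrite -powRN; congr (_ `^ _); rewrite /dim_ratio; field; by rewrite gt_eqF.
  by apply/implyP => _; exact: lt0r_neq0.
apply: ltW; apply: le_lt_trans hr.
have -> : dirichlet (fun x => u (t *: x + 0%R)) (fun x => u (t *: x + 0%R)) =
    t ^+ 2 / W u * dirichlet u u.
  by rewrite mulrAC -h mulrAC divff ?mul1r// gt_eqF.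
by rewrite t2 mulrC.
Qed.

Lemma concentration (B : R) : 0 <= B -> exists (rho : E -> R) (d : R),
  [/\ test_function rho, 0 < d & forall u : E -> R, H1 u -> W u = 1 ->
    dirichlet u u <= B -> exists x, d <= `|moll u rho x|].
Proof.
move=> B0; have [K2 K20 hK2] := nem_upper; have [S S0 hS] := H1_mixed n3 (R := R).
pose M := K2 * B `^ th^-1 / (V / 4) + S * B `^ th^-1.
have V4 : 0 < V / 4 by rewrite divr_gt0.
have Bt := powR_ge0 B th^-1.
have M0 : 0 <= M by rewrite addr_ge0 ?divr_ge0 ?mulr_ge0// ltW.
have M1 : 0 < M + 1 by rewrite ltr_wpDl.
(* [M] bounds the integral of [Np u], so the [e] term takes at most half of [W u = 1]; the set where
   [|u| >= d] must then have measure at least [c]. *)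
pose e := (2 * (M + 1))^-1; have e0 : 0 < e by rewrite invr_gt0 mulr_gt0.
have [d d0 [K K0 hK]] := hG e0.
pose c := (2 * (K + 1))^-1; have c0 : 0 < c by rewrite invr_gt0 mulr_gt0// ltr_wpDl.
(* At this scale, by Chebyshev, the mollification error is at least [d / 2] only on a set of measure
   at most [c / 2]. *)
pose r := Num.sqrt (c * d ^+ 2 / (8 * (a * B + 1))).
have aB : 0 < a * B + 1 by rewrite ltr_wpDl// mulr_ge0.
have rr : 0 < c * d ^+ 2 / (8 * (a * B + 1)).
  by rewrite divr_gt0 ?mulr_gt0 ?exprn_gt0.
have r0 : 0 < r by rewrite sqrtr_gt0.
have [rho mrho] := @mollifier_exists R n r r0; have [trho _ _ _] := mrho.
exists rho, (d / 2); split => //; first by rewrite divr_gt0.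
move=> u hu Wu uB; apply: contrapT => /forallNP Hn.
have D0 := dirichlet_ge0 u; have su := H1_sqint hu; have [mmu u2] := su.
have DB : dirichlet u u `^ th^-1 <= B `^ th^-1.
  by apply: ge0_ler_powR; rewrite ?nnegrE// invr_ge0 ltW.
have uM : \int[mu]_x Np (u x) <= M.
  have [_ _ bu ->] := hS u hu; apply: lerD; last first.
    by rewrite (le_trans bu)// thE ler_wpM2l.
  rewrite ler_pdivlMr// mulrC; have := hK2 u hu; rewrite Wu => h.
  apply: (@le_trans _ _ (K2 * dirichlet u u `^ th^-1)); first by lra.
  by rewrite ler_wpM2l// ltW.
pose A := [set x | d <= `|u x|]; pose q : E -> R := \1_A.
have mA : measurable A.
  rewrite (_ : A = setT `&` (fun x => `|u x|) @^-1` `[d, +oo[); last first.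
    by apply/seteqP; split => [x|x []]; rewrite /A /= in_itv/= andbT.
  by apply: measurableT_comp.
have qE x : q x = (d <= `|u x|)%R%:R.
  rewrite /q indicE; congr (nat_of_bool _)%:R; apply/idP/idP; [exact: set_mem|].
  by move=> h; apply/mem_set.
have d2 : 0 < d ^+ 2 by rewrite exprn_gt0.
have q0 x : 0 <= q x by rewrite qE.
have iq : Rintegrable mu q.
  apply: (Rintegrable_le _ (RintegrableZ (d ^+ 2)^-1 u2)); first exact/measurable_indicP.
  move=> x; rewrite ger0_norm// qE; have [dx|dx] := leP d `|u x|; last first.
    by rewrite mulr_ge0 ?invr_ge0 ?sqr_ge0// ltW.
  rewrite mulrC ler_pdivlMr// mul1r -[leRHS]real_normK ?num_real//.
  by rewrite lerXn2r// nnegrE ltW.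
have cq : c <= \int[mu]_x q x.
  have iN : Rintegrable mu (fun x => Np (u x)) by have [[]] := hS u hu.
  have : W u <= e * M + K * \int[mu]_x q x.
    apply: (@le_trans _ _ (\int[mu]_x (e * Np (u x) + K * q x))).
      apply: Rint_le; [exact: iG| |].
        by apply: RintegrableD; exact: RintegrableZ.
      move=> x; rewrite qE; apply: (le_trans (hK (u x))).
      by rewrite lerBlDr lerDl mulr_ge0 ?sqr_ge0 ?divr_ge0// ltW.
    rewrite RintD; [|exact: RintegrableZ|exact: RintegrableZ].
    by rewrite RintZ// RintZ// lerD2r ler_wpM2l// ltW.
  have eM : e * M <= 1 / 2.
    rewrite /e mulrC ler_pdivrMr ?mulr_gt0//; lra.
  rewrite Wu => h; have iq0 : 0 <= \int[mu]_x q x by exact: Rint_ge0.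
  have K1 : 0 < K + 1 by rewrite ltr_wpDl.
  rewrite /c -div1r ler_pdivrMr ?mulr_gt0// mulrC.
  have -> : 2 * (K + 1) * \int[mu]_x q x = 2 * (K * \int[mu]_x q x) + 2 * \int[mu]_x q x.
    by ring.
  by lra.
have sd : sqint mu (fun x => moll u rho x - u x).
  by apply: sqintB => //; have [] := moll_sqint su mrho.
have : \int[mu]_x q x <= 4 / d ^+ 2 * (a * r ^+ 2 * B).
  apply: (@le_trans _ _ (\int[mu]_x (4 / d ^+ 2 * (moll u rho x - u x) ^+ 2))).
    apply: Rint_le => //; first exact: RintegrableZ (sqint_int sd).
    move=> x; rewrite qE; have s0 := sqr_ge0 (moll u rho x - u x).
    have [dx|dx] := leP d `|u x|; last by rewrite mulr_ge0 ?divr_ge0// ltW.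
    rewrite mulrAC ler_pdivlMr// mul1r.
    have /negP := Hn x; rewrite -ltNge => hx.
    have h1 : d / 2 <= `|moll u rho x - u x|.
      have := ler_normB (moll u rho x) (moll u rho x - u x); rewrite subKr; lra.
    have -> : d ^+ 2 = 4 * (d / 2) ^+ 2 by field.
    rewrite ler_wpM2l// -[leRHS]real_normK ?num_real// lerXn2r// nnegrE.
    by rewrite divr_ge0// ltW.
  rewrite (RintZ _ (sqint_int sd)) ler_wpM2l ?divr_ge0 ?(ltW d2)//.
  apply: (le_trans (moll_approx (ltW r0) hu mrho)).
  by rewrite ler_wpM2l// mulr_ge0 ?sqr_ge0.
rewrite /r sqr_sqrtr ?(ltW rr)//.
have -> : 4 / d ^+ 2 * (a * (c * d ^+ 2 / (8 * (a * B + 1))) * B) =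
    c / 2 * (a * B / (a * B + 1)).
  by field; rewrite !gt_eqF.
have : c / 2 * (a * B / (a * B + 1)) <= c / 2.
  by rewrite ler_piMr ?divr_ge0 ?(ltW c0)// ler_pdivrMr// mul1r lerDl ler01.
lra.
Qed.

(** Each [x] strictly between 0 and 1 is less than [x ^ th]; this is applied to [w] and [1 - w]. *)
Lemma powR_split_gt1 (w : R) : 0 < w -> w < 1 -> 1 < w `^ th + (1 - w) `^ th.
Proof.
have key (x : R) : 0 < x -> x < 1 -> x < x `^ th.
  move=> x0 x1; have t1 : 0 < 1 - th by rewrite subr_gt0.
  have h : x `^ (1 - th) < 1.
    have := gt0_ltr_powR t1 _ _ x1; rewrite powR1 !nnegrE; apply => //.
    exact: ltW.
  rewrite -[ltLHS](powRr1 (ltW x0)) -[X in x `^ X < _](subrK th) powRD.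
    by rewrite gtr_pMl ?powR_gt0.
  by apply/implyP => _; exact: lt0r_neq0.
move=> w0 w1; have := key w w0 w1; have := key (1 - w); lra.
Qed.

Lemma minimiser_exists (m : R) : 0 < m ->
  (forall u : E -> R, H1 u -> 0 < W u -> m * W u `^ th <= dirichlet u u) ->
  (forall e : R, 0 < e -> exists u : E -> R,
    [/\ H1 u, W u = 1 & dirichlet u u <= m + e]) ->
  exists u : E -> R, [/\ H1 u, W u = 1 & dirichlet u u = m].
Proof.
move=> m0 hm hmin.
have h2 (k : nat) : 0 < (2^-1 : R) ^+ k by rewrite exprn_gt0.
have /choice[u_ hu_] (k : nat) := hmin _ (h2 k).
have h21 (k : nat) : (2^-1 : R) ^+ k <= 1 by rewrite exprn_ile1//; lra.
have m1 : 0 <= m + 1 by lra.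
have [rho [d [trho d0 conc]]] := concentration m1.
have /choice[x_ hx_] (k : nat) : exists x, d <= `|moll (u_ k) rho x|.
  by have [hu Wu Du] := hu_ k; apply: conc => //; rewrite (le_trans Du)// lerD2l.
(* Recentring: the pairing of [v k] with the fixed [rho] is at least [d] in absolute value, which
   survives weak limits. *)
pose v k (x : E) := u_ k (x + x_ k).
have hv k : H1 (v k) by apply: H1_shift; have [] := hu_ k.
have Wv k : W (v k) = 1 by have [hu Wu _] := hu_ k; rewrite nem_shift.
have Dv k : dirichlet (v k) (v k) <= m + (2^-1) ^+ k.
  by have [hu _ Du] := hu_ k; rewrite dirichlet_shift.
have Dv1 k : dirichlet (v k) (v k) <= m + 1 by rewrite (le_trans (Dv k))// lerD2l.
have mv k : d <= `|\int[mu]_x (v k x * rho x)|.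
  have [hu _ _] := hu_ k; have := hx_ k; rewrite /moll.
  have i1 := moll_integrable (x_ k) (H1_sqint hu) trho.
  rewrite -(Rint_rV_shift (x_ k) i1).
  by under eq_Rintegral do rewrite addrK.
have [K2 K20 hK2] := nem_upper; have [S S0 hS] := H1_mixed n3 (R := R).
have V4 : 0 < V / 4 by rewrite divr_gt0.
pose M2 := K2 * (m + 1) `^ th^-1 / (V / 4).
have vM k : \int[mu]_x v k x ^+ 2 <= M2.
  rewrite ler_pdivlMr// mulrC; have := hK2 _ (hv k); rewrite Wv => h.
  apply: (@le_trans _ _ (K2 * dirichlet (v k) (v k) `^ th^-1)); first by lra.
  rewrite ler_wpM2l ?(ltW K20)//; apply: ge0_ler_powR; rewrite ?nnegrE//.
  - by rewrite invr_ge0 ltW.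
  - exact: dirichlet_ge0.
(* An ultrafilter finer than convergence to infinity; it handles the functions and their [n] partial
   derivatives at once. *)
have [U [UU ooU]] := ultraFilterLemma (@eventually_filter).
have UP : ProperFilter U by exact: ultra_proper.
have [u su wu] := sqint_weak_compact UU (fun k => H1_sqint (hv k)) vM.
have /choice[q_ hq_] (i : 'I_n) : exists q : E -> R, sqint mu q /\
    forall f, sqint mu f -> \int[mu]_x (weak_partial i (v k) x * f x) @[k --> U] -->
      \int[mu]_x (q x * f x).
  have [q sq hq] := @sqint_weak_compact _ _ _ mu U (fun k => weak_partial i (v k)) (m + 1)
    UU (fun k => weak_partial_sqint i (hv k))
    (fun k => le_trans (weak_partial_le_dirichlet i (v k)) (Dv1 k)).
  by exists q.
(* Both sides of the defining identity converge along [U], so the limits of the derivatives are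
   derivatives of the limit. *)
have wq i : is_weak_partial i u (q_ i).
  move=> phi tphi; have [sq hq] := hq_ i.
  have c1 := wu _ (test_sqint (test_partial i tphi)).
  have c2 : - (\int[mu]_x (weak_partial i (v k) x * phi x)) @[k --> U] -->
      - \int[mu]_x (q_ i x * phi x).
    by apply: cvgN; exact: hq (test_sqint tphi).
  have c3 : \int[mu]_x (v k x * partial i phi x) @[k --> U] -->
      - \int[mu]_x (q_ i x * phi x).
    apply: cvg_trans c2; apply: near_eq_cvg; apply: nearW => k /=.
    by have [_ wk] := weak_partialP i (hv k); rewrite (wk _ tphi).
  exact: (cvg_unique (@Rhausdorff R) c1 c3).
have hu : H1 u := H1_intro su (fun i => (hq_ i).1) wq.
have Dcv : dirichlet (v k) u @[k --> U] --> dirichlet u u.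
  rewrite (dirichlet_eq_ae hu hu (fun i => (hq_ i).1) wq).
  have h : \sum_i \int[mu]_x (weak_partial i (v k) x * weak_partial i u x) @[k --> U]
      --> \sum_i \int[mu]_x (q_ i x * weak_partial i u x).
    apply: cvg_big => [|i _]; first exact: add_continuous.
    exact: (hq_ i).2 _ (weak_partial_sqint i hu).
  apply: cvg_trans h; apply: near_eq_cvg; apply: nearW => k /=.
  rewrite (dirichlet_eq_ae (hv k) hu (fun i => weak_partial_sqint i (hv k)))//.
  by move=> i; have [] := weak_partialP i (hv k).
pose w k (x : E) := v k x - u x.
have hw k : H1 (w k) by exact: H1B.
pose Mw := 2 * M2 + 2 * \int[mu]_x u x ^+ 2.
have wM k : \int[mu]_x w k x ^+ 2 <= Mw.
  have v2 := sqint_int (H1_sqint (hv k)); have u2 := sqint_int su.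
  apply: (@le_trans _ _ (\int[mu]_x (2 * v k x ^+ 2 + 2 * u x ^+ 2))).
    apply: Rint_le; first exact: sqint_int (H1_sqint (hw k)).
      by apply: RintegrableD; exact: RintegrableZ.
    by move=> x; have := sqr_ge0 (v k x + u x); rewrite /w !expr2; nra.
  rewrite RintD; [|exact: RintegrableZ|exact: RintegrableZ].
  by rewrite (RintZ _ v2) (RintZ _ u2) lerD2r ler_wpM2l.
have DwE k : dirichlet (w k) (w k) =
    dirichlet (v k) (v k) - 2 * dirichlet (v k) u + dirichlet u u.
  by rewrite /w dirichlet_sqrB.
pose Bw := 2 * (m + 1) + 2 * dirichlet u u.
have wB k : dirichlet (w k) (w k) <= Bw.
  rewrite DwE /Bw; have := dirichlet_lin2 1 (hv k) hu.
  have := dirichlet_ge0 (fun x => v k x + 1 * u x); move: (Dv1 k).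
  rewrite mulr1 expr1n mul1r; lra.
have w0 phi : sqint mu phi -> \int[mu]_x (w k x * phi x) @[k --> U] --> (0 : R).
  move=> sphi; rewrite -[X in _ --> X](subrr (\int[mu]_x (u x * phi x))).
  have h : \int[mu]_x (v k x * phi x) - \int[mu]_x (u x * phi x) @[k --> U] -->
      \int[mu]_x (u x * phi x) - \int[mu]_x (u x * phi x).
    by apply: cvgB; [exact: wu|exact: cvg_cst].
  apply: cvg_trans h; apply: near_eq_cvg; apply: nearW => k /=.
  rewrite -RintB; [|exact: sqint_mul (H1_sqint (hv k)) sphi|exact: sqint_mul].
  by apply: eq_Rintegral => x _; rewrite mulrBl.
(* Back from the ultrafilter to a sequence: sets of [U] are nonempty, so for each [j] some index
   satisfies all three conditions. *)
have /choice[kp hkp] (j : nat) : exists k, [/\ (j <= k)%N,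
    \int[mu]_x (\1_(rV_cube j) x * w k x ^+ 2) <= (2^-1) ^+ j &
    `|dirichlet u u - dirichlet (v k) u| <= (2^-1) ^+ j].
  suff : \forall k \near U, [/\ (j <= k)%N,
      \int[mu]_x (\1_(rV_cube j) x * w k x ^+ 2) <= (2^-1) ^+ j &
      `|dirichlet u u - dirichlet (v k) u| <= (2^-1) ^+ j] by move/filter_ex.
  have U1 : \forall k \near U, (j <= k)%N by apply: ooU; exists j.
  have U2 := rellich UP hw wM wB w0 j (h2 j).
  move/cvgrPdist_le : Dcv => /(_ _ (h2 j)) U3.
  by apply: filterS3 U1 U2 U3.
pose z j := w (kp j).
have zae : {ae mu, forall x, z ^~ x @ \oo --> (0 : R)}.
  apply: ae_cvg0_of_local; first by move=> j; exact: H1_sqint (hw _).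
  by move=> j; have [] := hkp j.
have zM j : \int[mu]_x Np (z j x) <= Mw + S * Bw `^ th^-1.
  have [_ _ bz ->] := hS _ (hw (kp j)); apply: lerD; first exact: wM.
  apply: (le_trans bz); rewrite thE ler_wpM2l//.
  apply: ge0_ler_powR; rewrite ?nnegrE ?invr_ge0 ?(ltW th0) ?dirichlet_ge0//.
  exact: le_trans (dirichlet_ge0 _) (wB 0%N).
have Wz : W (z j) @[j --> \oo] --> 1 - W u.
  (* Applied to [u + z j = v (kp j)], on which [W] equals 1. *)
  have BL := brezis_lieb p2 C0 G0 dG hg (H1_mixed_class n3 hu)
    (fun j => H1_mixed_class n3 (hw (kp j))) zM zae.
  have h : 1 - (W (fun x => u x + z j x) - W (z j)) @[j --> \oo] --> 1 - W u.
    by apply: cvgB => //; exact: cvg_cst.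
  apply: cvg_trans h; apply: near_eq_cvg; apply: nearW => j /=.
  have -> : (fun x => u x + z j x) = v (kp j).
    by apply/funext => x; rewrite /z /w addrC subrK.
  by rewrite Wv; ring.
(* Expand [dirichlet (v - u) (v - u)]: the error is one [2 ^ - j] from near-minimality and two from
   the mixed term. *)
have Dz j : dirichlet (z j) (z j) <= m - dirichlet u u + 3 * (2^-1) ^+ j.
  have [jk _ hD] := hkp j; rewrite /z DwE.
  have hk : dirichlet (v (kp j)) (v (kp j)) <= m + (2^-1) ^+ j.
    apply: (le_trans (Dv _)); rewrite lerD2l.
    by rewrite -(subnK jk) exprD ler_piMl ?exprn_ge0.
  have := ler_norm (dirichlet u u - dirichlet (v (kp j)) u); lra.
have c3 : m - dirichlet u u + 3 * (2^-1) ^+ j @[j --> \oo] --> m - dirichlet u u.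
  rewrite -[X in _ --> X]addr0 -[X in _ --> _ + X](mulr0 3).
  apply: cvgD; first exact: cvg_cst.
  apply: cvgM; first exact: cvg_cst.
  by apply: cvg_expr; rewrite ger0_norm ?invr_ge0// invf_lt1 ?ltr1n.
have Dum : dirichlet u u <= m.
  rewrite -subr_ge0 -(cvg_lim (@Rhausdorff R) c3); apply: limr_ge.
    by apply/cvg_ex; exists (m - dirichlet u u).
  by apply: nearW => j; exact: le_trans (dirichlet_ge0 (z j)) (Dz j).
(* If the defect [1 - W u] is positive, the differences [z j] eventually have positive [W], and the
   minimality inequality bounds their Dirichlet form from below. *)
have split : W u < 1 -> m * (1 - W u) `^ th <= m - dirichlet u u.
  move=> Wu1; have W1 : 0 < 1 - W u by rewrite subr_gt0.
  have c4 : m * W (z j) `^ th @[j --> \oo] --> m * (1 - W u) `^ th.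
    apply: cvgM; first exact: cvg_cst.
    exact: (@cvg_comp _ _ _ _ (@powR R ^~ th) _ _ _ Wz (powR_continuous_gt0 W1)).
  apply: (ler_cvg_to c4 c3).
  have : \forall j \near \oo, 0 < W (z j) by apply: (cvgr_gt _ Wz).
  apply: filterS => j Wj.
  exact: le_trans (hm _ (hw (kp j)) Wj) (Dz j).
(* A vanishing Dirichlet form would make [u] zero almost everywhere, while the pairings of [v k]
   with [rho] stay above [d] in absolute value. *)
have Du0 : 0 < dirichlet u u.
  rewrite lt_neqAle dirichlet_ge0 andbT eq_sym; apply/eqP => D0.
  have u0 := H1_dirichlet0 n3 hu D0.
  have I0 : \int[mu]_x (u x * rho x) = 0.
    rewrite -[RHS](@Rint_cst0 _ _ _ mu); apply: Rint_ae_eq => //.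
      apply: measurable_funM; first exact: sqint_meas su.
      exact: sqint_meas (test_sqint trho).
    by apply: filterS u0 => x ->; rewrite mul0r.
  have := wu _ (test_sqint trho); rewrite I0 => /cvgr0Pnorm_lt/(_ _ d0)/filter_ex[k].
  by rewrite ltNge mv.
(* [W u <= 0] gives [(1 - W u) ^ th >= 1], hence a nonpositive Dirichlet form; [0 < W u < 1]
   contradicts [powR_split_gt1]; [W u >= 1] forces equality in
   [m * W u ^ th <= dirichlet u u <= m]. *)
exists u; have [W0|W0] := leP (W u) 0.
  exfalso; have W1 : W u < 1 by apply: le_lt_trans W0 _.
  have : 1 <= (1 - W u) `^ th.
    rewrite -[leLHS](powRr0 (1 - W u)); apply: ler_powR; [lra|exact: ltW].
  move=> h; have := split W1; have := ler_wpM2l (ltW m0) h; lra.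
have [W1|W1] := ltP (W u) 1.
  exfalso; have := powR_split_gt1 W0 W1; have := split W1; have := hm u hu W0.
  move=> h3 h4; rewrite -(ltr_pM2l m0) mulrDr; lra.
have : m * W u `^ th <= m := le_trans (hm u hu W0) Dum.
rewrite -[leRHS]mulr1 ler_pM2l// => h.
have WE : W u = 1.
  apply/eqP; rewrite eq_le W1 andbT leNgt; apply/negP => W2.
  have := gt0_ltr_powR th0 _ _ W2; rewrite powR1 !nnegrE ler01 (ltW W0) => /(_ isT isT).
  by rewrite ltNge h.
split => //; apply/eqP; rewrite eq_le Dum/=.
by have := hm u hu W0; rewrite WE powR1 mulr1.
Qed.

End minimisation.

(** * Ground states *)

(** The difference quotients from the two sides of 0 have opposite signs. *)
Lemma is_derive_min0 (R : realType) (phi : R -> R) (l : R) :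
  is_derive (0 : R) 1 phi l ->
  phi 0 = 0 -> (\forall s \near (0 : R), 0 <= phi s) -> l = 0.
Proof.
move=> /is_deriveP dl p0 hpos.
have subR : (0 : R)^'+ `=>` (0 : R)^'.
  move=> A; rewrite /at_right /dnbhs /within /=; apply: filterS => y hy y0.
  by apply: hy; rewrite gt_eqF.
have subL : (0 : R)^'- `=>` (0 : R)^'.
  move=> A; rewrite /at_left /dnbhs /within /=; apply: filterS => y hy y0.
  by apply: hy; rewrite lt_eqF.
have lR := cvg_trans (cvg_app _ subR) dl.
have lL := cvg_trans (cvg_app _ subL) dl.
apply/eqP; rewrite eq_le; apply/andP; split.
- rewrite -(cvg_lim (@Rhausdorff R) lL); apply: limr_le; first by apply/cvg_ex; exists l.
  near=> h; rewrite p0 subr0 addr0 [h%:A]mulr1.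
  have h0 : h < 0 by near: h; exact: nbhs_left_lt.
  have : 0 <= phi h by near: h; apply: cvg_within.
  by move=> ph; rewrite mulr_le0_ge0 ?invr_le0// ltW.
- rewrite -(cvg_lim (@Rhausdorff R) lR); apply: limr_ge; first by apply/cvg_ex; exists l.
  near=> h; rewrite p0 subr0 addr0 [h%:A]mulr1.
  have h0 : 0 < h by near: h; exact: nbhs_right_gt.
  have : 0 <= phi h by near: h; apply: cvg_within.
  by move=> ph; rewrite mulr_ge0 ?invr_ge0// ltW.
Unshelve. all: end_near. Qed.

Section ground_state.
Context {R : realType} {n : nat} (n3 : (3 <= n)%N).
Local Notation E := 'rV[R]_n.
Local Notation mu := (lebesgue_rV n : {sigma_finite_measure set E -> \bar R}).
Local Notation a := n%:R.
Local Notation p := (critical_exponent n : R).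
Local Notation Np := (mixed_pow p).
Variables (V C : R) (g G : R -> R).
Hypotheses (V0 : 0 < V) (C0 : 0 <= C) (cg : continuous g) (G0 : G 0 = 0).
Hypothesis dG : forall t : R, is_derive t 1 G (g t).
Hypothesis hg : forall t, `|g t| <= C * mixed_dpow p t.
Hypothesis hG : forall e : R, 0 < e -> exists2 d : R, 0 < d & exists2 K : R, 0 <= K &
  forall t, G t <= e * Np t + K * (d <= `|t|)%R%:R - V / 2 * t ^+ 2.
Hypothesis hs : exists2 s : R, 0 < s & 0 < G s.
Local Notation W := (nem_int G).
Local Notation th := (dim_ratio R n).

Let p2 : 2 < p := critical_exponent_gt2 n3.

Let a0 : 0 < a :> R.
Proof. by rewrite ltr0n (ltn_trans _ n3). Qed.

Let th0 : 0 < th := dim_ratio_gt0 n3.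
Let th1 : th < 1 := dim_ratio_lt1 n3.
Let th1E := dim_ratioB n3 (R := R).

(** The minimiser is dilated until [dirichlet u u = 2 / th * W u], the Pohozaev identity. At [W = w]
    the dilated Dirichlet form is [m * w ^ th]; equating it with [2 / th * w] gives
    [w ^ (1 - th) = m * th / 2]. The last clause is the minimality inequality with [m] expressed by
    [w]. *)
Lemma ground_state_exists : exists (w : R) (u : E -> R),
  [/\ 0 < w, H1 u, W u = w, dirichlet u u = 2 / th * w &
      forall v : E -> R, H1 v -> 0 < W v ->
        2 / th * w `^ (1 - th) * W v `^ th <= dirichlet v v].
Proof.
have [m [m0 hm hmin]] := min_const n3 V0 C0 G0 dG hg hG hs.
have [u [hu Wu Du]] := minimiser_exists n3 V0 C0 G0 dG hg hG m0 hm hmin.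
have t10 : 0 < 1 - th by rewrite subr_gt0.
have mt : 0 < m * th / 2 by apply: divr_gt0 => //; exact: mulr_gt0.
pose w := (m * th / 2) `^ (1 - th)^-1; have w0 : 0 < w by rewrite powR_gt0.
have w1 : w `^ (1 - th) = m * th / 2.
  by rewrite -powRrM mulVf ?gt_eqF// powRr1// ltW.
pose t := w `^ (- a^-1); have t0 : 0 < t by rewrite powR_gt0.
have tn : t ^+ n = w^-1.
  rewrite -powR_mulrn ?(ltW t0)// -powRrM mulNr mulVf ?gt_eqF//.
  by rewrite powR_inv1// ltW.
have t2 : t ^+ 2 = (w `^ (1 - th))^-1.
  rewrite -(powR_mulrn 2 (ltW t0)) /t -powRrM -powRN th1E mulNr.
  by rewrite [a^-1 * 2]mulrC.
have hu' : H1 (fun x => u (t *: x + 0%R)) by exact: H1_affine.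
exists w, (fun x => u (t *: x + 0%R)); split => //.
- have := nem_affine n3 C0 G0 dG hg 0%R t0 hu; rewrite Wu tn => h.
  by apply: (mulfI (invr_neq0 (lt0r_neq0 w0))); rewrite -h mulVf// gt_eqF.
- have := dirichlet_affine 0%R t0 hu; rewrite Du tn t2 w1 => h.
  apply: (mulfI (invr_neq0 (lt0r_neq0 w0))); rewrite h.
  by field; rewrite !gt_eqF.
move=> v hv Wv; have := hm v hv Wv; congr (_ * _ <= _).
by rewrite w1; field; rewrite gt_eqF.
Qed.

Lemma nem_is_derive (u h : E -> R) : H1 u -> H1 h ->
  is_derive (0 : R) 1 (fun s => W (fun x => s * h x + u x)) (\int[mu]_x (g (u x) * h x)).
Proof.
move=> hu hh; set I := \int[mu]_x _.
have hn (s : R) : H1norm (fun x => s * h x) = `|s| * H1norm h.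
  have hsh := H1Z s hh.
  apply/eqP; rewrite -(eqrXn2 (ltn0Sn 1)) ?mulr_ge0 ?H1norm_ge0// exprMn.
  rewrite !H1norm_sqr// dirichletZ// real_normK ?num_real// mulrDr; apply/eqP.
  congr (_ + _); rewrite -RintZ; last exact: sqint_int (H1_sqint hh).
  by apply: eq_Rintegral => x _; rewrite exprMn.
apply/is_deriveP; apply/cvgrPdist_le => e e0.
have N1 : 0 < H1norm h + 1 by rewrite ltr_wpDl ?H1norm_ge0.
pose e' := e / (H1norm h + 1); have e'0 : 0 < e' by rewrite divr_gt0.
have [d d0 hd] := H1_frechet n3 C0 cg G0 dG hg hu e'0.
pose r := d / (H1norm h + 1); have r0 : 0 < r by exact: divr_gt0.
have hr : \forall s \near (0 : R)^', `|s| <= r.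
  apply: nbhs_dnbhs; exists r => // s /=; by rewrite sub0r normrN => /ltW.
near=> s.
have s0 : s != 0 by near: s; exact: nbhs_dnbhs_neq.
have sd : `|s| <= r by near: s.
have := hd _ (H1Z s hh); rewrite hn.
have -> : \int[mu]_x (g (u x) * (s * h x)) = s * I.
  have iI := nem_deriv_integrable p2 C0 cg hg (H1_mixed_class n3 hu) (H1_mixed_class n3 hh).
  rewrite /I -(RintZ s iI).
  by apply: eq_Rintegral => x _; rewrite mulrCA.
rewrite addr0 [s%:A]mulr1.
have -> : W (fun x => 0 * h x + u x) = \int[mu]_x G (u x).
  by apply: eq_Rintegral => x _; rewrite mul0r add0r.
rewrite -/(W (fun x => s * h x + u x)) -/(W u) => H.
have -> : I - s^-1 *: (W (fun x => s * h x + u x) - W u) =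
    - s^-1 * (W (fun x => s * h x + u x) - W u - s * I).
  by rewrite /GRing.scale/=; field.
rewrite normrM normrN normfV mulrC ler_pdivrMr ?normr_gt0//.
apply: (le_trans (H _)).
  apply: (le_trans (ler_wpM2r (H1norm_ge0 h) sd)).
  rewrite /r mulrAC ler_pdivrMr// ler_wpM2l ?(ltW d0)//.
  by rewrite lerDl.
rewrite mulrCA mulrC ler_wpM2r// /e' mulrAC ler_pdivrMr// ler_wpM2l ?(ltW e0)//.
by rewrite lerDl.
Unshelve. end_near. Qed.

Lemma dirichlet_is_derive (u h : E -> R) : H1 u -> H1 h ->
  is_derive (0 : R) 1 (fun s => dirichlet (fun x => u x + s * h x) (fun x => u x + s * h x))
    (2 * dirichlet u h).
Proof.
move=> hu hh; set D := dirichlet u u; set B := dirichlet u h; set Q := dirichlet h h.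
rewrite (_ : (fun s => _) = (fun s => D + 2 * s * B + s ^+ 2 * Q)); last first.
  by apply/funext => s; rewrite dirichlet_lin2.
apply/is_deriveP.
have h1 : 2 * B + s * Q @[s --> (0 : R)^'] --> 2 * B + 0 * Q.
  apply: cvgD; first exact: cvg_cst.
  by apply: cvgM; [exact: nbhs_dnbhs|exact: cvg_cst].
rewrite mul0r addr0 in h1; apply: cvg_trans h1; apply: near_eq_cvg; near=> s.
have s0 : s != 0 by near: s; exact: nbhs_dnbhs_neq.
by rewrite addr0 [s%:A]mulr1 /GRing.scale/=; field.
Unshelve. end_near. Qed.

Lemma ground_state_euler (w : R) (u h : E -> R) : 0 < w -> H1 u -> W u = w ->
  dirichlet u u = 2 / th * w ->
  (forall v : E -> R, H1 v -> 0 < W v ->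
     2 / th * w `^ (1 - th) * W v `^ th <= dirichlet v v) -> H1 h ->
  dirichlet u h = \int[mu]_x (g (u x) * h x).
Proof.
move=> w0 hu Wu Du hmin hh; set I := \int[mu]_x _; pose m := 2 / th * w `^ (1 - th).
pose Ws (s : R) := W (fun x => s * h x + u x).
pose Ds (s : R) := dirichlet (fun x => u x + s * h x) (fun x => u x + s * h x).
have dW : is_derive (0 : R) 1 Ws I := nem_is_derive hu hh.
have dD : is_derive (0 : R) 1 Ds (2 * dirichlet u h) := dirichlet_is_derive hu hh.
have W0 : Ws 0 = w.
  by rewrite -Wu; apply: eq_Rintegral => x _; rewrite mul0r add0r.
have D0 : Ds 0 = 2 / th * w.
  by rewrite -Du /Ds dirichlet_lin2// mulr0 mul0r addr0 expr0n/= mul0r addr0.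
have Wp : 0 < Ws 0 by rewrite W0.
have dP := is_derive1_comp (is_derive_powR th Wp) dW.
have dphi := is_deriveB dD (is_deriveM (is_derive_cst m (0 : R) 1) dP).
have cW : {for 0, continuous Ws}.
  by apply: differentiable_continuous; apply/derivable1_diffP; have [] := dW.
have wE : w `^ (1 - th) * w `^ th = w.
  rewrite -powRD ?subrK ?powRr1 ?(ltW w0)//.
  by apply/implyP => _; exact: lt0r_neq0.
have mE : m * (th * w `^ (th - 1)) = 2.
  rewrite /m -[th - 1]opprB powRN.
  by field; rewrite !gt_eqF ?powR_gt0.
have : 2 * dirichlet u h - 2 * I = 0.
  apply: (@is_derive_min0 _ (fun s => Ds s - m * Ws s `^ th)).
  - apply: (is_derive_val dphi); rewrite W0 /GRing.scale/= mulr0 addr0.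
    by rewrite [m * _]mulrA mE.
  - by rewrite D0 W0 /m -(mulrA (2 / th)) wE subrr.
  have : \forall s \near (0 : R), 0 < Ws s by apply: (cvgr_gt _ cW).
  apply: filterS => s Ws0; rewrite subr_ge0.
  have -> : Ws s = W (fun x => u x + s * h x).
    by apply: eq_Rintegral => x _; rewrite addrC.
  apply: hmin; first exact: H1_lin.
  by move: Ws0; congr (0 < _); apply: eq_Rintegral => x _; rewrite addrC.
by move=> /eqP; rewrite subr_eq0 => /eqP; apply: mulfI; rewrite pnatr_eq0.
Qed.

Lemma ground_state_critical (w : R) (u : E -> R) : 0 < w -> H1 u -> W u = w ->
  dirichlet u u = 2 / th * w ->
  (forall v : E -> R, H1 v -> 0 < W v ->
     2 / th * w `^ (1 - th) * W v `^ th <= dirichlet v v) ->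
  forall e : R, 0 < e -> exists2 d : R, 0 < d & forall h : E -> R, H1 h -> H1norm h <= d ->
    `|(2^-1 * dirichlet (fun x => u x + h x) (fun x => u x + h x) -
        W (fun x => u x + h x)) - (2^-1 * dirichlet u u - W u)| <= e * H1norm h.
Proof.
move=> w0 hu Wu Du hmin e e0; have e20 : 0 < e / 2 by rewrite divr_gt0.
have [d d0 hd] := H1_frechet n3 C0 cg G0 dG hg hu e20.
(* Besides the remainder of the nonlinear term there is [dirichlet h h / 2]; for a norm at most [e]
   it is at most [e / 2] times the norm. *)
exists (Num.min d e); first by rewrite lt_min d0.
move=> h hh; rewrite le_min => /andP[h1 h2]; have := hd h hh h1.
have E1 := ground_state_euler w0 hu Wu Du hmin hh.
have := dirichlet_lin2 1 hu hh.
have -> : (fun x => u x + 1 * h x) = (fun x => u x + h x).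
  by apply/funext => x; rewrite mul1r.
rewrite -E1 mulr1 expr1n mul1r => ->.
have -> : \int[mu]_x G (h x + u x) = W (fun x => u x + h x).
  by apply: eq_Rintegral => x _; rewrite addrC.
rewrite -/(W u); have D0 := dirichlet_ge0 h; have N0 := H1norm_ge0 h.
have DN : dirichlet h h <= e * H1norm h.
  apply: (@le_trans _ _ (H1norm h ^+ 2)); last by rewrite expr2 ler_wpM2r.
  rewrite H1norm_sqr// lerDl; apply: Rint_ge0 => x; exact: sqr_ge0.
move: DN D0; set Q := dirichlet h h; set B := dirichlet u h; set D := dirichlet u u.
set X := W _; set Y := W _; set z := H1norm h => DN Q0 H.
have -> : 2^-1 * (D + 2 * B + Q) - X - (2^-1 * D - Y) = 2^-1 * Q - (X - Y - B).
  by field.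
apply: (le_trans (ler_normB _ _)).
have -> : e * z = 2^-1 * (e * z) + e / 2 * z by field.
apply: lerD => //; rewrite ger0_norm ?mulr_ge0//.
by rewrite ler_wpM2l.
Qed.

(** On the constraint, division by [W v ^ th] turns the minimality inequality into
    [w ^ (1 - th) <= W v ^ (1 - th)]. *)
Lemma ground_state_level (w : R) (v : E -> R) : 0 < w ->
  (forall v : E -> R, H1 v -> 0 < W v ->
     2 / th * w `^ (1 - th) * W v `^ th <= dirichlet v v) ->
  H1 v -> 0 < W v -> dirichlet v v = 2 / th * W v -> w <= W v.
Proof.
move=> w0 hmin hv Wv Dv; have := hmin v hv Wv; rewrite Dv.
have t20 : 0 < 2 / th by rewrite divr_gt0.
have t10 : 0 < 1 - th by rewrite subr_gt0.
rewrite -mulrA ler_pM2l// -[leRHS](powRr1 (ltW Wv)) -[X in _ <= _ `^ X](subrK th).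
rewrite [X in _ <= X -> _]powRD; last by apply/implyP => _; exact: lt0r_neq0.
rewrite ler_pM2r ?powR_gt0// leNgt => h; rewrite leNgt; apply: contraNN h => h.
by apply: gt0_ltr_powR; rewrite ?nnegrE ?ltW.
Qed.

End ground_state.

(** * The autonomous problem *)

Section autonomous.
Context {R : realType} {N : nat} (N3 : (3 <= N)%N).
Variables (Vinf : R) (f : R -> R).
Local Notation E := 'rV[R]_N.
Local Notation mu := (lebesgue_rV N : {sigma_finite_measure set E -> \bar R}).
Local Notation th := (dim_ratio R N).

(** In terms of its integral [W], the Pohozaev constraint becomes [th / 2 * dirichlet u u = W u],
    and [Lambda] becomes [0 < W u]. *)
Definition reduced_primitive (t : R) : R := primitive f t - Vinf / 2 * t ^+ 2.

Local Notation G := reduced_primitive.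
Local Notation W := (nem_int reduced_primitive).

Hypothesis iG : forall u : E -> R, H1 u -> Rintegrable mu (fun x => G (u x)).

Let th0 : 0 < th := dim_ratio_gt0 N3.
Let th1 : th < 1 := dim_ratio_lt1 N3.

Let N0 : 0 < N%:R :> R.
Proof. by rewrite ltr0n (ltn_trans _ N3). Qed.

Lemma Rint_primitive (u : E -> R) : H1 u -> Rintegrable mu (fun x => primitive f (u x)) /\
  \int[mu]_x primitive f (u x) = W u + Vinf / 2 * \int[mu]_x u x ^+ 2.
Proof.
move=> hu; have u2 := sqint_int (H1_sqint hu).
have i2 := RintegrableZ (Vinf / 2) u2; have i1 := iG hu.
have FE x : G (u x) + Vinf / 2 * u x ^+ 2 = primitive f (u x) by rewrite /G subrK.
split; first exact: (eq_Rintegrable FE (RintegrableD i1 i2)).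
rewrite -(RintZ _ u2) /nem_int -(RintD i1 i2).
by apply: eq_Rintegral => x _; rewrite FE.
Qed.

Lemma energyE (u : E -> R) : H1 u -> energy Vinf f u = 2^-1 * dirichlet u u - W u.
Proof.
move=> hu; have u2 := sqint_int (H1_sqint hu); have [_ FE] := Rint_primitive hu.
rewrite /energy FE (RintD (grad_sqr_int hu) (RintegrableZ Vinf u2)).
rewrite (RintZ _ u2) (dirichletE hu).
set D := dirichlet u u; set I := \int[mu]_x _; set w := W u; by field.
Qed.

Lemma pohozaevE (u : E -> R) : H1 u ->
  pohozaev Vinf f u = N%:R * (th / 2 * dirichlet u u - W u).
Proof.
move=> hu; have [_ FE] := Rint_primitive hu.
rewrite /pohozaev FE (dirichletE hu) /dim_ratio.
set D := dirichlet u u; set I := \int[mu]_x _; set w := W u.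
by field; rewrite gt_eqF.
Qed.

Lemma LambdaP (u : E -> R) : Lambda N Vinf f u <-> H1 u /\ 0 < W u.
Proof.
suff h : H1 u -> \int[mu]_x (2^-1 * Vinf * u x ^+ 2 - primitive f (u x)) = - W u.
  by split => -[hu]; move: (h hu) => hE; rewrite ?hE => h0; split => //;
    move: h0; rewrite ?hE ?oppr_lt0.
move=> hu; rewrite -mulN1r -(RintZ _ (iG hu)); apply: eq_Rintegral => x _.
by rewrite /G; field.
Qed.

Lemma dilate_scaling (u : E -> R) (t : R) : 0 < t -> H1 u ->
  [/\ H1 (dilate t u), dirichlet (dilate t u) (dilate t u) = t ^+ N / t ^+ 2 * dirichlet u u &
      W (dilate t u) = t ^+ N * W u].
Proof.
move=> t0 hu; have ti0 : 0 < t^-1 by rewrite invr_gt0.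
have -> : dilate t u = (fun x => u (t^-1 *: x + 0%R)).
  by apply/funext => x; rewrite /dilate addr0.
have tN : t ^+ N != 0 by rewrite expf_neq0// gt_eqF.
split; first exact: H1_affine.
- have := dirichlet_affine 0%R ti0 hu; rewrite !exprVn => h.
  apply: (mulfI (invr_neq0 tN)); rewrite h; field; by rewrite tN gt_eqF.
- have := Rint_rV_affine 0%R ti0 (iG hu); rewrite exprVn => h.
  by rewrite /nem_int h mulVKf.
Qed.

(** Up to a positive factor the left side is the energy along a fibre, normalised to be critical at
    [s = 1]. The bound is Young's inequality for [s ^ (N - 2)] and 1 with exponents [1 / th] and
    [1 / (1 - th)], since [(N - 2) / th = N]. *)
Lemma dilate_profile_le (s : R) : 0 < s ->
  s ^+ N / s ^+ 2 / th - s ^+ N <= th^-1 - 1.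
Proof.
move=> s0; have t10 : 0 < 1 - th by rewrite subr_gt0.
have sN2 : s ^+ N / s ^+ 2 = s ^+ (N - 2).
  by rewrite -[in LHS](subnK (ltnW N3)) exprD mulfK// expf_neq0// gt_eqF.
have ti : 0 < th^-1 by rewrite invr_gt0.
have t1i : 0 < (1 - th)^-1 by rewrite invr_gt0.
have pq : th^-1^-1 + (1 - th)^-1^-1 = 1 by rewrite !invrK addrC subrK.
have := conjugate_powR (exprn_ge0 (N - 2) (ltW s0)) ler01 ti t1i pq.
rewrite mulr1 powR1 mul1r !invrK.
have -> : (s ^+ (N - 2)) `^ th^-1 = s ^+ N.
  rewrite -powR_mulrn ?(ltW s0)// -powRrM -[RHS]powR_mulrn ?(ltW s0)//.
  congr (_ `^ _); rewrite natrB ?(ltnW N3)// /dim_ratio invf_div mulrC divfK//.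
  by rewrite gt_eqF// subr_gt0 ltr_nat.
rewrite sN2 => h; rewrite -(ler_pM2r th0) mulrBl mulrBl divfK ?gt_eqF//.
by rewrite mulVf ?gt_eqF// mul1r; lra.
Qed.

Lemma dilate_max (u : E -> R) : H1 u -> 0 < W u -> 0 < dirichlet u u ->
  exists2 t : R, 0 < t &
    [/\ 0 < W (dilate t u),
        dirichlet (dilate t u) (dilate t u) = 2 / th * W (dilate t u) &
        forall s : R, 0 < s ->
          energy Vinf f (dilate s u) <= energy Vinf f (dilate t u)].
Proof.
move=> hu Wu Du.
have r0 : 0 < th * dirichlet u u / (2 * W u) 
  by apply: divr_gt0; apply: mulr_gt0.
(* The dilation that reaches the Pohozaev identity: the solution of [t ^ (N - 2) * dirichlet u u = 2
   / th * t ^ N * W u]. *)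
pose t := Num.sqrt (th * dirichlet u u / (2 * W u)).
have t0 : 0 < t by rewrite sqrtr_gt0.
have t2 : t ^+ 2 = th * dirichlet u u / (2 * W u) by rewrite sqr_sqrtr// ltW.
have tN : 0 < t ^+ N by rewrite exprn_gt0.
have [h1 h2 h3] := dilate_scaling t0 hu.
have DE : dirichlet u u = 2 / th * W u * t ^+ 2.
  by rewrite t2; field; rewrite !gt_eqF.
exists t; first exact: t0.
split; first by rewrite h3; exact: mulr_gt0.
  by rewrite h2 h3 DE; field; rewrite !gt_eqF.
move=> s s0; have [k1 k2 k3] := dilate_scaling s0 hu.
rewrite !energyE// k2 k3 h2 h3 DE.
(* At [s = q t] the energy is [t ^ N * W u] times the profile at [q]. *)
have [q q0 sE] : exists2 q, 0 < q & s = q * t.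
  by exists (s / t); [exact: divr_gt0|rewrite divfK// gt_eqF].
have qN : 0 < q ^+ N by rewrite exprn_gt0.
have q2 : 0 < q ^+ 2 by rewrite exprn_gt0.
rewrite sE !exprMn; have tt : 0 < t ^+ 2 by rewrite exprn_gt0.
have := ler_wpM2l (ltW (mulr_gt0 tN Wu)) (dilate_profile_le q0).
move: (t ^+ N) (t ^+ 2) (q ^+ N) (q ^+ 2) (W u) tN tt qN q2 Wu => T2 T3 Q2 Q3 w *.
have -> : 2^-1 * (Q2 * T2 / (Q3 * T3) * (2 / th * w * T3)) - Q2 * T2 * w =
    T2 * w * (Q2 / Q3 / th - Q2) by field; rewrite !gt_eqF.
have -> : 2^-1 * (T2 / T3 * (2 / th * w * T3)) - T2 * w = T2 * w * (th^-1 - 1).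
  by field; rewrite !gt_eqF.
by [].
Qed.

End autonomous.

Theorem theorem1p3 (R : realType) (N : nat) (Vinf : R) (f : R -> R)
  (hN : (3 <= N)%N)
  (hV : 0 < Vinf)
  (hf_cont : continuous f)
  (hf_growth : exists2 C0 : R, 0 < C0 &
    forall t : R, `|f t| <= C0 * (1 + `|t| `^ (critical_exponent N - 1)))
  (hf_zero : f t / t @[t --> (0 : R)^'] --> (0 : R))
  (hf_pinfty : `|f t| / `|t| `^ ((N%:R + 2) / (N%:R - 2)) @[t --> +oo] --> (0 : R))
  (hf_ninfty : `|f t| / `|t| `^ ((N%:R + 2) / (N%:R - 2)) @[t --> -oo] --> (0 : R))
  (hF : exists2 s0 : R, 0 < s0 & primitive f s0 > 2^-1 * Vinf * s0 ^+ 2) :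
  (forall u : 'rV[R]_N -> R, Lambda N Vinf f u -> exists2 t : R, 0 < t &
    forall s : R, 0 < s ->
      energy Vinf f (dilate s u) <= energy Vinf f (dilate t u)) /\
  exists ubar : 'rV[R]_N -> R,
    [/\ is_solution Vinf f ubar,
        (energy Vinf f ubar)%:E =
          ereal_inf [set (energy Vinf f u)%:E | u in pohozaev_manifold N Vinf f],
        (energy Vinf f ubar)%:E =
          ereal_inf [set ereal_sup [set (energy Vinf f (dilate t u))%:E
                                   | t in [set t : R | 0 < t]]
                    | u in Lambda N Vinf f]
      & 0 < energy Vinf f ubar].
Proof.
have N3R : 3 <= N%:R :> R by rewrite ler_nat.
have p2 := critical_exponent_gt2 hN (R := R); set p : R := critical_exponent N in p2 *.
have pE : (N%:R + 2) / (N%:R - 2) = p - 1.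
  by rewrite /p /critical_exponent; field; rewrite gt_eqF//; lra.
rewrite pE in hf_pinfty hf_ninfty.
pose G := reduced_primitive Vinf f; pose g t := f t - Vinf * t.
have [C C0 hC] := growth_global hf_cont hf_growth hf_zero.
have cg : continuous g.
  move=> t; apply: (@continuousB R R R f (fun t => Vinf * t)); first exact: hf_cont.
  by apply: (@continuousM R R (cst Vinf) id); [exact: cst_continuous|exact: cvg_id].
have G0 : G 0 = 0 by rewrite /G /reduced_primitive primitive0 expr0n mulr0 subr0.
have dG (t : R) : is_derive t 1 G (g t).
  have d1 := primitive_is_derive hf_cont t.
  have d2 : is_derive t 1 (fun s : R => Vinf / 2 * s ^+ 2) (Vinf * t).
    have := is_deriveM (is_derive_cst (Vinf / 2) t 1) (is_deriveX 2 (is_derive_id t 1)).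
    move=> d3; apply: (is_derive_val d3).
    by rewrite /GRing.scale/= mulr0 addr0 expr1 mulr1; field.
  exact: is_deriveB.
have CV : 0 <= C + Vinf by rewrite addr_ge0// ltW.
have hg t : `|g t| <= (C + Vinf) * mixed_dpow p t.
  rewrite mulrDl (le_trans (ler_normB _ _))// lerD// normrM (gtr0_norm hV).
  by rewrite ler_wpM2l ?(ltW hV)// lerDl powR_ge0.
have hG e : 0 < e -> exists2 d : R, 0 < d & exists2 K : R, 0 <= K &
    forall t, G t <= e * mixed_pow p t + K * (d <= `|t|)%R%:R - Vinf / 2 * t ^+ 2.
  move=> e0; have [d d0 [K K0 hK]] :=
    primitive_small p2 hf_cont hf_growth hf_zero hf_pinfty hf_ninfty e0.
  exists d => //; exists K => // t; rewrite lerD2r.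
  exact: le_trans (ler_norm _) (hK t).
have hs : exists2 s, 0 < s & 0 < G s.
  have [s s0 hs] := hF; exists s => //; rewrite /G /reduced_primitive subr_gt0.
  by rewrite [Vinf / 2]mulrC.
have iG u : H1 u -> Rintegrable (lebesgue_rV N) (fun x => G (u x)).
  by move=> hu; exact: (nem_integrable p2 CV G0 dG hg (H1_mixed_class hN hu)).
have [w [u [w0 hu Wu Du hmin]]] := ground_state_exists hN hV CV G0 dG hg hG hs.
have th0 := dim_ratio_gt0 hN (R := R); have th1 := dim_ratio_lt1 hN (R := R).
set th := dim_ratio R N in th0 th1 Du hmin.
have t20 : 0 < 2 / th by rewrite divr_gt0.
have c0 : 0 < th^-1 - 1 by rewrite subr_gt0 invf_gt1.
have energy_level (v : 'rV[R]_N -> R) : H1 v -> dirichlet v v = 2 / th * nem_int G v ->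
    energy Vinf f v = (th^-1 - 1) * nem_int G v.
  by move=> hv Dv; rewrite (energyE iG hv) Dv -/G; field; rewrite gt_eqF.
have Wpos (v : 'rV[R]_N -> R) : H1 v -> 0 < nem_int G v -> 0 < dirichlet v v.
  move=> hv Wv; apply: lt_le_trans (hmin v hv Wv).
  by apply: mulr_gt0; rewrite ?powR_gt0//; apply: mulr_gt0; rewrite ?powR_gt0.
have level_ge (v : 'rV[R]_N -> R) : H1 v -> 0 < nem_int G v -> dirichlet v v = 2 / th * nem_int G v ->
    energy Vinf f u <= energy Vinf f v.
  move=> hv Wv Dv; rewrite !energy_level ?Wu// ler_wpM2l ?(ltW c0)//.
  exact: (ground_state_level hN w0 hmin hv Wv Dv).
split.
  (* The supremum over each fibre is attained, so it is a maximum. *)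
  move=> v /(LambdaP iG)[hv Wv].
  by have [t t0 [_ _ ht]] := dilate_max hN iG hv Wv (Wpos v hv Wv); exists t.
have Du0 : dirichlet u u = 2 / th * nem_int G u by rewrite Wu.
have Wu0 : 0 < nem_int G u by rewrite Wu.
exists u; split.
- split => // e e0.
  have [d d0 hd] := ground_state_critical hN CV cg G0 dG hg w0 hu Wu Du hmin e0.
  exists d => // h hh hhd.
  by rewrite (energyE iG (H1D hu hh)) (energyE iG hu); exact: hd.
- apply/eqP; rewrite eq_le; apply/andP; split.
    apply: le_ereal_inf_tmp => _ [v [hv vn0 vP] <-]; rewrite lee_fin.
    rewrite (pohozaevE hN iG hv) in vP.
    have Dv : dirichlet v v = 2 / th * nem_int G v.
      move/eqP : vP; rewrite mulf_eq0 gt_eqF ?ltr0n ?(ltn_trans _ hN)//= subr_eq0.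
      by move=> /eqP <-; rewrite -/th; field; rewrite gt_eqF.
    apply: level_ge => //.
    (* On the manifold [nem_int G v] is a positive multiple of the Dirichlet form, which can vanish
       only if [v] is zero almost everywhere. *)
    have : 0 < dirichlet v v.
      rewrite lt_neqAle dirichlet_ge0 andbT eq_sym; apply/eqP => D0.
      by apply: vn0; apply: filterS (H1_dirichlet0 hN hv D0) => x ->.
    by rewrite Dv pmulr_rgt0.
  apply: ereal_inf_lbound; exists u => //; split => //.
    move=> u0; have : nem_int G u = 0.
      rewrite /nem_int -[RHS](@Rint_cst0 _ _ _ (lebesgue_rV N)); apply: Rint_ae_eq => //.
        exact: Rintegrable_meas (iG _ hu).
      by apply: filterS u0 => x /(_ I) ->; rewrite /= G0.
    by move=> h; rewrite h ltxx in Wu0.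
  rewrite (pohozaevE hN iG hu) Du0 -/th -/G.
  have -> : th / 2 * (2 / th * nem_int G u) - nem_int G u = 0.
    by field; rewrite gt_eqF.
  by rewrite mulr0.
- apply/eqP; rewrite eq_le; apply/andP; split.
    apply: le_ereal_inf_tmp => _ [v /(LambdaP iG)[hv Wv] <-].
    (* The highest point of the fibre satisfies the Pohozaev identity, so its energy is at least
       that of [u]. *)
    have [t t0 [Wt Dt _]] := dilate_max hN iG hv Wv (Wpos v hv Wv).
    have [ht _ _] := dilate_scaling iG t0 hv.
    apply: (@le_trans _ _ (energy Vinf f (dilate t v))%:E).
      by rewrite lee_fin; exact: level_ge.
    by apply: ereal_sup_ubound; exists t.
  have [t t0 [_ Dt ht]] := dilate_max hN iG hu Wu0 (Wpos u hu Wu0).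
  apply: (@le_trans _ _ (ereal_sup [set (energy Vinf f (dilate t u))%:E
                                   | t in [set t : R | 0 < t]])).
    by apply: ereal_inf_lbound; exists u => //; exact/(LambdaP iG).
  apply: ge_ereal_sup => _ [s s0 <-]; rewrite lee_fin; apply: (le_trans (ht s s0)).
  have [h1 h2 h3] := dilate_scaling iG t0 hu.
  (* Both [u] and its highest dilate satisfy the Pohozaev identity, whose two sides scale
     differently; this forces [t ^ 2 = 1]. *)
  have t1 : t = 1.
    have tN : t ^+ N != 0 by rewrite expf_neq0// gt_eqF.
    have : t ^+ 2 = 1.
      move: Dt; rewrite h2 h3 Du0 -/th -/G => Dt.
      have W0 : nem_int G u != 0 by rewrite gt_eqF.
      have tt : t ^+ 2 != 0 by rewrite expf_neq0// gt_eqF.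
      apply: (mulIf (mulf_neq0 tN (mulf_neq0 (lt0r_neq0 t20) W0))).
      rewrite mul1r.
      have {}Dt : t ^+ N * (2 / th * nem_int G u) =
          t ^+ N / t ^+ 2 * (2 / th * nem_int G u) by rewrite Dt mulrCA.
      by rewrite {1}Dt (mulrC (t ^+ N)) -(mulrA (t ^+ 2)^-1) mulVKf.
    by move=> t21; apply/eqP; rewrite -(@eqrXn2 _ 2)// ?t21 ?expr1n// ltW.
  rewrite t1 (_ : dilate 1 u = u); first exact: lexx.
  by apply/funext => x; rewrite /dilate invr1 scale1r.
- by rewrite energy_level// mulr_gt0.
Qed.
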